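(* Let $T(y)=My+c$ with $M\in\mathbb R^{d\times d}$ invertible and $c\in\mathbb R^d$, let $\Omega:=T(S)$, $v_i:=Me_i$, and let $I=\{i_1<\cdots<i_k\}\subseteq[d]$ be nonempty, $k=|I|$. Let $f$ be a probability density on $\Omega$. (i) If $f\in BV(\Omega)$ and $\varphi\circ T\in L^\infty(S)$, then $$\left|\int_\Omega\varphi f\right|\le\frac1{2k}\Lambda_{\mathrm{sl},T}^I(\mathcal P_I^T\varphi)\sum_{i\in I}|D_{v_i}f|(\Omega)+\|\mathcal R_I^T\varphi\|_{L^\infty(\Omega)}.$$ (ii) If $f\in C^k(\overline\Omega)$ and $\varphi\circ T\in L^\infty(S)$, then $$\left|\int_\Omega\varphi f\right|\le2^{-k}\Lambda_{\mathrm{mix},T}^I(\mathcal P_I^T\varphi)\int_\Omega\left|(v_{i_1}\cdot\nabla)\cdots(v_{i_k}\cdot\nabla)f(x)\right|dx+\|\mathcal R_I^T\varphi\|_{L^\infty(\Omega)}.$$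
   Context: Let $d\ge 1$, $[d]=\{1,\dots,d\}$, and let $S=\prod_{i=1}^d[a_i,b_i]\subset\mathbb R^d$ be a box with $a_i<b_i$; $e_i$ are the standard basis vectors. For $I\subseteq[d]$ write $\omega_I=(\omega_i)_{i\in I}$, $\omega_{-I}=(\omega_j)_{j\notin I}$, $S_I=\prod_{i\in I}[a_i,b_i]$, $S_{-I}=\prod_{j\notin I}[a_j,b_j]$ (a singleton if $I=[d]$), and $-i$ for $-\{i\}$. A probability density is a nonnegative integrable function with integral $1$. On $S$: $(\Pi_i\psi)(\omega)=\frac1{b_i-a_i}\int_{a_i}^{b_i}\psi(\omega_{-i},t)\,dt$ ($t$ inserted in coordinate $i$), and $$\Lambda_{\mathrm{sl}}^I(\psi)=\max_{i\in I}\operatorname*{ess\,sup}_{\omega_{-i}\in S_{-i}}\int_{a_i}^{b_i}|\psi(\omega_{-i},t)|\,dt,\qquad \Lambda_{\mathrm{mix}}^I(\psi)=\operatorname*{ess\,sup}_{\omega_{-I}\in S_{-I}}\int_{S_I}|\psi(\omega_{-I},t_I)|\,dt_I.$$ Transported to $\Omega=T(S)$: $(\Pi_i^T\varphi)\circ T:=\Pi_i(\varphi\circ T)$ (these operators commute), $\mathcal P_I^T:=\prod_{i\in I}(\mathrm{Id}-\Pi_i^T)$, $\mathcal R_I^T:=\mathrm{Id}-\mathcal P_I^T$, $\Lambda_{\mathrm{sl},T}^I(\varphi):=\Lambda_{\mathrm{sl}}^I(\varphi\circ T)$, $\Lambda_{\mathrm{mix},T}^I(\varphi):=\Lambda_{\mathrm{mix}}^I(\varphi\circ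 T)$. For $f\in BV(\Omega)$ and $v\in\mathbb R^d$, $D_vf:=v\cdot Df$ is the directional derivative measure on the interior of $\Omega$, and $|D_vf|(\Omega)$ its total variation mass there. $C^k(\overline\Omega)$: functions $C^k$ up to the boundary of $\Omega$. *)

(* Defs.v *)
From HB Require Import structures.
From mathcomp Require Import all_boot all_order all_algebra.
From mathcomp Require Import all_classical all_reals all_analysis.
From mathcomp Require Import ess_sup_inf.
Set Implicit Arguments.
Unset Strict Implicit.
Unset Printing Implicit Defensive.
Import Order.TTheory GRing.Theory Num.Theory.
Import numFieldNormedType.Exports.
Local Open Scope classical_set_scope.
Local Open Scope ring_scope.

Definition measure_cV_display : measure_display -> measure_display.
Proof. exact. Qed.

Section measurable_cV.
Context {d} {T : sigmaRingType d}.
Variable n : nat.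

Let coors : 'I_n -> 'cV[T]_n -> T := fun i x => x i ord0.

Let cV_set0 : g_sigma_preimage coors set0.
Proof. exact: sigma_algebra0. Qed.

Let cV_setC A : g_sigma_preimage coors A -> g_sigma_preimage coors (~` A).
Proof. exact: sigma_algebraC. Qed.

Let cV_bigcup (F : _^nat) : (forall i, g_sigma_preimage coors (F i)) ->
  g_sigma_preimage coors (\bigcup_i (F i)).
Proof. exact: sigma_algebra_bigcup. Qed.

(* The product sigma-algebra on column vectors (the same construction as the
   library's for tuples); over the reals it is the Borel sigma-algebra. *)
HB.instance Definition _ := @isMeasurable.Build (measure_cV_display d)
  'cV[T]_n (g_sigma_preimage coors) cV_set0 cV_setC cV_bigcup.

End measurable_cV.

Section lebesgue_cV.
Context {R : realType}.
Local Open Scope ereal_scope.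

Definition cons_cV n (xu : measurableTypeR R * 'cV[R]_n) : 'cV[R]_n.+1 :=
  col_mx (const_mx xu.1 : 'cV[R]_1) xu.2.

(* Lebesgue measure on R^n, as an n-fold product of the one on R. *)
Fixpoint lebesgue_cV n : set 'cV[R]_n -> \bar R :=
  match n return set 'cV[R]_n -> \bar R with
  | 0 => dirac (0%R : 'cV[R]_0)
  | n'.+1 => pushforward (lebesgue_measure \x @lebesgue_cV n') (@cons_cV n')
  end.

Lemma measurable_cV_coord n (i : 'I_n) :
  measurable_fun [set: 'cV[R]_n] (fun x => x i ord0 : measurableTypeR R).
Proof.
move=> _ Y mY; rewrite setTI; apply: sub_sigma_algebra => /=.
rewrite -bigcup_seq/=; exists i => /=; first by rewrite mem_index_enum.
by exists Y => //; rewrite setTI.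
Qed.

Lemma measurable_fun_cV d (T : measurableType d) n (f : T -> 'cV[R]_n) :
  (forall i, measurable_fun setT (fun x => f x i ord0 : measurableTypeR R)) ->
  measurable_fun setT f.
Proof.
move=> mf.
suff: g_sigma_preimage (fun i => (fun x : 'cV[R]_n => x i ord0 : measurableTypeR R) \o f)
    `<=` measurable.
  rewrite g_sigma_preimage_comp => prefS.
  by move=> _ A mA; apply: prefS; exists A.
apply: smallest_sub; first exact: sigma_algebra_measurable.
case: n => [|n] in f mf *; first by rewrite big_ord0.
rewrite -bigcup_mkord_ord; apply: bigcup_sub => i Ii.
by move=> A [B mB <-]; exact: mf.
Qed.

Lemma cons_cV_lshift n xu i :
  @cons_cV n xu (lshift n i : 'I_(1 + n)) ord0 = xu.1.
Proof. by rewrite /cons_cV [LHS]col_mxEu mxE. Qed.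

Lemma cons_cV_rshift n xu j :
  @cons_cV n xu (rshift 1 j : 'I_(1 + n)) ord0 = xu.2 j ord0.
Proof. exact: col_mxEd. Qed.

Lemma measurable_cons_cV n : measurable_fun setT (@cons_cV n).
Proof.
apply: measurable_fun_cV => i.
have [j ->|j ->] := split_ordP (i : 'I_(1 + n)).
  rewrite (_ : (fun _ => _) = fst)//.
  by apply/funext => x; exact: cons_cV_lshift.
rewrite (_ : (fun _ => _) =
  (fun x : 'cV[R]_n => x j ord0 : measurableTypeR R) \o snd).
  by apply: measurableT_comp => //; exact: measurable_cV_coord.
by apply/funext => x; exact: cons_cV_rshift.
Qed.

Definition uncons_cV n (x : 'cV[R]_n.+1) : measurableTypeR R * 'cV[R]_n :=
  ((usubmx (x : 'cV[R]_(1 + n))) ord0 ord0, dsubmx (x : 'cV[R]_(1 + n))).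

Lemma cons_cVK n : cancel (@cons_cV n) (@uncons_cV n).
Proof.
by move=> [x u]; rewrite /uncons_cV /cons_cV col_mxKu col_mxKd mxE.
Qed.

Lemma uncons_cVK n : cancel (@uncons_cV n) (@cons_cV n).
Proof.
move=> x; rewrite -[RHS](@vsubmxK _ 1 n 1 x) /cons_cV /=.
have -> : const_mx (@usubmx R 1 n 1 x ord0 ord0) = @usubmx R 1 n 1 x.
  by apply/matrixP => i j; rewrite [LHS]mxE !ord1.
by [].
Qed.

Lemma measurable_uncons_cV n : measurable_fun setT (@uncons_cV n).
Proof.
apply/measurable_fun_pairP; split => /=.
  rewrite (_ : _ \o _ =
    (fun x : 'cV[R]_n.+1 => x (lshift n (ord0 : 'I_1)) ord0 : measurableTypeR R)).
    exact: measurable_cV_coord.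
  by apply/funext => x; rewrite /= mxE.
apply: measurable_fun_cV => i.
rewrite (_ : (fun _ => _) =
    (fun x : 'cV[R]_n.+1 => x (rshift 1 i) ord0 : measurableTypeR R)).
  exact: measurable_cV_coord.
by apply/funext => x; rewrite /= mxE.
Qed.

Section lebesgue_cV_step.
Variables (n : nat) (mu : {sigma_finite_measure set 'cV[R]_n -> \bar R}).

Definition lebesgue_cV_rec : set 'cV[R]_n.+1 -> \bar R :=
  pushforward (lebesgue_measure \x mu) (@cons_cV n).

Local Notation step := lebesgue_cV_rec.

Let step0 : step set0 = 0.
Proof. by rewrite /lebesgue_cV_rec /pushforward preimage_set0 measure0. Qed.

Let step_ge0 A : 0 <= step A.
Proof. by rewrite /lebesgue_cV_rec /pushforward; exact: measure_ge0. Qed.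

Let step_sigma_additive : semi_sigma_additive step.
Proof.
have mf := @measurable_cons_cV n.
move=> F mF tF mUF; rewrite /lebesgue_cV_rec /pushforward preimage_bigcup.
apply: measure_semi_sigma_additive.
- by move=> k; rewrite -[X in measurable X]setTI; exact: mf.
- apply/trivIsetP => /= i j _ _ ij; rewrite -preimage_setI.
  by move/trivIsetP : tF => /(_ _ _ _ _ ij) ->//; rewrite preimage_set0.
- by rewrite -preimage_bigcup -[X in measurable X]setTI; exact: mf.
Qed.

HB.instance Definition _ :=
  isMeasure.Build _ _ _ step step0 step_ge0 step_sigma_additive.

Let step_sigma_finite : sigma_finite setT step.
Proof.
have /sigma_finiteP[F [TF ndF Foo]] := sigma_finiteT (@lebesgue_measure R).
have /sigma_finiteP[G [TG ndG Goo]] := sigma_finiteT mu.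
exists (fun k => @uncons_cV n @^-1` (F k `*` G k)).
  rewrite -preimage_bigcup (_ : \bigcup_k _ = setT) ?preimage_setT//.
  apply/seteqP; split => // -[x u] _.
  have [i _ Fx] : (\bigcup_k F k) x by rewrite -TF.
  have [j _ Gu] : (\bigcup_k G k) u by rewrite -TG.
  exists (maxn i j) => //; split => /=.
    by move: x Fx; exact/subsetPset/ndF/leq_maxl.
  by move: u Gu; exact/subsetPset/ndG/leq_maxr.
move=> k; have [mF Fk] := Foo k; have [mG Gk] := Goo k; split.
  rewrite -[X in measurable X]setTI; apply: measurable_uncons_cV => //.
  exact: measurableX.
rewrite /lebesgue_cV_rec /pushforward -comp_preimage (_ : _ \o _ = id).
  by rewrite preimage_id product_measure1E// lte_mul_pinfty// ge0_fin_numE.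
by apply/funext => x; exact: cons_cVK.
Qed.

HB.instance Definition _ :=
  Measure_isSigmaFinite.Build _ _ _ step step_sigma_finite.

Lemma lebesgue_cV_step :
  exists nu : {sigma_finite_measure set 'cV[R]_n.+1 -> \bar R},
    step = nu.
Proof. by exists step. Qed.

End lebesgue_cV_step.

Lemma lebesgue_cV_subproof n :
  exists mu : {sigma_finite_measure set 'cV[R]_n -> \bar R},
    @lebesgue_cV n = mu.
Proof.
elim: n => [|n [mu muE]] /=; first by exists (dirac (0%R : 'cV[R]_0)).
by rewrite muE; exact: lebesgue_cV_step.
Qed.

Section lebesgue_cV_measure.
Variable n : nat.

Let lebesgue_cV0 : @lebesgue_cV n set0 = 0.
Proof. by have [mu ->] := lebesgue_cV_subproof n; exact: measure0. Qed.

Let lebesgue_cV_ge0 A : 0 <= @lebesgue_cV n A.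
Proof. by have [mu ->] := lebesgue_cV_subproof n; exact: measure_ge0. Qed.

Let lebesgue_cV_sigma_additive : semi_sigma_additive (@lebesgue_cV n).
Proof.
have [mu ->] := lebesgue_cV_subproof n; exact: measure_semi_sigma_additive.
Qed.

HB.instance Definition _ := isMeasure.Build _ _ _ (@lebesgue_cV n)
  lebesgue_cV0 lebesgue_cV_ge0 lebesgue_cV_sigma_additive.

Let lebesgue_cV_sigma_finite : sigma_finite setT (@lebesgue_cV n).
Proof. by have [mu ->] := lebesgue_cV_subproof n; exact: sigma_finiteT. Qed.

HB.instance Definition _ :=
  Measure_isSigmaFinite.Build _ _ _ (@lebesgue_cV n) lebesgue_cV_sigma_finite.

End lebesgue_cV_measure.

Lemma lebesgue_cV_box n (A : 'I_n -> set R) : (forall i, measurable (A i)) ->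
  lebesgue_cV [set x : 'cV[R]_n | forall i, A i (x i ord0)] =
  \prod_(i < n) lebesgue_measure (A i).
Proof.
elim: n A => [|n IHn] A mA.
  rewrite big_ord0 /= diracE mem_set//; by case.
rewrite big_ord_recl -(IHn (A \o lift ord0))//; last by move=> i; exact: mA.
have [mu muE] := lebesgue_cV_subproof n.
have mB : measurable [set x : 'cV[R]_n | forall i, (A \o lift ord0) i (x i ord0)].
  rewrite (_ : [set x | _] = \bigcap_(i in [set: 'I_n])
      ((fun x : 'cV[R]_n => x i ord0 : measurableTypeR R) @^-1` A (lift ord0 i))).
    apply: fin_bigcap_measurable; first exact: finite_finset.
    move=> i _; rewrite -[X in measurable X]setTI.
    by apply: measurable_cV_coord => //; exact: mA.
  by apply/seteqP; split => x /= Ax i; [move=> _|]; apply: Ax.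
rewrite /= /pushforward muE.
apply: etrans; last exact: (@product_measure1E _ _ (measurableTypeR R) _ _
  (@lebesgue_measure R) mu _ _ (mA ord0) mB).
apply: (congr1 (lebesgue_measure \x mu)); apply/seteqP; split => -[x u] /=.
  move=> Ax; split => [|i].
    have := Ax (lshift n (ord0 : 'I_1)); rewrite cons_cV_lshift /=.
    by rewrite (_ : lshift n ord0 = ord0)//; apply/val_inj.
  have := Ax (rshift 1 i); rewrite cons_cV_rshift /=.
  by rewrite (_ : rshift 1 i = lift ord0 i)//; apply/val_inj.
move=> [Ax Au] i; have [j ->|j ->] := split_ordP (i : 'I_(1 + n)).
  rewrite cons_cV_lshift /= (_ : lshift n j = ord0)//.
  by apply/val_inj; rewrite ord1.
rewrite cons_cV_rshift /= (_ : rshift 1 j = lift ord0 j)//.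
exact/val_inj.
Qed.

End lebesgue_cV.

Section essential_supremum.
Local Open Scope ereal_scope.
Context d (T : measurableType d) (R : realType).

(* Off D the function is replaced by -oo, the neutral value for suprema. *)
Definition ess_sup_on (mu : {measure set T -> \bar R}) (D : set T)
  (g : T -> \bar R) : \bar R := ess_sup mu (patch (cst -oo) D g).

End essential_supremum.

Section signed_measures.
Local Open Scope ereal_scope.
Context d (T : measurableType d) (R : realType).
Implicit Types nu : {charge set T -> \bar R}.

Lemma hahn_sets_subproof nu :
  exists PN : set T * set T, hahn_decomposition nu PN.1 PN.2.
Proof. by have [P [N PN]] := Hahn_decomposition nu; exists (P, N). Qed.

Definition hahn_sets nu := cid (hahn_sets_subproof nu).

Definition charge_integral nu (D : set T) (g : T -> R) : \bar R :=
  \int[jordan_pos (svalP (hahn_sets nu))]_(x in D) (g x)%:E -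
  \int[jordan_neg (svalP (hahn_sets nu))]_(x in D) (g x)%:E.

Definition total_variation nu : set T -> \bar R :=
  charge_variation (svalP (hahn_sets nu)).

Definition charge_add (nu1 nu2 : {charge set T -> \bar R}) :
  {charge set T -> \bar R} := cadd nu1 nu2.

Definition charge_zero : {charge set T -> \bar R} := czero.

Definition charge_scale (r : R) nu : {charge set T -> \bar R} := cscale r nu.

End signed_measures.

Section euclidean.
Context {R : realType} {d : nat}.
Local Notation E := 'cV[R]_d.
Local Notation lambda := (@lebesgue_cV R d).
Implicit Types (Omega : set E) (f g : E -> R).

Definition basis_vec (i : 'I_d) : E := delta_mx i ord0.

Definition prob_density Omega f :=
  [/\ forall x, Omega x -> 0 <= f x,
      lambda.-integrable Omega (EFin \o f) &
      (\int[lambda]_(x in Omega) (f x)%:E = 1)%E].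

Definition Linfty_norm Omega f : \bar R :=
  ess_sup_on lambda Omega (fun x => `|f x|%:E).

Definition Linfty Omega f :=
  measurable_fun Omega f /\ (Linfty_norm Omega f < +oo)%E.

(* C^k up to the boundary, for Omega the closure of its interior: f is
   continuous on Omega, differentiable inside, and its partial derivatives
   extend to functions that are C^(k-1) up to the boundary. *)
Fixpoint Ck_closure (k : nat) Omega f : Prop :=
  {within Omega, continuous f} /\
  if k is k'.+1 then
    (forall x, Omega° x -> differentiable f x) /\
    forall j : 'I_d, exists2 g, (forall x, Omega° x -> g x = 'D_(basis_vec j) f x)
                     & Ck_closure k' Omega g
  else True.

(* Test functions for weak derivatives are C^1 with compact support in U. *)
Definition C1_compact_support (U : set E) f :=
  [/\ forall x, differentiable f x,
      forall j : 'I_d, continuous ('D_(basis_vec j) f) &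
      exists K : set E, [/\ compact K, K `<=` U & forall x, ~ K x -> f x = 0]].

(* Only the restriction of the charges Df j to Borel subsets of the interior of
   Omega is constrained (and then determined). *)
Definition is_gradient_measure Omega f (Df : 'I_d -> {charge set E -> \bar R}) :=
  forall (j : 'I_d) (eta : E -> R), C1_compact_support Omega° eta ->
    (\int[lambda]_(x in Omega°) (f x * 'D_(basis_vec j) eta x)%:E =
     - charge_integral (Df j) Omega° eta)%E.

Definition BV Omega f :=
  lambda.-integrable Omega (EFin \o f) /\ exists Df, is_gradient_measure Omega f Df.

Definition gradient_measure Omega f : 'I_d -> {charge set E -> \bar R} :=
  if pselect (exists Df, is_gradient_measure Omega f Df) is left H
  then sval (cid H) else fun=> charge_zero _ _.

Definition directional_measure Omega f (v : E) : {charge set E -> \bar R} :=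
  \big[@charge_add _ _ _/charge_zero _ _]_(j < d)
    charge_scale (v j ord0) (gradient_measure Omega f j).

Definition directional_variation Omega f (v : E) : \bar R :=
  total_variation (directional_measure Omega f v) Omega°.

(* (v i_1 . grad) ... (v i_k . grad) f for I = {i_1 < ... < i_k} (enum I is
   increasing). *)
Definition mixed_derivative (I : {set 'I_d}) (v : 'I_d -> E) f : E -> R :=
  foldr (fun i g => 'D_(v i) g) f (enum I).

(* R^J is 'cV_#|J|, its coordinates being listed along the increasing
   enumeration of J; embed is the inclusion of R^J in R^d, so that
   (w_(-I), t_I) is embed (~: I) w + embed I t. *)
Definition embed (J : {set 'I_d}) (u : 'cV[R]_#|J|) : E :=
  \sum_(k < #|J|) u k ord0 *: basis_vec (enum_val k).

Section box.
Variables a b : 'I_d -> R.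

Definition box : set E := [set w | forall i, a i <= w i ord0 <= b i].

Definition box_on (J : {set 'I_d}) : set 'cV[R]_#|J| :=
  [set u | forall k, a (enum_val k) <= u k ord0 <= b (enum_val k)].

Definition set_coord (w : E) (i : 'I_d) (t : R) : E :=
  \col_j (if j == i then t else w j ord0).

Definition slice_mean (i : 'I_d) (psi : E -> R) : E -> R := fun w =>
  (b i - a i)^-1 *
  \int[lebesgue_measure]_(t in `[a i, b i]) psi (set_coord w i t).

Definition Lambda_sl (I : {set 'I_d}) (psi : E -> R) : \bar R :=
  (\big[maxe/-oo]_(i in I)
    ess_sup_on (@lebesgue_cV R #|~: [set i]%SET|) (@box_on (~: [set i])%SET)
      (fun w => \int[lebesgue_measure]_(t in `[a i, b i])
                 `|psi (embed w + t *: basis_vec i)%R|%:E))%E.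

Definition Lambda_mix (I : {set 'I_d}) (psi : E -> R) : \bar R :=
  (ess_sup_on (@lebesgue_cV R #|~: I|) (@box_on (~: I)%SET)
    (fun w => \int[@lebesgue_cV R #|I|]_(t in @box_on I)
               `|psi (embed w + embed t)%R|%:E))%E.

End box.

Section transported.
Variables (a b : 'I_d -> R) (M : 'M[R]_d) (c : E).

Definition affine (y : E) : E := M *m y + c.

Definition affine_inv (x : E) : E := invmx M *m (x - c).

Definition slice_meanT (i : 'I_d) (phi : E -> R) : E -> R :=
  slice_mean a b i (phi \o affine) \o affine_inv.

(* The factors commute up to null sets; a fixed order is used. *)
Definition P_T (I : {set 'I_d}) (phi : E -> R) : E -> R :=
  foldr (fun i g => g \- slice_meanT i g) phi (enum I).

Definition R_T (I : {set 'I_d}) (phi : E -> R) : E -> R := phi \- P_T I phi.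

Definition Lambda_slT (I : {set 'I_d}) (phi : E -> R) : \bar R :=
  Lambda_sl a b I (phi \o affine).

Definition Lambda_mixT (I : {set 'I_d}) (phi : E -> R) : \bar R :=
  Lambda_mix a b I (phi \o affine).

End transported.

End euclidean.

(* Main.v *)
Require Import Defs.
From HB Require Import structures.
From mathcomp Require Import all_boot all_order all_algebra.
From mathcomp Require Import all_classical all_reals all_analysis.
From mathcomp Require Import ess_sup_inf measurable_realfun ring lra.
Import Order.TTheory GRing.Theory Num.Theory.
Import numFieldNormedType.Exports.
Set Implicit Arguments.
Unset Strict Implicit.
Unset Printing Implicit Defensive.
Local Open Scope classical_set_scope.
Local Open Scope ring_scope.

(** Everything happens on the box S.  Since phi is the sum of P phi and R phi
and f is a probability density, R phi contributes at most its sup norm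
([split_bound]), and the integral of (P phi) f remains.  Up to a null set,
(P phi) o T is a bounded measurable function psi whose integral over every
segment of S parallel to e_i, i in I, is zero ([line_int_mean_free]).

The constant 1/2 comes from the primitive of such a psi along e_i: at a point
of a segment it is the integral of psi up to that point, and also minus the
integral beyond that point, so its absolute value is at most half the integral
of |psi| over the segment ([line_prim_le_half]).

For f of bounded variation one integrates by parts once, in a direction i of I,
against the charge D_(v_i) f.  The definition of the gradient measure gives the
formula for C^1 test functions only, whereas psi is merely bounded and
measurable.  Both sides are linear in psi and continuous for bounded pointwise
convergence, so that by a monotone class argument ([bclin_pi_eq0]) it suffices
to treat products of one-dimensional bumps, corrected so as to have integral
zero in direction i ([weak_identity_chi]).  This bounds the integral of
(P phi) f by half the supremum of the integrals of |psi| over segments times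
the variation of D_(v_i) f ([line_bound]); averaging over i in I gives the
factor 1/(2k) ([BV_part]).

For smooth f one integrates by parts once in each direction of I
([iterate_by_parts]).  The iterated primitive of psi is at most 2^(-k) times
the function N_I |psi| obtained by integrating |psi| over all coordinates in I
([prim_seq_le]).  The operator N_I is self-adjoint and N_I of any function does
not depend on the coordinates in I, so Fubini's theorem lets the essential
supremum of the integrals of |psi| over the fibres S_I come out
([mixed_mean_bound]).

Integrals over Omega = T(S) and over S differ by the constant |det M|, the
image of Lebesgue measure under an affine map being translation invariant
([pushforward_affine_inv]); it occurs on both sides and cancels. *)

(** * Boxes and Lebesgue measure on column vectors *)

Section boxes.
Context {R : realType}.
Implicit Types n : nat.
Local Notation lebR := (@lebesgue_measure R).

Definition mbox n (A : 'I_n -> set R) : set 'cV[R]_n :=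
  [set x | forall i, A i (x i ord0)].

Definition mboxes n : set (set 'cV[R]_n) :=
  [set B | exists2 A, (forall i, measurable (A i)) & B = mbox A].

Lemma measurable_mbox n (A : 'I_n -> set R) :
  (forall i, measurable (A i)) -> measurable (mbox A).
Proof.
move=> mA; rewrite (_ : mbox A = \bigcap_(i in [set: 'I_n])
    ((fun x : 'cV[R]_n => x i ord0 : measurableTypeR R) @^-1` A i)).
  apply: fin_bigcap_measurable; first exact: finite_finset.
  by move=> i _; rewrite -[X in measurable X]setTI; apply: measurable_cV_coord => //; exact: mA.
by rewrite /mbox; apply/seteqP; split => x /= Ax i; [move=> _|]; apply: Ax.
Qed.

Lemma mboxes_setI n : setI_closed (@mboxes n).
Proof.
move=> _ _ [A mA ->] [B mB ->]; exists (fun i => A i `&` B i).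
  by move=> i; exact: measurableI.
apply/seteqP; split => x /= => [[xA xB] i|xAB].
  by split; [exact: xA|exact: xB].
by split => i; have [] := xAB i.
Qed.

Lemma measurable_mboxes n :
  @measurable _ 'cV[R]_n = <<s (@mboxes n) >>.
Proof.
apply/seteqP; split.
  apply: smallest_sub; first exact: smallest_sigma_algebra.
  case: n => [|n]; first by rewrite big_ord0.
  rewrite -bigcup_mkord_ord; apply: bigcup_sub => i Ii.
  move=> _ [B mB <-]; apply: sub_sigma_algebra.
  exists (fun j => if j == inord i then B else setT).
    by move=> j; case: ifP.
  rewrite setTI; apply/seteqP; split => x /=.
    by move=> xB j; case: eqP => // ->.
  by move=> /(_ (inord i)); rewrite eqxx.
apply: smallest_sub; first exact: sigma_algebra_measurable.
by move=> _ [A mA ->]; exact: measurable_mbox.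
Qed.

Lemma lebesgue_cV_mbox n (A : 'I_n -> set R) : (forall i, measurable (A i)) ->
  (lebesgue_cV (mbox A) = \prod_(i < n) lebesgue_measure (A i))%E.
Proof. exact: lebesgue_cV_box. Qed.

Let cube n (k : nat) :  set 'cV[R]_n := mbox (fun=> `[- k%:R, k%:R]%classic).

Let cube_cover n : \bigcup_k (@cube n k) = setT.
Proof.
apply/seteqP; split => // x _.
pose m := \max_(i < n) Num.bound `|x i ord0|.
exists m => // i /=; rewrite in_itv /= -ler_norml.
have /ltW/le_trans := archi_boundP (normr_ge0 (x i ord0)); apply.
by rewrite ler_nat; apply: (@leq_bigmax _ (fun j => Num.bound `|x j ord0|) i).
Qed.

Let cube_fin n k : (lebesgue_cV (@cube n k) < +oo)%E.
Proof.
rewrite lebesgue_cV_mbox// -ge0_fin_numE; last by apply: prode_ge0 => i _.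
apply: prode_fin_num => i _; rewrite lebesgue_measure_itv/=.
by case: ifP => // _; rewrite -EFinN -EFinD.
Qed.

(** Boxes form a generating pi-system, and Lebesgue measure is finite on the
    cubes that exhaust the space. *)
Lemma cV_measure_unique n (m : {measure set 'cV[R]_n -> \bar R}) :
  (forall A : 'I_n -> set R, (forall i, measurable (A i)) ->
    m (mbox A) = (\prod_(i < n) lebR (A i))%E) ->
  forall B, measurable B -> m B = lebesgue_cV B.
Proof.
move=> mE B mB.
apply: (@measure_unique _ _ _ (@mboxes n) (@cube n)); last exact: mB.
- exact: measurable_mboxes.
- exact: mboxes_setI.
- by move=> k; exists (fun=> `[- k%:R, k%:R]%classic).
- exact: cube_cover.
- by move=> _ [A mA ->]; rewrite mE//; exact/esym/lebesgue_cV_box.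
- by move=> k; rewrite mE//; have := @cube_fin n k; rewrite lebesgue_cV_mbox.
Qed.

Lemma lebesgue_measure_shift (z : R) (A : set R) : measurable A ->
  lebR [set x | A (x + z)] = lebR A.
Proof.
have mz : measurable_fun setT (fun x : measurableTypeR R => x + z : measurableTypeR R).
  exact: measurable_funD.
move=> mA; apply/esym.
apply: (lebesgue_measure_unique (mu := pushforward lebR
  (fun x : measurableTypeR R => x + z : measurableTypeR R))) => //.
move=> _ [[u v] _ <-] /=; rewrite /pushforward.
rewrite (_ : _ @^-1` _ = `]u - z, v - z]%classic); last first.
  by apply/seteqP; split => x /=; rewrite !in_itv/= ltrBlDr lerBrDr.
by rewrite !lebesgue_measure_itv/= !lte_fin ltrD2r; case: ifP => // _; congr EFin; ring.
Qed.

Lemma measurable_shift_cV n (z : 'cV[R]_n) :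
  measurable_fun setT (fun x : 'cV[R]_n => x + z).
Proof.
apply: measurable_fun_cV => i.
rewrite (_ : (fun _ => _) = fun x : 'cV[R]_n => x i ord0 + z i ord0); last first.
  by apply/funext => x; rewrite mxE.
by apply: measurable_funD => //; exact: measurable_cV_coord.
Qed.

Lemma lebesgue_cV_shift n (z : 'cV[R]_n) (B : set 'cV[R]_n) : measurable B ->
  lebesgue_cV [set x | B (x + z)] = lebesgue_cV B.
Proof.
have mz := @measurable_shift_cV n z.
apply: (@cV_measure_unique n (pushforward (@lebesgue_cV R n) (fun x => x + z))).
move=> A mA; rewrite -[LHS]/(lebesgue_cV ((fun x => x + z) @^-1` mbox A)).
have -> : (fun x => x + z) @^-1` mbox A = mbox (fun i => [set t | A i (t + z i ord0)]).
  by apply/seteqP; split => x /= xA i; have := xA i; rewrite /= mxE.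
rewrite lebesgue_cV_mbox => [|i].
  by apply: eq_bigr => i _; rewrite lebesgue_measure_shift.
have : measurable_fun setT (fun x : R => x + z i ord0) by exact: measurable_funD.
by move=> /(_ measurableT _ (mA i)); rewrite setTI.
Qed.

End boxes.

(** * Splitting off coordinates *)

Section split.
Context {R : realType} {d : nat}.
Local Notation E := 'cV[R]_d.
Local Notation lebR := (@lebesgue_measure R).
Implicit Types (J : {set 'I_d}) (i : 'I_d).

Lemma basis_vecE i j : (basis_vec i : E) j ord0 = (j == i)%:R.
Proof. by rewrite mxE eqxx andbT. Qed.

Lemma embedE J (u : 'cV[R]_#|J|) k : embed u (enum_val k) ord0 = u k ord0.
Proof.
rewrite /embed summxE (bigD1 k)//= !mxE !eqxx mulr1 big1 ?addr0// => l lk.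
by rewrite !mxE (inj_eq enum_val_inj) eq_sym (negbTE lk) mulr0.
Qed.

Lemma embed_notin J (u : 'cV[R]_#|J|) j : j \notin J -> embed u j ord0 = 0.
Proof.
move=> jJ; rewrite /embed summxE big1// => k _; rewrite !mxE.
case: eqP => [jk|]; last by rewrite mulr0.
by move: jJ; rewrite jk enum_valP.
Qed.

Lemma enum_valP_ex J j : j \in J -> exists k : 'I_#|J|, j = enum_val k.
Proof. by move=> jJ; exists (enum_rank_in jJ j); rewrite enum_rankK_in. Qed.

Lemma measurable_embed J : measurable_fun setT (@embed R d J).
Proof.
apply: measurable_fun_cV => j; have [jJ|jJ] := boolP (j \in J).
  have [k ->] := enum_valP_ex jJ.
  by under eq_fun do rewrite embedE; exact: measurable_cV_coord.
by under eq_fun do rewrite embed_notin//; exact: measurable_cst.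
Qed.

Lemma measurable_addcV d' (T : measurableType d') (f g : T -> E) :
  measurable_fun setT f -> measurable_fun setT g ->
  measurable_fun setT (fun x => f x + g x).
Proof.
move=> mf mg; apply: measurable_fun_cV => j.
rewrite (_ : (fun _ => _) = fun x => f x j ord0 + g x j ord0); last first.
  by apply/funext => x; rewrite mxE.
by apply: measurable_funD; exact: (measurableT_comp (measurable_cV_coord _)).
Qed.

(** The coordinates in J come second, so that they are the inner variables in
    iterated integrals. *)
Definition glue J (wu : 'cV[R]_#|~: J| * 'cV[R]_#|J|) : E :=
  embed wu.1 + embed wu.2.

(** The case of one coordinate, with the real line itself as second factor, as
    in the integrals over segments. *)
Definition glue1 i (wt : 'cV[R]_#|~: [set i]| * measurableTypeR R) : E :=
  embed wt.1 + wt.2 *: basis_vec i.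

Lemma glueE_notin J wu k : @glue J wu (enum_val k) ord0 = wu.1 k ord0.
Proof.
rewrite mxE embedE embed_notin ?addr0//.
by have := enum_valP k; rewrite inE.
Qed.

Lemma glueE_in J wu k : @glue J wu (enum_val k) ord0 = wu.2 k ord0.
Proof.
by rewrite mxE embedE embed_notin ?add0r// inE negbK; exact: enum_valP.
Qed.

Lemma glue1E_notin i wt k : @glue1 i wt (enum_val k) ord0 = wt.1 k ord0.
Proof.
rewrite mxE embedE mxE basis_vecE; have := enum_valP k; rewrite !inE => /negbTE ->.
by rewrite mulr0 addr0.
Qed.

Lemma glue1E i wt : @glue1 i wt i ord0 = wt.2.
Proof.
by rewrite mxE embed_notin ?mxE ?eqxx ?mulr1 ?add0r// !inE eqxx.
Qed.

Lemma measurable_glue J : measurable_fun setT (@glue J).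
Proof.
by apply: measurable_addcV; apply: (measurableT_comp (@measurable_embed _)).
Qed.

Lemma measurable_glue1 i : measurable_fun setT (@glue1 i).
Proof.
apply: measurable_addcV; first exact: (measurableT_comp (@measurable_embed _)).
apply: measurable_fun_cV => j.
rewrite (_ : (fun _ => _) =
    fun x : 'cV[R]_#|~: [set i]| * measurableTypeR R => x.2 * (j == i)%:R); last first.
  by apply/funext => x; rewrite mxE basis_vecE.
by apply: measurable_funM => //; exact: measurable_snd.
Qed.

Lemma glue_mbox J (A : 'I_d -> set R) :
  @glue J @^-1` mbox A =
    mbox (fun k : 'I_#|~: J| => A (enum_val k)) `*`
    mbox (fun k : 'I_#|J| => A (enum_val k)).
Proof.
apply/seteqP; split => wu /=.
  move=> Awu; split => k; have := Awu (enum_val k).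
    by rewrite glueE_notin.
  by rewrite glueE_in.
move=> [A1 A2] j; have [jJ|jJ] := boolP (j \in J).
  by have [k ->] := enum_valP_ex jJ; rewrite glueE_in; exact: A2.
have jJ' : j \in ~: J by rewrite inE.
by have [k ->] := enum_valP_ex jJ'; rewrite glueE_notin; exact: A1.
Qed.

Lemma glue1_mbox i (A : 'I_d -> set R) :
  @glue1 i @^-1` mbox A =
    mbox (fun k : 'I_#|~: [set i]| => A (enum_val k)) `*` A i.
Proof.
apply/seteqP; split => wu /=.
  move=> Awu; split; last by have := Awu i; rewrite glue1E.
  by move=> k; have := Awu (enum_val k); rewrite glue1E_notin.
move=> [A1 A2] j; have [->|ji] := eqVneq j i; first by rewrite glue1E.
have jJ' : j \in ~: [set i] by rewrite !inE.
by have [k ->] := enum_valP_ex jJ'; rewrite glue1E_notin; exact: A1.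
Qed.

Lemma prode_setC J (F : 'I_d -> \bar R) :
  (\prod_(i < d) F i = \prod_(k < #|~: J|) F (enum_val k) *
                       \prod_(k < #|J|) F (enum_val k))%E.
Proof.
rewrite (bigID (mem J))/= muleC -!big_enum_val.
by congr (_ * _)%E; apply: eq_bigl => j; rewrite inE.
Qed.

(** Both sides give a box the product of the lengths of its sides. *)
Lemma lebesgue_cV_glue J (B : set E) : measurable B ->
  pushforward (@lebesgue_cV R #|~: J| \x @lebesgue_cV R #|J|)%E (@glue J) B =
  lebesgue_cV B.
Proof.
have mg := @measurable_glue J; apply: cV_measure_unique => A mA.
rewrite -[LHS]/((@lebesgue_cV R #|~: J| \x @lebesgue_cV R #|J|)%E
  (@glue J @^-1` mbox A)) glue_mbox product_measure1E; last 2 first.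
- exact: (@measurable_mbox R _ (fun k : 'I_#|~: J| => A (enum_val k)) (fun k => mA _)).
- exact: (@measurable_mbox R _ (fun k : 'I_#|J| => A (enum_val k)) (fun k => mA _)).
rewrite (prode_setC J); congr (_ * _)%E; exact: lebesgue_cV_mbox.
Qed.

Lemma lebesgue_cV_glue1 i (B : set E) : measurable B ->
  pushforward (@lebesgue_cV R #|~: [set i]| \x lebR)%E (@glue1 i) B =
  lebesgue_cV B.
Proof.
have mg := @measurable_glue1 i; apply: cV_measure_unique => A mA.
rewrite -[LHS]/((@lebesgue_cV R #|~: [set i]| \x lebR)%E
  (@glue1 i @^-1` mbox A)) glue1_mbox product_measure1E; last 2 first.
- exact: (@measurable_mbox R _ (fun k : 'I_#|~: [set i]| => A (enum_val k)) (fun k => mA _)).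
- exact: mA.
rewrite (prode_setC [set i]); congr (_ * _)%E; first exact: lebesgue_cV_mbox.
by rewrite -(big_enum_val (fun j => lebR (A j))) big_set1.
Qed.

End split.

(** * Fubini's theorem along lines and blocks *)

Section slices.
Context {R : realType} {d : nat}.
Local Notation E := 'cV[R]_d.
Local Notation lebR := (@lebesgue_measure R).
Local Notation lam := (@lebesgue_cV R d).
Implicit Types (J : {set 'I_d}) (i j : 'I_d) (y : E).

Lemma set_coordE y i t j : set_coord y i t j ord0 = if j == i then t else y j ord0.
Proof. by rewrite mxE. Qed.

Lemma set_coord_set y i s t : set_coord (set_coord y i s) i t = set_coord y i t.
Proof. by apply/colP => j; rewrite !set_coordE; case: eqP. Qed.

Lemma set_coordC y i j s t : i != j ->
  set_coord (set_coord y i s) j t = set_coord (set_coord y j t) i s.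
Proof.
move=> ij; apply/colP => k; rewrite !set_coordE.
by have [->|ki] := eqVneq k i; [rewrite (negbTE ij)|].
Qed.

Lemma glue1_set_coord i w t :
  @glue1 R d i (w, t) = set_coord (embed w) i t :> E.
Proof.
apply/colP => j; rewrite set_coordE; case: eqP => [->|/eqP ji].
  by rewrite glue1E.
have jJ' : j \in ~: [set i] by rewrite !inE.
by have [k ->] := enum_valP_ex jJ'; rewrite glue1E_notin embedE.
Qed.

Definition away i y : 'cV[R]_#|~: [set i]| := \col_k y (enum_val k) ord0.

Lemma glue1_away i y : @glue1 R d i (away i y, y i ord0) = y.
Proof.
rewrite glue1_set_coord; apply/colP => j; rewrite set_coordE.
case: eqP => [->//|/eqP ji].
have jJ' : j \in ~: [set i] by rewrite !inE.
by have [k ->] := enum_valP_ex jJ'; rewrite embedE mxE.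
Qed.

Lemma away_glue1 i w t : away i (@glue1 R d i (w, t)) = w.
Proof. by apply/colP => k; rewrite mxE glue1E_notin. Qed.

Lemma set_coord_away y i t : set_coord y i t = @glue1 R d i (away i y, t).
Proof. by rewrite glue1_set_coord -{1}(glue1_away i y) glue1_set_coord set_coord_set. Qed.

Lemma measurable_away i : measurable_fun setT (away i).
Proof.
apply: measurable_fun_cV => k; under eq_fun do rewrite mxE.
exact: measurable_cV_coord.
Qed.

Lemma measurable_set_coord i :
  measurable_fun setT (fun yt : E * measurableTypeR R => set_coord yt.1 i yt.2).
Proof.
apply: measurable_fun_cV => j; under eq_fun do rewrite set_coordE.
case: eqP => _; first exact: measurable_snd.
by apply: (measurableT_comp (measurable_cV_coord _)).
Qed.

Lemma measurable_slice i y :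
  measurable_fun setT (fun t : measurableTypeR R => set_coord y i t).
Proof.
apply: measurable_fun_cV => j; under eq_fun do rewrite set_coordE.
by case: eqP => _; [exact: measurable_id|exact: measurable_cst].
Qed.

Local Open Scope ereal_scope.

Lemma ge0_integral_glue1 i (F : E -> \bar R) : measurable_fun setT F ->
  (forall y, 0 <= F y) ->
  \int[lam]_y F y =
  \int[@lebesgue_cV R #|~: [set i]|]_w \int[lebR]_t F (@glue1 R d i (w, t)).
Proof.
move=> mF F0; have mg := @measurable_glue1 R d i.
transitivity (\int[pushforward (@lebesgue_cV R #|~: [set i]| \x lebR) (@glue1 _ _ i)]_y F y).
  by apply: eq_measure_integral => A mA _; exact/esym/(lebesgue_cV_glue1 i mA).
rewrite ge0_integral_pushforward//= fubini_tonelli1//.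
exact: measurableT_comp.
Qed.

Lemma ge0_integral_glue J (F : E -> \bar R) : measurable_fun setT F ->
  (forall y, 0 <= F y) ->
  \int[lam]_y F y =
  \int[@lebesgue_cV R #|~: J|]_w \int[@lebesgue_cV R #|J|]_u F (@glue R d J (w, u)).
Proof.
move=> mF F0; have mg := @measurable_glue R d J.
transitivity (\int[pushforward (@lebesgue_cV R #|~: J| \x @lebesgue_cV R #|J|) (@glue _ _ J)]_y F y).
  by apply: eq_measure_integral => A mA _; exact/esym/(lebesgue_cV_glue J mA).
rewrite ge0_integral_pushforward//= fubini_tonelli1//.
exact: measurableT_comp.
Qed.

Lemma integral_glue1 i (F : E -> \bar R) : lam.-integrable setT F ->
  \int[lam]_y F y =
  \int[@lebesgue_cV R #|~: [set i]|]_w \int[lebR]_t F (@glue1 R d i (w, t)).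
Proof.
move=> iF; have mg := @measurable_glue1 R d i.
have mF := measurable_int _ iF.
have iG : (@lebesgue_cV R #|~: [set i]| \x lebR).-integrable setT (F \o @glue1 _ _ i).
  apply/integrable12ltyP; first exact: measurableT_comp.
  rewrite -(ge0_integral_glue1 i (F := fun y => `|F y|))//.
    by have /integrableP[] := iF.
  exact: measurableT_comp.
transitivity (\int[pushforward (@lebesgue_cV R #|~: [set i]| \x lebR) (@glue1 _ _ i)]_y F y).
  by apply: eq_measure_integral => A mA _; exact/esym/(lebesgue_cV_glue1 i mA).
by rewrite integral_pushforward//= -integral12_prod_meas1.
Qed.

(** Identities between integrals over the whole space are checked one line at a
    time by means of this consequence of Fubini's theorem. *)
Lemma eq_integral_slices i (F G : E -> \bar R) :
  lam.-integrable setT F -> lam.-integrable setT G ->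
  (forall y, \int[lebR]_t F (set_coord y i t) = \int[lebR]_t G (set_coord y i t)) ->
  \int[lam]_y F y = \int[lam]_y G y.
Proof.
move=> iF iG FG; rewrite (integral_glue1 i iF) (integral_glue1 i iG).
apply: eq_integral => w _; under eq_integral do rewrite glue1_set_coord.
by rewrite FG; under eq_integral do rewrite -glue1_set_coord.
Qed.

Lemma ae_section_null d1 d2 (T1 : measurableType d1) (T2 : measurableType d2)
    (m1 : {sigma_finite_measure set T1 -> \bar R})
    (m2 : {sigma_finite_measure set T2 -> \bar R}) (N : set (T1 * T2)) :
  measurable N -> (m1 \x m2) N = 0 ->
  {ae m1, forall x, m2 (xsection N x) = 0}.
Proof.
move=> mN N0.
have mm : measurable_fun setT (fun x => m2 (xsection N x)).
  exact: measurable_fun_xsection.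
have : \int[m1]_x `|m2 (xsection N x)| = 0.
  rewrite -N0; apply: eq_integral => x _ /=.
  by rewrite gee0_abs//; exact: measure_ge0.
by move=> /(ae_eq_integral_abs m1 measurableT mm); apply: filterS => x /(_ I).
Qed.

Lemma ae_glue1_null i (N : set E) : measurable N -> lam N = 0 ->
  {ae @lebesgue_cV R #|~: [set i]|, forall w,
    lebR [set t | N (@glue1 R d i (w, t))] = 0}.
Proof.
move=> mN N0; have mg := @measurable_glue1 R d i.
have mP : measurable (@glue1 R d i @^-1` N) by rewrite -[X in measurable X]setTI; exact: mg.
have := @ae_section_null _ _ _ _ (@lebesgue_cV R #|~: [set i]|) lebR _ mP.
rewrite -[X in X = 0 -> _]/(pushforward _ (@glue1 R d i) N) lebesgue_cV_glue1//.
move=> /(_ N0); apply: filterS => w /=; rewrite (_ : xsection _ w = [set t | N (@glue1 R d i (w, t))])//.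
by apply/seteqP; split => t /=; rewrite xsectionE.
Qed.

Lemma ae_glue_null J (N : set E) : measurable N -> lam N = 0 ->
  {ae @lebesgue_cV R #|~: J|, forall w,
    @lebesgue_cV R #|J| [set u | N (@glue R d J (w, u))] = 0}.
Proof.
move=> mN N0; have mg := @measurable_glue R d J.
have mP : measurable (@glue R d J @^-1` N) by rewrite -[X in measurable X]setTI; exact: mg.
have := @ae_section_null _ _ _ _ (@lebesgue_cV R #|~: J|) (@lebesgue_cV R #|J|) _ mP.
rewrite -[X in X = 0 -> _]/(pushforward _ (@glue R d J) N) lebesgue_cV_glue//.
move=> /(_ N0); apply: filterS => w /=; rewrite (_ : xsection _ w = [set u | N (@glue R d J (w, u))])//.
by apply/seteqP; split => t /=; rewrite xsectionE.
Qed.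

(** A null set of lines parallel to e_i covers a null set of points. *)
Lemma ae_away i (P : set 'cV[R]_#|~: [set i]|) :
  {ae @lebesgue_cV R #|~: [set i]|, forall w, P w} ->
  {ae lam, forall y, P (away i y)}.
Proof.
move=> [W [mW W0 PW]]; exists (away i @^-1` W); split.
- by rewrite -[X in measurable X]setTI; exact: measurable_away.
- have maW : measurable (away i @^-1` W).
    by rewrite -[X in measurable X]setTI; exact: measurable_away.
  rewrite -(lebesgue_cV_glue1 i maW) -[LHS]/((@lebesgue_cV R #|~: [set i]| \x lebR)
    (@glue1 R d i @^-1` (away i @^-1` W))).
  have -> : @glue1 R d i @^-1` (away i @^-1` W) = W `*` setT.
    by apply/seteqP; split => -[w t] /=; rewrite away_glue1 => // -[].
  rewrite product_measure1E//.
  by rewrite (_ : _ W = 0)//; exact: mul0e.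
- by move=> y /= nP; apply: PW.
Qed.

Lemma ae_slice_null i (N : set E) : measurable N -> lam N = 0 ->
  {ae lam, forall y, lebR [set t | N (set_coord y i t)] = 0}.
Proof.
move=> mN N0; have := ae_away (ae_glue1_null i mN N0).
by apply: filterS => y; under eq_set do rewrite -set_coord_away.
Qed.

End slices.

(** * Affine change of variables *)

(** The measure is unchanged; the name carries the proof from which the sigma-
    finite structure is built. *)
Definition with_sigma_finite d (T : measurableType d) (R : realType)
  (mu : {measure set T -> \bar R}) (muoo : sigma_finite setT mu) :
  set T -> \bar R := mu.

HB.instance Definition _ d (T : measurableType d) (R : realType)
  (mu : {measure set T -> \bar R}) (muoo : sigma_finite setT mu) :=
  Measure.on (with_sigma_finite muoo).

HB.instance Definition _ d (T : measurableType d) (R : realType)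
  (mu : {measure set T -> \bar R}) (muoo : sigma_finite setT mu) :=
  @Measure_isSigmaFinite.Build _ _ _ (with_sigma_finite muoo) muoo.

Section haar.
Context {R : realType} {d : nat}.
Local Notation E := 'cV[R]_d.
Local Notation lam := (@lebesgue_cV R d).
Local Open Scope ereal_scope.

(** The heart of the uniqueness of Haar measure: both sides compute the product
    measure of the set of all (x, y) with x in A and x + y in B, once with y and
    once with x as inner variable. *)
Lemma shift_invariant_swap (mu : {sigma_finite_measure set E -> \bar R}) :
  (forall (z : E) (B : set E), measurable B -> mu [set x | B (x + z)%R] = mu B) ->
  forall A B : set E, measurable A -> measurable B ->
    mu A * lam B = mu B * lam [set x | A (- x)%R].
Proof.
move=> mush A B mA mB.
have mN : measurable_fun setT (fun x : E => - x)%R.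
  apply: measurable_fun_cV => i; under eq_fun do rewrite mxE.
  by apply: measurable_funN; exact: measurable_cV_coord.
have mAN : measurable [set x | A (- x)%R].
  by rewrite -[X in measurable X]setTI; exact: mN.
have m1 : measurable (fst @^-1` A : set (E * E)).
  by rewrite -[X in measurable X]setTI; exact: measurable_fst.
have m2 : measurable ((fun xy => xy.1 + xy.2)%R @^-1` B : set (E * E)).
  rewrite -[X in measurable X]setTI.
  by apply: (measurable_addcV (@measurable_fst _ _ _ _) (@measurable_snd _ _ _ _)).
have mP := measurableI _ _ m1 m2.
set P := (_ `&` _) in mP.
have ex z : mu [set x | P (x, z)] = mu [set x | A (x - z)%R /\ B x].
  have mz : measurable [set x | A (x - z)%R /\ B x].
    apply: measurableI => //; rewrite -[X in measurable X]setTI.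
    exact: (@measurable_shift_cV R d (- z)%R).
  rewrite -(mush z _ mz); congr (mu _); apply/seteqP; split => x /=.
    by rewrite addrK.
  by rewrite addrK.
transitivity (\int[mu]_x \int[lam]_y (\1_P (x, y))%:E).
  transitivity (\int[mu]_x ((lam B) * (\1_A x)%:E)).
    rewrite ge0_integralZl//; last exact/measurable_EFinP/measurable_indic.
    by rewrite integral_indic// setIT muleC.
  apply: eq_integral => x _.
  rewrite (_ : (fun y => _) = fun y => (\1_[set y | P (x, y)] y)%:E); last first.
    by apply/funext => y; rewrite !indicE; congr ((nat_of_bool _)%:R%:E); apply/idP/idP; rewrite !inE.
  rewrite integral_indic// ?setIT; last first.
    by have := measurable_xsection x mP; rewrite (_ : xsection _ _ = [set y | P (x, y)])//;
     apply/seteqP; split => t /=; rewrite xsectionE.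
  have [Ax|nAx] := pselect (A x).
    rewrite indicE mem_set// mule1 -(lebesgue_cV_shift x mB); congr (lam _).
    by apply/seteqP; split => y; rewrite /P /= addrC; [move=> ?; split|case].
  rewrite indicE memNset// mule0 (_ : [set y | P (x, y)] = set0) ?measure0//.
  by apply/seteqP; split => y //= -[].
(* Exchange the integrals, translate x by - y in the inner one, and exchange again. *)
rewrite (@fubini_tonelli _ _ _ _ _ mu lam (fun xy => (\1_P xy)%:E))//; last exact/measurable_EFinP/measurable_indic.
transitivity (\int[lam]_y \int[mu]_x (\1_[set xy : E * E | A (xy.1 - xy.2)%R /\ B xy.1] (x, y))%:E).
  apply: eq_integral => y _.
  have mS : measurable [set x | P (x, y)].
    by have := measurable_ysection y mP; rewrite (_ : ysection _ _ = [set x | P (x, y)])//;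
     apply/seteqP; split => t /=; rewrite ysectionE.
  rewrite (_ : (fun x => _) = fun x => (\1_[set x | P (x, y)] x)%:E); last first.
    by apply/funext => x; rewrite !indicE; congr ((nat_of_bool _)%:R%:E); apply/idP/idP; rewrite !inE.
  rewrite integral_indic// setIT.
  transitivity (mu [set x | A (x - y)%R /\ B x]); first exact: ex.
  rewrite [RHS](_ : _ = \int[mu]_x (\1_[set x | A (x - y)%R /\ B x] x)%:E); last first.
    apply: eq_integral => x _; rewrite !indicE; congr ((nat_of_bool _)%:R%:E).
  rewrite integral_indic ?setIT//.
  apply: measurableI => //; rewrite -[X in measurable X]setTI.
  exact: (@measurable_shift_cV R d (- y)%R).
have mQ : measurable [set xy : E * E | A (xy.1 - xy.2)%R /\ B xy.1].
  apply: measurableI.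
    rewrite -[X in measurable X]setTI.
    apply: (measurable_addcV (f := fst) (g := fun xy : E * E => - xy.2)%R) => //.
    exact: (measurableT_comp mN).
  by rewrite -[X in measurable X]setTI; exact: measurable_fst.
set Q := [set _ | _] in mQ *.
rewrite -(@fubini_tonelli _ _ _ _ _ mu lam (fun xy => (\1_Q xy)%:E))//; last exact/measurable_EFinP/measurable_indic.
transitivity (\int[mu]_x (lam [set x | A (- x)%R] * (\1_B x)%:E)); last first.
  rewrite ge0_integralZl//; last exact/measurable_EFinP/measurable_indic.
  by rewrite integral_indic// setIT muleC.
apply: eq_integral => x _.
rewrite (_ : (fun y => _) = fun y => (\1_[set y | Q (x, y)] y)%:E); last first.
  by apply/funext => y; rewrite !indicE; congr ((nat_of_bool _)%:R%:E); apply/idP/idP; rewrite !inE.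
rewrite integral_indic// ?setIT; last first.
  by have := measurable_xsection x mQ; rewrite (_ : xsection _ _ = [set y | Q (x, y)])//;
   apply/seteqP; split => t /=; rewrite xsectionE.
have [Bx|nBx] := pselect (B x).
  rewrite indicE (mem_set Bx) mule1 -(lebesgue_cV_shift (- x)%R mAN); congr (lam _).
  by apply/seteqP; split => y; rewrite /Q /= opprD opprK addrC; [case|move=> ?; split].
rewrite indicE (memNset nBx) mule0 (_ : [set y | Q (x, y)] = set0) ?measure0//.
by apply/seteqP; split => y //= -[].
Qed.

Definition unit_cube : set E := mbox (fun=> `[0%R, 1%R]%classic).

Lemma measurable_unit_cube : measurable unit_cube.
Proof. by apply: measurable_mbox. Qed.

Lemma lebesgue_unit_cube : lam unit_cube = 1.
Proof.
rewrite /unit_cube lebesgue_cV_mbox// big1// => i _.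
by rewrite lebesgue_measure_itv/= lte_fin ltr01 oppr0 adde0.
Qed.

(** The previous lemma for Lebesgue measure itself shows that A and - A have the
    same measure. *)
Lemma shift_invariantE (mu : {sigma_finite_measure set E -> \bar R}) :
  (forall (z : E) (B : set E), measurable B -> mu [set x | B (x + z)%R] = mu B) ->
  forall A : set E, measurable A -> mu A = mu unit_cube * lam A.
Proof.
move=> mush A mA; have mC := measurable_unit_cube.
have E1 : lam unit_cube = 1 := lebesgue_unit_cube.
have AN : lam A = lam [set x | A (- x)%R].
  rewrite -[LHS]mule1 -[RHS]mul1e -E1.
  exact: (@shift_invariant_swap lam (@lebesgue_cV_shift R d) _ _ mA mC).
by rewrite -[LHS]mule1 -E1 AN; exact: shift_invariant_swap.
Qed.

End haar.

Section affine.
Context {R : realType} {d : nat}.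
Local Notation E := 'cV[R]_d.
Local Notation lam := (@lebesgue_cV R d).
Variables (M : 'M[R]_d) (M_unit : M \in unitmx) (c : E).

Lemma affineK : cancel (affine M c) (affine_inv M c).
Proof. by move=> y; rewrite /affine_inv /affine addrK mulKmx. Qed.

Lemma affine_invK : cancel (affine_inv M c) (affine M c).
Proof. by move=> x; rewrite /affine_inv /affine mulKVmx// subrK. Qed.

Lemma affine_image (A : set E) : affine M c @` A = affine_inv M c @^-1` A.
Proof.
apply/seteqP; split => x /=; first by move=> [y Ay <-]; rewrite affineK.
by move=> Ax; exists (affine_inv M c x) => //; rewrite affine_invK.
Qed.

Lemma measurable_mulmx (A : 'M[R]_d) : measurable_fun setT (fun x : E => A *m x).
Proof.
apply: measurable_fun_cV => i; under eq_fun do rewrite mxE.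
by apply: measurable_sum => j; apply: measurable_funM => //; exact: measurable_cV_coord.
Qed.

Lemma measurable_affine : measurable_fun setT (affine M c).
Proof.
by apply: (measurable_addcV (f := fun x : E => M *m x) (g := fun=> c)) => //;
  exact: measurable_mulmx.
Qed.

Lemma measurable_affine_inv : measurable_fun setT (affine_inv M c).
Proof.
apply: (measurableT_comp (@measurable_mulmx (invmx M))).
exact: measurable_shift_cV.
Qed.

(** This is |det M|, as the volume of the image of the unit cube. *)
Definition jacobian : \bar R :=
  pushforward lam (affine_inv M c) (@unit_cube R d).

Lemma pushforward_sigma_finite :
  exists mu : {sigma_finite_measure set E -> \bar R},
    forall A, mu A = pushforward lam (affine_inv M c) A.
Proof.
have mT := measurable_affine.
have mTi := measurable_affine_inv.
have [mu muE] : exists mu : {measure set E -> \bar R},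
    mu = pushforward lam (affine_inv M c) :> (set E -> \bar R).
  by unshelve eexists (pushforward lam (affine_inv M c)).
have muoo : sigma_finite setT mu.
  have /sigma_finiteP[F [TF ndF Foo]] := sigma_finiteT lam.
  exists (fun k => affine M c @^-1` F k).
    by rewrite -preimage_bigcup -TF preimage_setT.
  move=> k; have [mF Fk] := Foo k; split.
    by rewrite -[X in measurable X]setTI; exact: mT.
  rewrite muE /pushforward -comp_preimage (_ : _ \o _ = id)// ?preimage_id//.
  by apply/funext => x /=; rewrite affine_invK.
by exists (with_sigma_finite muoo) => A; rewrite -muE.
Qed.

(** The image measure is translation invariant, since a shift by z in the source
    is a shift by M z in the target. *)
Lemma pushforward_affine_inv (A : set E) : measurable A ->
  pushforward lam (affine_inv M c) A = (jacobian * lam A)%E.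
Proof.
move=> mA; have [mu muE] := pushforward_sigma_finite.
rewrite /jacobian -!muE; apply: shift_invariantE => // z B mB.
rewrite !muE /pushforward.
have mB' : measurable (affine_inv M c @^-1` B).
  by rewrite -[X in measurable X]setTI; exact: measurable_affine_inv.
rewrite -(lebesgue_cV_shift (M *m z) mB').
have e x : affine_inv M c (x + M *m z) = affine_inv M c x + z.
  by rewrite /affine_inv addrAC mulmxDr mulKmx.
by congr (lam _); apply/seteqP; split => x /=; rewrite e.
Qed.

Lemma jacobian_ge0 : (0 <= jacobian)%E.
Proof. exact: (measure_ge0 lam). Qed.

(** The image of the unit cube lies in a cube. *)
Lemma jacobian_lty : (jacobian < +oo)%E.
Proof.
pose K i := \sum_j `|M i j| + `|c i ord0|.
have mK : measurable (mbox (fun i => `[- K i, K i]%classic)) by exact: measurable_mbox.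
apply: (@le_lt_trans _ _ (lam (mbox (fun i => `[- K i, K i]%classic)))).
  rewrite /jacobian /pushforward le_measure ?inE//=.
    rewrite -[X in measurable X]setTI; apply: measurable_affine_inv => //.
    exact: measurable_unit_cube.
  move=> x /= x01 i /=; rewrite in_itv/= -ler_norml.
  rewrite -(affine_invK x) /affine; set y := affine_inv M c x in x01 *.
  rewrite mxE (le_trans (ler_normD _ _))// lerD2r mxE (le_trans (ler_norm_sum _ _ _))//.
  apply: ler_sum => j _; rewrite normrM ler_piMr//.
  by have := x01 j; rewrite /= in_itv/= => /andP[y0 y1]; rewrite ger0_norm.
rewrite lebesgue_cV_mbox// -ge0_fin_numE; last by apply: prode_ge0 => i _.
apply: prode_fin_num => i _; rewrite lebesgue_measure_itv/=.
by case: ifP => // _; rewrite -EFinN -EFinD.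
Qed.

Lemma ge0_integral_affine_inv (F : E -> \bar R) : measurable_fun setT F ->
  (forall y, 0 <= F y)%E ->
  (\int[lam]_x F (affine_inv M c x) = jacobian * \int[lam]_y F y)%E.
Proof.
move=> mF F0; have mTi := measurable_affine_inv.
have := @ge0_integral_pushforward _ _ _ _ R _ mTi lam setT F measurableT mF (fun y _ => F0 y).
move=> <-.
have jf : jacobian \is a fin_num by rewrite ge0_fin_numE ?jacobian_lty ?jacobian_ge0.
have j0 : 0 <= fine jacobian by rewrite fine_ge0// jacobian_ge0.
rewrite -(fineK jf) -[in RHS](@ge0_integral_mscale _ _ _ lam setT measurableT (NngNum j0)) //.
by apply: eq_measure_integral => A mA _; rewrite -[RHS]/((fine jacobian)%:E * lam A)%E fineK//; exact: pushforward_affine_inv.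
Qed.

Lemma integral_affine_inv (F : E -> R) : lam.-integrable setT (EFin \o F) ->
  lam.-integrable setT (fun x => (F (affine_inv M c x))%:E) /\
  (\int[lam]_x (F (affine_inv M c x))%:E = jacobian * \int[lam]_y (F y)%:E)%E.
Proof.
move=> iF; have mTi := measurable_affine_inv.
have /integrableP[mF Foo] := iF.
have jf : jacobian \is a fin_num by rewrite ge0_fin_numE ?jacobian_lty ?jacobian_ge0.
split.
  apply/integrableP; split; first exact: (measurableT_comp mF).
  rewrite (@ge0_integral_affine_inv (fun y => `|(F y)%:E|%E))//.
    by rewrite lte_mul_pinfty// jacobian_ge0.
  exact: measurableT_comp.
rewrite [LHS]integralE [in RHS](integralE _ _ (EFin \o F)).
have -> : (fun x => (F (affine_inv M c x))%:E)^\+%E = (EFin \o F)^\+%E \o affine_inv M c.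
  exact: (funepos_comp (EFin \o F) (affine_inv M c)).
have -> : (fun x => (F (affine_inv M c x))%:E)^\-%E = (EFin \o F)^\-%E \o affine_inv M c.
  exact: (funeneg_comp (EFin \o F) (affine_inv M c)).
rewrite !ge0_integral_affine_inv//; last 2 first.
- exact: measurable_funeneg.
- exact: measurable_funepos.
rewrite [RHS]muleBr// fin_num_adde_defr//.
exact: (integrable_pos_fin_num measurableT iF).
Qed.

Lemma affine_inv_null (N : set E) : measurable N -> lam N = 0%E ->
  lam (affine_inv M c @^-1` N) = 0%E.
Proof.
by move=> mN N0; have := pushforward_affine_inv mN; rewrite N0 mule0.
Qed.

End affine.

(** * Topology of boxes and of their affine images *)

Section topology_cV.
Context {R : realType}.

Lemma cV_continuous_at (T : topologicalType) n (f : T -> 'cV[R]_n) x :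
  (forall i, {for x, continuous (fun x => f x i ord0)}) -> {for x, continuous f}.
Proof.
move=> cf U /= /nbhs_ballP[e /= e0 eU]; rewrite nbhs_simpl/=.
suff : \forall y \near x, forall i, ball (f x i ord0) e (f y i ord0).
  by apply: filterS => y fy; apply: eU; split => // i j; rewrite ord1.
apply: filter_forall => i; apply: cf; exact: nbhsx_ballx.
Qed.

Lemma cV_continuous (T : topologicalType) n (f : T -> 'cV[R]_n) :
  (forall i, continuous (fun x => f x i ord0)) -> continuous f.
Proof. by move=> cf x; apply: cV_continuous_at => i; exact: cf. Qed.

Lemma compact_mbox n (A : 'I_n -> set R) :
  (forall i, compact (A i)) -> compact (mbox A).
Proof.
move=> cA; have /continuous_compact := rV_compact cA.
move=> /(_ _ (fun v : 'rV[R]_n => v^T)).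
have ct : continuous (fun v : 'rV[R]_n => v^T).
  apply: cV_continuous => i; under eq_fun do rewrite mxE.
  exact: coord_continuous.
move=> /(_ (continuous_subspaceT ct)); congr compact; apply/seteqP; split => x /=.
  by move=> [v Av <-] i; rewrite mxE; exact: Av.
by move=> Ax; exists x^T; rewrite ?trmxK// => i; rewrite mxE; exact: Ax.
Qed.

Lemma open_mbox n (A : 'I_n -> set R) : (forall i, open (A i)) -> open (mbox A).
Proof.
move=> oA; rewrite openE => x Ax; rewrite /interior.
have : \forall y \near x, forall i, A i ((y : 'cV[R]_n) i ord0).
  have := (@filter_forall _ _ (fun i (y : 'cV[R]_n) => A i (y i ord0)) (nbhs x) (nbhs_filter x)).
  apply => i.
  apply: (@coord_continuous R n 1 i ord0 x).
  by apply: open_nbhs_nbhs; split => //; exact: Ax.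
by [].
Qed.

(** An open set is a countable union of boxes with rational vertices. *)
Lemma open_measurable_cV n (U : set 'cV[R]_n) : open U -> measurable U.
Proof.
move=> oU.
pose B (g : {ffun 'I_n -> rat * rat}) : set 'cV[R]_n :=
  mbox (fun i => `]ratr (g i).1, ratr (g i).2[%classic).
have mB g : measurable (B g) by exact: measurable_mbox.
pose F g := if `[< B g `<=` U >] then B g else set0.
rewrite (_ : U = \bigcup_g F g).
  by apply: countable_bigcupT_measurable => // g; rewrite /F; case: ifP.
apply/seteqP; split => x; last first.
  by move=> [g _]; rewrite /F; case: asboolP => // gU; exact: gU.
move=> Ux; move: oU; rewrite openE => /(_ _ Ux); rewrite /interior => /nbhs_ballP[e /= e0 eU].
have lo i : {q : rat | ratr q \in `]x i ord0 - e, x i ord0[}.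
  by apply/cid; apply: rat_in_itvoo; rewrite ltrBlDr ltrDl.
have hi i : {q : rat | ratr q \in `]x i ord0, x i ord0 + e[}.
  by apply/cid; apply: rat_in_itvoo; rewrite ltrDl.
exists [ffun i => (sval (lo i), sval (hi i))] => //; rewrite /F asboolT.
  move=> i /=; rewrite ffunE/=; case: (lo i) => p /=; case: (hi i) => q /=.
  by rewrite !in_itv/= => /andP[-> _] /andP[_ ->].
move=> y By; apply: eU; split => // i j; rewrite ord1 /ball/= ltr_norml.
have := By i; rewrite /= ffunE/=; case: (lo i) => p /=; case: (hi i) => q /=.
rewrite !in_itv/= => /andP[q1 q2] /andP[p1 p2] /andP[py yq].
apply/andP; split; lra.
Qed.

Lemma within_continuous_measurable_cV n (D : set 'cV[R]_n) (g : 'cV[R]_n -> R) :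
  open D -> (forall x, D x -> {for x, continuous g}) -> measurable_fun D g.
Proof.
move=> oD cg; apply: (measurability _ (RGenOpens.measurableE R)).
move=> _ [_ [u [v ->] <-]]; apply: open_measurable_cV.
rewrite openE => x [Dx /= gx]; rewrite /interior.
near=> y; split; first by near: y; exact: open_nbhs_nbhs.
near: y; apply: (cg _ Dx); apply: open_nbhs_nbhs; split => //; exact: interval_open.
Unshelve. all: by end_near. Qed.

End topology_cV.

Section affine_topology.
Context {R : realType} {d : nat}.
Local Notation E := 'cV[R]_d.
Local Notation lam := (@lebesgue_cV R d).
Variables (a b : 'I_d -> R) (M : 'M[R]_d) (M_unit : M \in unitmx) (c : E).
Local Notation T := (affine M c).
Local Notation Ti := (affine_inv M c).

Definition obox : set E := mbox (fun i => `]a i, b i[%classic).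

Lemma box_mbox : box a b = mbox (fun i => `[a i, b i]%classic).
Proof. by apply/seteqP; split => x /= xA i; have := xA i; rewrite /= in_itv. Qed.

Lemma measurable_box : measurable (box a b).
Proof. by rewrite box_mbox; exact: measurable_mbox. Qed.

Lemma measurable_obox : measurable obox.
Proof. exact: measurable_mbox. Qed.

Lemma obox_sub : obox `<=` box a b.
Proof. by move=> x xo i; have := xo i; rewrite /= in_itv/= => /andP[/ltW -> /ltW ->]. Qed.

Lemma mulmx_linear (A : 'M[R]_d) i : linear (fun x : E => (A *m x) i ord0).
Proof. by move=> k u v; rewrite mulmxDr -scalemxAr !mxE. Qed.

Lemma continuous_mulmx (A : 'M[R]_d) i : continuous (fun x : E => (A *m x) i ord0).
Proof.
under eq_fun do rewrite mxE.
apply: (@continuous_big _ _ +%R) => [|j _]; first exact: add_continuous.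
by move=> x; exact: (continuous_comp (@coord_continuous R d 1 j ord0 x) (@mulrl_continuous R (A i j) _)).
Qed.

Lemma continuous_affine : continuous T.
Proof.
apply: cV_continuous => i x; rewrite /affine; under eq_fun do rewrite mxE.
exact: (cvgD (@continuous_mulmx M i x) (cvg_cst _)).
Qed.

Lemma continuous_affine_inv : continuous Ti.
Proof.
apply: cV_continuous => i x; rewrite /affine_inv; under eq_fun do rewrite mulmxBr mxE.
exact: (cvgD (@continuous_mulmx (invmx M) i x) (cvg_cst _)).
Qed.

(** The preimage of an interior point can be moved a little both ways along each
    e_i without leaving the box, so it lies on no face. *)
Lemma interior_affine_box : (T @` box a b)° = Ti @^-1` obox.
Proof.
apply/seteqP; split => x.
  rewrite /interior (affine_image M_unit) => xO i.
  have [e e0 eO] : exists2 e : R, 0 < e & forall t, `|t| < e -> box a b (Ti x + t *: basis_vec i).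
    have cl : {for 0, continuous (fun t : R => T (Ti x + t *: basis_vec i))}.
      apply: (continuous_comp (f := fun t : R => Ti x + t *: basis_vec i)).
        by apply: cvgD; [exact: cvg_cst|apply: cvgZr_tmp; exact: cvg_id].
      exact: continuous_affine.
    have := cl (Ti @^-1` box a b); rewrite scale0r addr0 (affine_invK M_unit).
    move=> /(_ xO); rewrite nbhs_simpl => /nbhs_ballP[e /= e0 eO].
    exists e => // t te; have := eO t; rewrite /ball/= sub0r normrN => /(_ te).
    by rewrite (affineK M_unit).
  have e2 : `|e / 2| < e by rewrite gtr0_norm ?divr_gt0// ltr_pdivrMr// mulr_natr mulr2n ltrDl.
  have := eO _ e2 i; have := eO (- (e / 2)); rewrite normrN => /(_ e2 i).
  rewrite !mxE !eqxx /= !mulr1 !in_itv/= => /andP[h1 _] /andP[_ h2].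
  by apply/andP; split; lra.
move=> xO; have : open (Ti @^-1` obox).
  move/continuousP : continuous_affine_inv; apply; apply: open_mbox => i.
  exact: interval_open.
rewrite openE => /(_ _ xO); apply: filterS => y /obox_sub yb.
by exists (Ti y) => //; rewrite (affine_invK M_unit).
Qed.

Lemma box_lty : (lam (box a b) < +oo)%E.
Proof.
rewrite box_mbox lebesgue_cV_mbox// -ge0_fin_numE; last by apply: prode_ge0.
apply: prode_fin_num => i _; rewrite lebesgue_measure_itv/=.
by case: ifP => // _; rewrite -EFinN -EFinD.
Qed.

Lemma box_boundary_null : (forall i, a i < b i) -> lam (box a b `\` obox) = 0%E.
Proof.
move=> ab; have vol : lam (box a b) = lam obox.
  rewrite box_mbox !lebesgue_cV_mbox//; apply: eq_bigr => i _.
  by rewrite !lebesgue_measure_itv.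
have voloo := box_lty.
transitivity (lam (box a b) - lam obox)%E; last first.
  by rewrite -vol subee// ge0_fin_numE.
rewrite -[in RHS](setIidr obox_sub); apply: measureD => //.
  exact: measurable_box.
exact: measurable_obox.
Qed.

End affine_topology.

(** * Functionals continuous under bounded convergence *)

Section bounded_measurable.
Context {R : realType} d (T : measurableType d).
Implicit Types f g : T -> R.

Definition bmeas f := measurable_fun setT f /\ exists K, forall x, `|f x| <= K.

Lemma bmeas_cst k : bmeas (fun=> k).
Proof. by split; [exact: measurable_cst|exists `|k|]. Qed.

Lemma bmeasD f g : bmeas f -> bmeas g -> bmeas (fun x => f x + g x).
Proof.
move=> [mf [K fK]] [mg [L gL]]; split; first exact: measurable_funD.
by exists (K + L) => x; rewrite (le_trans (ler_normD _ _))// lerD.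
Qed.

Lemma bmeasM f g : bmeas f -> bmeas g -> bmeas (fun x => f x * g x).
Proof.
move=> [mf [K fK]] [mg [L gL]]; split; first exact: measurable_funM.
by exists (K * L) => x; rewrite normrM ler_pM.
Qed.

Lemma bmeasB f g : bmeas f -> bmeas g -> bmeas (fun x => f x - g x).
Proof.
move=> bf bg; rewrite (_ : (fun x => _) = fun x => f x + -1 * g x).
  by apply: bmeasD => //; apply: bmeasM => //; exact: bmeas_cst.
by apply/funext => x; rewrite mulN1r.
Qed.

Lemma bmeas_norm f : bmeas f -> bmeas (fun x => `|f x|).
Proof.
move=> [mf [K fK]]; split; first exact: measurableT_comp.
by exists K => x; rewrite normr_id.
Qed.

Lemma bmeas_indic (A : set T) : measurable A -> bmeas (\1_A).
Proof.
move=> mA; split; first exact: measurable_indic.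
by exists 1 => x; rewrite indicE; case: (_ \in _); rewrite ?normr1 ?normr0.
Qed.

Lemma bmeas_prod (I : eqType) (s : seq I) (F : I -> T -> R) :
  (forall i, bmeas (F i)) -> bmeas (fun x => \prod_(i <- s) F i x).
Proof.
move=> bF; elim: s => [|i s IH].
  by under eq_fun do rewrite big_nil; exact: bmeas_cst.
by under eq_fun do rewrite big_cons; exact: bmeasM.
Qed.

(** Linearity and continuity for bounded pointwise convergence are what the
    monotone class argument requires of a functional. Integration against an
    integrable density or a charge has these properties, and they survive
    composition with the operators [kop]. *)
Definition bclin (L : (T -> R) -> R) :=
  (forall k f g, bmeas f -> bmeas g ->
    L (fun x => k * f x + g x) = k * L f + L g) /\
  (forall (F : nat -> T -> R) f K, (forall n, bmeas (F n)) -> bmeas f ->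
    (forall n x, `|F n x| <= K) -> (forall x, F n x @[n --> \oo] --> f x) ->
    L (F n) @[n --> \oo] --> L f).

Lemma bclin0 L : bclin L -> L (fun=> 0) = 0.
Proof.
move=> [+ _] => /(_ 1 (fun=> 0) (fun=> 0)) /(_ (bmeas_cst _) (bmeas_cst _)).
rewrite (_ : (fun x => _) = fun=> 0); last by apply/funext => x; rewrite mulr0 addr0.
by rewrite mul1r => /eqP; rewrite -subr_eq subrr => /eqP.
Qed.

Lemma bclinD L f g : bclin L -> bmeas f -> bmeas g ->
  L (fun x => f x + g x) = L f + L g.
Proof.
move=> [+ _] bf bg => /(_ 1 f g bf bg).
by under eq_fun do rewrite mul1r; rewrite mul1r.
Qed.

Lemma bclinB L f g : bclin L -> bmeas f -> bmeas g ->
  L (fun x => f x - g x) = L f - L g.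
Proof.
move=> [+ _] bf bg => /(_ (-1) g f bg bf).
rewrite mulN1r addrC => <-; congr L; apply/funext => x; ring.
Qed.

Lemma bclinZ L k f : bclin L -> bmeas f -> L (fun x => k * f x) = k * L f.
Proof.
move=> hL bf; have [+ _] := hL => /(_ k f (fun=> 0) bf (bmeas_cst _)).
by rewrite (bclin0 hL) addr0 => <-; congr L; apply/funext => x; rewrite addr0.
Qed.

Lemma bclin_comb L1 L2 k : bclin L1 -> bclin L2 ->
  bclin (fun f => L1 f + k * L2 f).
Proof.
move=> [l1 c1] [l2 c2]; split=> [j f g bf bg|F f K bF bf FK Ff].
  by rewrite l1// l2//; ring.
by apply: cvgD; [exact: c1|apply: cvgMl_tmp; exact: c2].
Qed.

(** The sets whose indicator is annihilated form a Dynkin system. *)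
Lemma bclin_indic_eq0 L (G : set (set T)) : bclin L ->
  @measurable _ T = <<s G >> -> setI_closed G ->
  L (\1_setT) = 0 -> (forall A, G A -> L (\1_A) = 0) ->
  forall A, measurable A -> L (\1_A) = 0.
Proof.
move=> hL GE GI LT LG A; rewrite GE; move: A.
apply: (dynkin_induction (P := fun A => L (\1_A) = 0) GE) => //.
  move=> A mA LA; rewrite (_ : \1_(~` A) = (fun x => \1_setT x - \1_A x)).
    by rewrite bclinB// ?LT ?LA ?subr0//; exact: bmeas_indic.
  apply/funext => x; rewrite !indicE in_setT in_setC.
  by case: (_ \in _); rewrite ?subrr ?subr0.
move=> F mF tF LF; pose u n := \bigcup_(k < n) F k.
have mu n : measurable (u n) by apply: bigcup_measurable => k _.
have Lu n : L (\1_(u n)) = 0.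
  elim: n => [|n IH].
    rewrite (_ : \1_(u 0%N) = fun=> 0) ?bclin0//; apply/funext => x.
    by rewrite indicE memNset// => -[].
  rewrite (_ : \1_(u n.+1) = fun x => \1_(u n) x + \1_(F n) x).
    by rewrite bclinD ?IH ?LF ?addr0//; exact: bmeas_indic.
  apply/funext => x; rewrite !indicE.
  have [Fnx|nFnx] := pselect (F n x).
    rewrite (mem_set Fnx) (mem_set (A := u n.+1)); last by exists n => /=.
    rewrite memNset ?add0r// => -[k /= kn Fkx].
    move/trivIsetP : tF => /(_ k n I I); rewrite neq_ltn kn => /(_ isT).
    by move/seteqP => -[] /(_ x (conj Fkx Fnx)).
  rewrite (memNset nFnx) addr0; congr (nat_of_bool _)%:R; apply/idP/idP; rewrite !inE.
    move=> [k /=]; rewrite ltnS leq_eqVlt => /predU1P[->//|kn] Fkx.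
    by exists k.
  by move=> [k /= kn Fkx]; exists k => //=; rewrite ltnS ltnW.
have := hL.2 (fun n => \1_(u n)) (\1_(\bigcup_k F k)) 1.
have Lu' : (fun n => L (\1_(u n))) = fun=> 0 by apply/funext.
rewrite Lu' => /(_ (fun n => bmeas_indic (mu n))).
have mF' : measurable (\bigcup_k F k) by apply: bigcup_measurable => k _.
move=> /(_ (bmeas_indic mF')) h.
have {}h : (fun=> 0 : R) @ \oo --> L \1_(\bigcup_k F k).
  apply: h => [n x|x].
    by rewrite indicE; case: (_ \in _); rewrite ?normr1 ?normr0.
  have [[k _ Fkx]|nF] := pselect ((\bigcup_k F k) x).
    apply: cvg_near_cst; exists k.+1 => // n /= kn.
    by rewrite !indicE !mem_set//; exists k.
  apply: cvg_near_cst; exists 0%N => // n _.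
  by rewrite !indicE !memNset// => -[k _ Fkx]; apply: nF; exists k.
by apply/esym; apply: (cvg_unique _ (cvg_cst (0 : R)) h).
Qed.

Lemma bmeas_sum (I : Type) (s : seq I) (F : I -> T -> R) :
  (forall i, bmeas (F i)) -> bmeas (fun x => \sum_(i <- s) F i x).
Proof.
move=> bF; elim: s => [|i s IH].
  by under eq_fun do rewrite big_nil; exact: bmeas_cst.
by under eq_fun do rewrite big_cons; exact: bmeasD.
Qed.

Lemma bclin_sum L (I : Type) (s : seq I) (F : I -> T -> R) : bclin L ->
  (forall i, bmeas (F i)) ->
  L (fun x => \sum_(i <- s) F i x) = \sum_(i <- s) L (F i).
Proof.
move=> hL bF; elim: s => [|i s IH].
  by rewrite big_nil; under eq_fun do rewrite big_nil; exact: bclin0.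
rewrite big_cons -IH -bclinD//; last exact: bmeas_sum.
by congr L; apply/funext => x; rewrite big_cons.
Qed.

Import HBNNSimple.

(** After addition of a constant, f is a bounded pointwise limit of simple
    functions. *)
Lemma bclin_eq0 L : bclin L -> (forall A, measurable A -> L (\1_A) = 0) ->
  forall f, bmeas f -> L f = 0.
Proof.
move=> hL L0 f bf; have [mf [K fK]] := bf.
have simple (h : {nnsfun T >-> R}) : L (h : T -> R) = 0.
  pose s := finmap.enum_fset (fset_set (range h)).
  rewrite (_ : (h : T -> R) = fun x => \sum_(i <- s) (i * \1_(h @^-1` [set i]) x)).
    rewrite bclin_sum//; last first.
      by move=> i; apply: bmeasM; [exact: bmeas_cst|exact: bmeas_indic].
    by rewrite big1// => i _; rewrite bclinZ ?L0 ?mulr0//; exact: bmeas_indic.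
  by apply/funext => x; rewrite fimfunE fsbig_finite//; exact: fimfunP.
have fK0 x : 0 <= f x + K by have := fK x; rewrite ler_norml; lra.
have mfK : measurable_fun setT (EFin \o (fun x => f x + K)).
  by apply/measurable_EFinP; exact: measurable_funD.
pose h := nnsfun_approx measurableT mfK.
have hcvg x : h n x @[n --> \oo] --> f x + K.
  have := cvg_nnsfun_approx measurableT mfK; move=> /(_ _ x I).
  by move=> /(_ (fun y _ => fK0 y)) /fine_cvg.
have hle n x : h n x <= f x + K.
  rewrite -(cvg_lim _ (hcvg x))//; apply: nondecreasing_cvgn_le.
    by move=> p q pq; exact/lefP/nd_nnsfun_approx.
  by apply/cvg_ex; exists (f x + K).
have bK : bmeas (fun x => f x + K) by apply: bmeasD => //; exact: bmeas_cst.
have bh n : bmeas (h n).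
  split; first exact: measurable_funP.
  exists (2 * K) => x; rewrite ger0_norm ?fun_ge0// (le_trans (hle n x))//.
  by have := fK x; rewrite ler_norml; lra.
have hK n x : `|h n x| <= 2 * K.
  rewrite ger0_norm ?fun_ge0// (le_trans (hle n x))//.
  by have := fK x; rewrite ler_norml; lra.
have : L (h n) @[n --> \oo] --> L (fun x => f x + K) := hL.2 _ _ _ bh bK hK hcvg.
rewrite (_ : (fun n => L (h n)) = fun=> 0); last by apply/funext => n; exact: simple.
move=> c0; have : L (fun x => f x + K) = 0.
  by apply/esym; apply: (cvg_unique _ (cvg_cst (0 : R)) c0).
rewrite bclinD//; last exact: bmeas_cst.
have -> : L (fun=> K) = 0; last by rewrite addr0.
rewrite (_ : (fun=> K) = fun x => K * \1_setT x).
  by rewrite bclinZ ?L0 ?mulr0//; exact: bmeas_indic.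
by apply/funext => x; rewrite indicT mulr1.
Qed.

Lemma bclin_pi_eq0 L (G : set (set T)) : bclin L ->
  @measurable _ T = <<s G >> -> setI_closed G ->
  L (\1_setT) = 0 -> (forall A, G A -> L (\1_A) = 0) ->
  forall f, bmeas f -> L f = 0.
Proof.
by move=> hL GE GI LT LG; apply: bclin_eq0 => //; exact: bclin_indic_eq0 GE GI LT LG.
Qed.

Section integral_functional.
Context d' (T' : measurableType d') (m : {measure set T' -> \bar R}).
Variables (D : set T') (mD : measurable D) (h : T' -> T) (mh : measurable_fun setT h).
Variables (g : T' -> R) (ig : m.-integrable D (EFin \o g)).

Lemma integrable_bmeas f : bmeas f ->
  m.-integrable D (fun x => (f (h x) * g x)%:E).
Proof.
move=> [mf [K fK]].
have mfh : measurable_fun D (f \o h) by apply: measurable_funTS; exact: measurableT_comp.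
apply: (@le_integrable _ _ _ m D mD _ (fun x => (K * g x)%:E)) => //.
- apply/measurable_EFinP; apply: measurable_funM => //.
  exact/measurable_EFinP/measurable_int/ig.
- move=> x Dx /=; rewrite lee_fin !normrM ler_wpM2r//.
  by rewrite (le_trans (fK _))// ler_norm.
- by under eq_fun do rewrite EFinM; exact: integrableZl.
Qed.

Lemma bclin_integral : bclin (fun f => \int[m]_(x in D) (f (h x) * g x)).
Proof.
split=> [k f1 f2 b1 b2|F f K bF bf FK Ff].
  rewrite -RintegralZl//; last exact: integrable_bmeas.
  rewrite -RintegralD//; last 2 first.
  - by under [X in _.-integrable _ X]eq_fun do rewrite /= EFinM; apply: integrableZl => //; exact: integrable_bmeas.
  - exact: integrable_bmeas.
  by apply: eq_Rintegral => x _; rewrite mulrDl mulrA.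
have mg : measurable_fun D g by exact/measurable_EFinP/measurable_int/ig.
have mfh f' : bmeas f' -> measurable_fun D (fun x => f' (h x) * g x).
  move=> [mf' _]; apply: measurable_funM => //; apply: measurable_funTS.
  exact: (measurableT_comp mf').
have [|||||_ _ c] := @dominated_convergence _ _ _ m D mD
  (fun n x => (F n (h x) * g x)%:E) (fun x => (f (h x) * g x)%:E)
  (fun x => (`|K * g x|)%:E).
- by move=> n; apply/measurable_EFinP; exact: mfh.
- by apply/measurable_EFinP; exact: mfh.
- apply/aeW => x Dx; apply: cvg_EFin; first by apply: nearW.
  by apply: cvgMr_tmp; exact: Ff.
- under eq_fun do rewrite -abse_EFin; apply: integrable_abse.
  by under eq_fun do rewrite EFinM; exact: integrableZl.
- apply/aeW => x n Dx; rewrite abse_EFin lee_fin !normrM ler_wpM2r//.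
  by rewrite (le_trans (FK _ _))// ler_norm.
rewrite /Rintegral; apply: fine_cvg; rewrite fineK//.
by apply: integrable_fin_num => //; exact: integrable_bmeas.
Qed.

End integral_functional.

End bounded_measurable.

(** * Integral operators in one coordinate *)

Section kernel_operators.
Context {R : realType} {d : nat}.
Local Notation E := 'cV[R]_d.
Local Notation lebR := (@lebesgue_measure R).
Implicit Types (i j : 'I_d) (psi : E -> R) (kap : R -> R -> R).

Lemma EFin_Rintegral d' (T : measurableType d') (m : {measure set T -> \bar R})
  (D : set T) (f : T -> R) : measurable D -> m.-integrable D (EFin \o f) ->
  ((\int[m]_(x in D) f x)%:E = \int[m]_(x in D) (f x)%:E)%E.
Proof. by move=> mD iF; rewrite /Rintegral fineK//; exact: integrable_fin_num. Qed.

Definition kern kap :=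
  measurable_fun setT (fun st : measurableTypeR R * measurableTypeR R => kap st.1 st.2) /\
  exists al be C, forall s t, `|kap s t| <= C * \1_`[al, be] t.

(** Integrates out the i-th coordinate with a weight that may depend on its
    former value. The integral over a segment and the primitive along it are
    both of this form, so that boundedness, measurability and commutation are
    proved once. *)
Definition kop i kap psi : E -> R := fun y =>
  \int[lebR]_t (psi (set_coord y i t) * kap (y i ord0) t).

Lemma integrable_box_indic (al be C : R) :
  lebR.-integrable setT (fun t => (C * \1_`[al, be] t)%:E).
Proof.
under eq_fun do rewrite EFinM; apply: integrableZl => //.
apply/integrableP; split; first exact/measurable_EFinP/measurable_indic.
under eq_integral do rewrite gee0_abs ?lee_fin//.
have : (lebR `[al, be] < +oo)%E.
  by rewrite lebesgue_measure_itv/=; case: ifP => // _; rewrite -EFinD ltry.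
by rewrite integral_indic// setIT.
Qed.

Lemma kern_measurable kap s : kern kap -> measurable_fun setT (kap s).
Proof.
by move=> [mk _]; exact: (measurable_fun_pair2 s mk).
Qed.

Lemma kern_integrable kap s : kern kap -> lebR.-integrable setT (EFin \o kap s).
Proof.
move=> hk; have [_ [al [be [C kC]]]] := hk.
apply: (le_integrable _ _ _ (integrable_box_indic al be C)) => //.
  by apply/measurable_EFinP; exact: kern_measurable.
by move=> t _ /=; rewrite lee_fin (le_trans (kC _ _))// ler_norm.
Qed.

Lemma kop_bclin_at i kap y : kern kap -> bclin (fun psi => kop i kap psi y).
Proof.
move=> hk; exact: (@bclin_integral R _ E _ (measurableTypeR R) lebR setT measurableT
  (fun t => set_coord y i t) (measurable_slice i y) _ (kern_integrable (y i ord0) hk)).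
Qed.

Lemma kop_integrable i kap psi y : kern kap -> bmeas psi ->
  lebR.-integrable setT (fun t => (psi (set_coord y i t) * kap (y i ord0) t)%:E).
Proof.
move=> hk bp; exact: (@integrable_bmeas R _ E _ (measurableTypeR R) lebR setT measurableT
  (fun t => set_coord y i t) (measurable_slice i y) _ (kern_integrable (y i ord0) hk)).
Qed.

Lemma measurable_kop i kap psi : kern kap -> measurable_fun setT psi ->
  measurable_fun setT (kop i kap psi).
Proof.
move=> [mk _] mp.
pose f (yt : E * measurableTypeR R) : R := psi (set_coord yt.1 i yt.2) * kap (yt.1 i ord0) yt.2.
have mf : measurable_fun setT (EFin \o f).
  apply/measurable_EFinP; apply: measurable_funM.
    exact: (measurableT_comp mp (@measurable_set_coord _ _ i)).
  apply: (measurableT_comp mk (g := fun yt : E * measurableTypeR R => (yt.1 i ord0 : measurableTypeR R, yt.2))).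
  apply: measurable_fun_pair => //.
  exact: (measurableT_comp (measurable_cV_coord _)).
apply: (measurableT_comp (f := @fine R)) => //.
rewrite (_ : (fun y => _) = fun y => (\int[lebR]_t (EFin \o f)^\+ (y, t) -
                                     \int[lebR]_t (EFin \o f)^\- (y, t))%E).
  apply: emeasurable_funB.
    by apply: measurable_fun_fubini_tonelli_F => //; exact: measurable_funepos.
  by apply: measurable_fun_fubini_tonelli_F => //; exact: measurable_funeneg.
apply/funext => y; rewrite [LHS]integralE; congr (_ - _)%E; apply: eq_integral => t _.
  exact: (congr1 (@^~ t) (funepos_comp (EFin \o f) (pair y))).
exact: (congr1 (@^~ t) (funeneg_comp (EFin \o f) (pair y))).
Qed.

Lemma kop_bound kap : kern kap -> exists C, forall i psi K y, bmeas psi ->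
  (forall x, `|psi x| <= K) -> `|kop i kap psi y| <= K * C.
Proof.
move=> hk; have [_ [al [be [C kC]]]] := hk.
exists (\int[lebR]_t (C * \1_`[al, be] t)) => i psi K y bp pK.
rewrite -RintegralZl//; last exact: integrable_box_indic.
apply: (le_trans (le_normr_Rintegral measurableT (kop_integrable i y hk bp))).
apply: le_Rintegral => //.
- by apply: (integrable_abse (kop_integrable i y hk bp)).
- by under [X in _.-integrable _ X]eq_fun do rewrite /= EFinM; apply: integrableZl => //;
    exact: integrable_box_indic.
- by move=> t _; rewrite normrM ler_pM.
Qed.

Lemma bmeas_kop i kap psi : kern kap -> bmeas psi -> bmeas (kop i kap psi).
Proof.
move=> hk bp; split; first by apply: measurable_kop => //; exact: bp.1.
have [_ [K pK]] := bp; have [C kC] := kop_bound hk.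
by exists (K * C) => y; exact: kC.
Qed.

Lemma bclin_kop i kap (L : (E -> R) -> R) : kern kap -> bclin L ->
  bclin (fun psi => L (kop i kap psi)).
Proof.
move=> hk hL; split=> [k f g bf bg|F f K bF bf FK Ff].
  rewrite -(hL.1 k)//; try exact: bmeas_kop.
  by congr L; apply/funext => y; exact: (kop_bclin_at i y hk).1.
have [C kC] := kop_bound hk.
apply: (hL.2 (fun n => kop i kap (F n)) _ (K * C)).
- by move=> n; exact: bmeas_kop.
- exact: bmeas_kop.
- by move=> n x; exact: kC.
- by move=> x; exact: ((kop_bclin_at i x hk).2 _ _ K).
Qed.

Lemma kopB i kap f g : kern kap -> bmeas f -> bmeas g ->
  kop i kap (fun x => f x - g x) = (fun y => kop i kap f y - kop i kap g y).
Proof. by move=> hk bf bg; apply/funext => y; exact: (bclinB (kop_bclin_at i y hk)). Qed.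

Lemma kopZ i kap k f : kern kap -> bmeas f ->
  kop i kap (fun x => k * f x) = (fun y => k * kop i kap f y).
Proof. by move=> hk bf; apply/funext => y; exact: (bclinZ _ (kop_bclin_at i y hk)). Qed.

Lemma kop0 i kap : kop i kap (fun=> 0) = fun=> 0.
Proof.
apply/funext => y; rewrite /kop; under eq_Rintegral do rewrite mul0r.
by rewrite Rintegral_cst// mul0r.
Qed.

Lemma kop_set_coord i kap psi y s :
  kop i kap psi (set_coord y i s) =
  \int[lebR]_t (psi (set_coord y i t) * kap s t).
Proof.
apply: eq_Rintegral => t _.
by rewrite set_coord_set set_coordE eqxx.
Qed.

(** Fubini's theorem in the plane of the two coordinates. *)
Lemma kopC i j kap kap' psi : i != j -> kern kap -> kern kap' -> bmeas psi ->
  kop i kap (kop j kap' psi) = kop j kap' (kop i kap psi).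
Proof.
move=> ij hk hk' bp; apply/funext => y.
pose F (st : measurableTypeR R * measurableTypeR R) : R :=
  psi (set_coord (set_coord y i st.1) j st.2) * kap (y i ord0) st.1 * kap' (y j ord0) st.2.
have mF : measurable_fun setT (EFin \o F).
  apply/measurable_EFinP; apply: measurable_funM; last first.
    exact: (measurableT_comp (kern_measurable _ hk')).
  apply: measurable_funM; last exact: (measurableT_comp (kern_measurable _ hk)).
  apply: (measurableT_comp bp.1).
  apply: measurable_fun_cV => k; under eq_fun do rewrite !set_coordE.
  by case: eqP => _; [exact: measurable_snd|case: eqP => _; [exact: measurable_fst|exact: measurable_cst]].
have [_ [al [be [C kC]]]] := hk.
have [_ [al' [be' [C' kC']]]] := hk'.
have [_ [K pK]] := bp.
pose Q : set (measurableTypeR R * measurableTypeR R) := `[al, be] `*` `[al', be'].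
have mQ : measurable Q by exact: measurableX.
have iF : (lebR \x lebR)%E.-integrable setT (EFin \o F).
  apply: (@le_integrable _ _ _ _ setT measurableT _ (fun st => (K * C * C' * \1_Q st)%:E)) => //.
    move=> [s t] _ /=; rewrite lee_fin !normrM -!mulrA.
    apply: (@le_trans _ _ (K * (C * \1_`[al, be] s * (C' * \1_`[al', be'] t)))).
      by rewrite ler_pM ?mulr_ge0// ler_pM.
    rewrite -!normrM (le_trans _ (ler_norm _))//.
    rewrite (_ : \1_Q (s, t) = \1_`[al, be] s * \1_`[al', be'] t); first by lra.
    rewrite !indicE -natrM mulnb; congr (nat_of_bool _)%:R.
    by apply/idP/andP; rewrite !inE.
  under eq_fun do rewrite EFinM; apply: integrableZl => //.
  apply/integrableP; split; first exact/measurable_EFinP/measurable_indic.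
  under eq_integral do rewrite gee0_abs ?lee_fin//.
  rewrite integral_indic// setIT.
  have fin u v : (lebR `[u, v]%classic < +oo)%E.
    by rewrite lebesgue_measure_itv/=; case: ifP => // _; rewrite -EFinD ltry.
  rewrite [X in (X < _)%E](_ : _ = lebR `[al, be]%classic * lebR `[al', be']%classic)%E.
    by rewrite lte_mul_pinfty ?ge0_fin_numE.
  exact: product_measure1E.
rewrite /kop /Rintegral; congr fine.
transitivity (\int[lebR]_s \int[lebR]_t (EFin \o F) (s, t))%E.
  apply: eq_integral => s _; rewrite -/(Rintegral _ _ _) mulrC EFinM EFin_Rintegral//; last first.
    exact: kop_integrable.
  rewrite -integralZl//; last exact: kop_integrable.
  apply: eq_integral => t _; rewrite /F/= -EFinM set_coordE eq_sym (negbTE ij).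
  by congr EFin; ring.
rewrite Fubini//.
apply: eq_integral => t _; rewrite -/(Rintegral _ _ _) mulrC EFinM EFin_Rintegral//; last first.
  exact: kop_integrable.
rewrite -integralZl//; last exact: kop_integrable.
apply: eq_integral => s _; rewrite /F/= -EFinM set_coordE (negbTE ij) set_coordC//.
by congr EFin; ring.
Qed.

End kernel_operators.

(** * Means, primitives and functions of mean zero *)

Section means.
Context {R : realType} {d : nat}.
Local Notation E := 'cV[R]_d.
Local Notation lebR := (@lebesgue_measure R).
Variables (a b : 'I_d -> R) (ab : forall i, a i < b i).
Implicit Types (i j : 'I_d) (psi : E -> R).

(** Constant in s: the integral over a segment does not depend on the point of
    the segment. *)
Definition ker_int i (s t : R) : R := \1_`[a i, b i] t.
Definition ker_prim i (s t : R) : R := \1_`[a i, b i] t * (t <= s)%R%:R.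

Definition line_int i := kop i (ker_int i).
Definition line_prim i := kop i (ker_prim i).

Lemma kern_int i : kern (ker_int i).
Proof.
split; last by exists (a i), (b i), 1 => s t; rewrite mul1r ger0_norm.
by apply: (measurableT_comp (f := \1_`[a i, b i] : measurableTypeR R -> R)) => //; exact: measurable_indic.
Qed.

Lemma measurable_le_indic : measurable_fun setT
  (fun st : measurableTypeR R * measurableTypeR R => ((st.2 <= st.1)%R%:R : R)).
Proof.
rewrite (_ : (fun _ => _) = \1_[set st : measurableTypeR R * measurableTypeR R | st.2 <= st.1]).
  apply: measurable_indic.
  rewrite -[X in measurable X]setTI.
  have := @measurable_fun_ler _ (measurableTypeR R * measurableTypeR R)%type R setT
    snd fst (@measurable_snd _ _ _ _) (@measurable_fst _ _ _ _).
  move=> /(_ measurableT [set true]) -/(_ I).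
  by congr (measurable _); apply/seteqP; split => st /= [? ?].
by apply/funext => st; rewrite indicE; congr (nat_of_bool _)%:R; apply/idP/idP; rewrite inE.
Qed.

Lemma kern_prim i : kern (ker_prim i).
Proof.
split.
  apply: measurable_funM; last exact: measurable_le_indic.
  exact: (kern_int i).1.
exists (a i), (b i), 1 => s t; rewrite mul1r /ker_prim normrM ger0_norm// ler_piMr//.
by case: (t <= s); rewrite ?normr1 ?normr0.
Qed.

Lemma line_intE i psi y : line_int i psi y =
  \int[lebR]_(t in `[a i, b i]) psi (set_coord y i t).
Proof.
by rewrite [RHS]Rintegral_mkcond; apply: eq_Rintegral => t _; rewrite patchE /ker_int indicE;
  case: (_ \in _); rewrite ?mulr1 ?mulr0.
Qed.

Lemma slice_meanE i psi : slice_mean a b i psi = fun y => (b i - a i)^-1 * line_int i psi y.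
Proof. by apply/funext => y; rewrite line_intE. Qed.

Lemma line_int_set_coord i psi y s : line_int i psi (set_coord y i s) = line_int i psi y.
Proof. by rewrite /line_int kop_set_coord. Qed.

Lemma int_ker_int i : \int[lebR]_t ker_int i 0 t = b i - a i.
Proof.
rewrite /ker_int -[RHS]/(fine (b i - a i)%:E) /Rintegral; congr fine.
rewrite integral_indic// setIT.
have : lebR `[a i, b i]%classic = (b i - a i)%:E; last by [].
by rewrite lebesgue_measure_itv/= lte_fin ab EFinB.
Qed.

Lemma line_int_cst i psi y : (forall s, psi (set_coord y i s) = psi y) ->
  line_int i psi y = (b i - a i) * psi y.
Proof.
move=> pc; rewrite /line_int /kop; under eq_Rintegral do rewrite pc.
by rewrite RintegralZl ?int_ker_int 1?mulrC//; exact: (kern_integrable 0 (kern_int i)).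
Qed.

Lemma line_int_mulr i psi g y : (forall s, g (set_coord y i s) = g y) ->
  bmeas psi ->
  line_int i (fun x => psi x * g x) y = line_int i psi y * g y.
Proof.
move=> gc bp; rewrite /line_int /kop -RintegralZr//; last exact: kop_integrable (kern_int i) bp.
by apply: eq_Rintegral => t _; rewrite gc; ring.
Qed.

Lemma line_int_ge0 i psi y : (forall x, 0 <= psi x) -> 0 <= line_int i psi y.
Proof. by move=> p0; apply: Rintegral_ge0 => t _; rewrite mulr_ge0// /ker_int. Qed.

Lemma le_line_int i f g y : bmeas f -> bmeas g -> (forall x, f x <= g x) ->
  line_int i f y <= line_int i g y.
Proof.
move=> bf bg fg; rewrite -subr_ge0 -(bclinB (kop_bclin_at i y (kern_int i)))//.
by apply: line_int_ge0 => x; rewrite subr_ge0.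
Qed.

Lemma le_half (u v w : R) : u <= v -> u <= w -> u <= 2^-1 * (v + w).
Proof. by move=> *; lra. Qed.

(** As psi has integral zero on the segment, its primitive is both the integral
    up to the point and minus the integral beyond it. The absolute values of
    these two integrals have sum at most the integral of |psi|, so they are both
    at most half of it. *)
Lemma line_prim_le_half i psi y : bmeas psi -> line_int i psi y = 0 ->
  `|line_prim i psi y| <= 2^-1 * line_int i (fun x => `|psi x|) y.
Proof.
move=> bp p0.
set s := y i ord0.
pose kl t := ker_prim i s t; pose ku t := ker_int i s t - ker_prim i s t.
have klu t : 0 <= kl t /\ 0 <= ku t.
  rewrite /kl /ku /ker_int /ker_prim; split; first by rewrite mulr_ge0.
  by rewrite subr_ge0 ler_piMr//; case: (t <= s).
have bn := bmeas_norm bp.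
have i1 := kop_integrable i y (kern_int i) bp.
have i2 := kop_integrable i y (kern_prim i) bp.
have i1n := kop_integrable i y (kern_int i) bn.
have i2n := kop_integrable i y (kern_prim i) bn.
have iu : lebR.-integrable setT (fun t => (psi (set_coord y i t) * ku t)%:E).
  by rewrite /ku; under eq_fun do rewrite mulrBr EFinB; exact: integrableB.
have iun : lebR.-integrable setT (fun t => (`|psi (set_coord y i t)| * ku t)%:E).
  by rewrite /ku; under eq_fun do rewrite mulrBr EFinB; exact: integrableB.
have JE : line_prim i psi y = - \int[lebR]_t (psi (set_coord y i t) * ku t).
  apply/eqP; rewrite -addr_eq0 -p0 /line_prim /line_int /kop -RintegralD//.
  by apply/eqP; apply: eq_Rintegral => t _; rewrite /ku; ring.
have nE : line_int i (fun x => `|psi x|) y = line_prim i (fun x => `|psi x|) y +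
    \int[lebR]_t (`|psi (set_coord y i t)| * ku t).
  rewrite /line_prim /line_int /kop -RintegralD//.
  by apply: eq_Rintegral => t _; rewrite /ku; ring.
have h1 : `|line_prim i psi y| <= line_prim i (fun x => `|psi x|) y.
  apply: (le_trans (le_normr_Rintegral measurableT i2)).
  rewrite le_eqVlt; apply/orP; left; apply/eqP; apply: eq_Rintegral => t _.
  by rewrite normrM (ger0_norm (klu t).1).
have h2 : `|line_prim i psi y| <= \int[lebR]_t (`|psi (set_coord y i t)| * ku t).
  rewrite JE normrN; apply: (le_trans (le_normr_Rintegral measurableT iu)).
  rewrite le_eqVlt; apply/orP; left; apply/eqP; apply: eq_Rintegral => t _.
  by rewrite normrM (ger0_norm (klu t).2).
by rewrite nE; exact: le_half.
Qed.

Definition mean_free (s : seq 'I_d) (psi : E -> R) : E -> R :=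
  foldr (fun i g => g \- slice_mean a b i g) psi s.

Lemma bmeas_slice_mean i psi : bmeas psi -> bmeas (slice_mean a b i psi).
Proof.
move=> bp; rewrite slice_meanE; apply: bmeasM; first exact: bmeas_cst.
exact: bmeas_kop (kern_int i) bp.
Qed.

Lemma bmeas_mean_free s psi : bmeas psi -> bmeas (mean_free s psi).
Proof.
by move=> bp; elim: s => //= i s IH; apply: bmeasB => //; exact: bmeas_slice_mean.
Qed.

(** Subtracting the mean in direction i annihilates the integrals in that
    direction; subtracting means in other directions keeps this property because
    the operators commute. *)
Lemma line_int_mean_free s i psi : bmeas psi -> i \in s ->
  line_int i (mean_free s psi) = fun=> 0.
Proof.
move=> bp; elim: s => //= j s IH; rewrite inE.
set g := mean_free s psi in IH *.
have bg : bmeas g by exact: bmeas_mean_free.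
have bN k h : bmeas h -> bmeas (line_int k h) by exact: bmeas_kop (kern_int k).
have -> : line_int i (g \- slice_mean a b j g) =
    fun y => line_int i g y - (b j - a j)^-1 * line_int i (line_int j g) y.
  rewrite slice_meanE /line_int (kopB i (kern_int i) (f := g))//; last first.
    by apply: bmeasM; [exact: bmeas_cst|exact: bN].
  by apply/funext => y; rewrite (kopZ i _ (kern_int i))//; exact: bN.
have [<- _|ij /= /IH Ng] := eqVneq i j.
  apply/funext => y; rewrite (line_int_cst (psi := line_int i g)); last by move=> s'; rewrite line_int_set_coord.
  by rewrite mulrA mulVf ?mul1r ?subrr// subr_eq0 gt_eqF.
have -> : line_int i (line_int j g) = line_int j (line_int i g).
  by apply: kopC => //; exact: kern_int.
by apply/funext => y; rewrite Ng /line_int kop0 mulr0 subr0.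
Qed.

Definition prim_seq (s : seq 'I_d) (psi : E -> R) : E -> R := foldr line_prim psi s.
Definition int_seq (s : seq 'I_d) (psi : E -> R) : E -> R := foldr line_int psi s.

Lemma bmeas_prim_seq s psi : bmeas psi -> bmeas (prim_seq s psi).
Proof. by move=> bp; elim: s => //= i s IH; exact: bmeas_kop (kern_prim i) IH. Qed.

Lemma bmeas_int_seq s psi : bmeas psi -> bmeas (int_seq s psi).
Proof. by move=> bp; elim: s => //= i s IH; exact: bmeas_kop (kern_int i) IH. Qed.

Lemma int_seq_ge0 s psi y : (forall x, 0 <= psi x) -> 0 <= int_seq s psi y.
Proof. by move=> p0; elim: s y => //= i s IH y; exact: line_int_ge0. Qed.

(** Primitives in other directions commute with integration in direction i. *)
Lemma line_int_prim_seq s i psi : bmeas psi -> i \notin s ->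
  line_int i psi = (fun=> 0) -> line_int i (prim_seq s psi) = fun=> 0.
Proof.
move=> bp + p0; elim: s => //= j s IH; rewrite inE negb_or => /andP[ij /IH h].
rewrite [LHS]kopC//; [|exact: kern_int|exact: kern_prim|exact: bmeas_prim_seq].
by rewrite -/(line_int i _) h kop0.
Qed.

(** Each primitive contributes a factor 1/2, because the function to which it is
    applied still has mean zero in its direction. *)
Lemma prim_seq_le s psi y : uniq s -> bmeas psi ->
  (forall i, i \in s -> line_int i psi = fun=> 0) ->
  `|prim_seq s psi y| <= (2 ^+ size s)^-1 * int_seq s (fun x => `|psi x|) y.
Proof.
move=> + bp; elim: s y => [y _ _|i s IH y /= /andP[si us] p0].
  by rewrite expr0 invr1 mul1r.
have {}IH x : `|prim_seq s psi x| <= (2 ^+ size s)^-1 * int_seq s (fun x => `|psi x|) x.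
  by apply: IH => // j js; apply: p0; rewrite inE js orbT.
have bn := bmeas_norm bp.
apply: (le_trans (line_prim_le_half _ _)).
- exact: bmeas_prim_seq.
- by rewrite line_int_prim_seq// p0// mem_head.
rewrite exprS invfM -mulrA ler_wpM2l//.
rewrite -(bclinZ _ (kop_bclin_at i y (kern_int i))); last exact: bmeas_int_seq.
apply: le_line_int => //.
- exact/bmeas_norm/bmeas_prim_seq.
- by apply: bmeasM; [exact: bmeas_cst|exact: bmeas_int_seq].
Qed.

End means.

(** * One-dimensional bumps *)

Section bumps.
Context {R : realType}.
Implicit Types (al be t : R) (n : nat).

(** The positive part, whose square is C^1. *)
Definition pos t : R := (t + `|t|) / 2.

Lemma posE t : pos t = if 0 <= t then t else 0.
Proof.
rewrite /pos; case: ifPn => [t0|]; first by rewrite ger0_norm//; field.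
by rewrite -ltNge => /ltr0_norm ->; rewrite subrr mul0r.
Qed.

Lemma pos_ge0 t : 0 <= pos t.
Proof. by rewrite posE; case: ifP. Qed.

Lemma continuous_pos : continuous pos.
Proof.
move=> t; apply: cvgMr_tmp; apply: cvgD; first exact: cvg_id.
exact: norm_continuous.
Qed.

Lemma is_derive_sqpos (t : R) : is_derive t 1 (fun s : R => pos s ^+ 2 : R) (2 * pos t).
Proof.
have [t0|t0|->] := ltgtP t 0.
- rewrite posE leNgt t0 /= mulr0.
  apply: (@near_eq_is_derive R R R (cst 0)).
    near=> s; rewrite posE ifF ?expr0n//; apply/negbTE; rewrite -ltNge.
    by near: s; exact: lt_nbhsl.
- rewrite posE (ltW t0) /=.
  apply: (@near_eq_is_derive R R R (fun s : R => s ^+ 2)).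
    near=> s; rewrite posE ifT//; apply: ltW; near: s; exact: lt_nbhsr.
  rewrite -[X in is_derive _ _ _ X](_ : (2%:R * t ^+ 1) *: (1 : R) = _).
    by exact: (@is_deriveX R R id 2 t 1 1 (is_derive_id t 1)).
  by rewrite scaler1 expr1.
- rewrite posE lexx mulr0.
  have norm0 : `|h| @[h --> (0:R)^'] --> (0 : R).
    apply: cvg_within_filter; have := @norm_continuous R R 0.
    by rewrite /continuous_at normr0.
  have c0 : h^-1 *: (pos (h *: 1 + 0) ^+ 2 - pos 0 ^+ 2) @[h --> (0:R)^'] --> (0 : R).
    apply: (@squeeze_cvgr _ _ _ _ (fun h => - `|h|) (fun h => `|h|)).
    - near=> h; rewrite scaler1 addr0 (posE 0) lexx expr0n subr0 posE.
      case: ifP => _; last by rewrite expr0n scaler0 oppr_le0 !normr_ge0.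
      have [->|h0] := eqVneq h 0; first by rewrite expr0n scaler0 normr0 oppr0 !lexx.
      by rewrite expr2 scalerA mulVf// scale1r -ler_norml.
    - have h := cvgN norm0; rewrite oppr0 in h. exact: h.
    - exact: norm0.
  by apply: DeriveDef; [apply/cvg_ex; exists 0|apply/cvg_lim].
Unshelve. all: by end_near. Qed.

(** A C^1 function equal to 0 for t <= 0 and to 1 for t >= 1. *)
Definition ramp t : R := 1 - pos (1 - pos t ^+ 2) ^+ 2.
Definition dramp t : R := 2 * pos (1 - pos t ^+ 2) * (2 * pos t).

Lemma is_derive_ramp (t : R) : is_derive t 1 ramp (dramp t).
Proof.
have h1 : is_derive t 1 (fun s : R => 1 - pos s ^+ 2 : R) (- (2 * pos t)).
  rewrite -[X in is_derive _ _ _ X]add0r; exact: (@is_deriveB R R R (cst 1) _ t 1 0 _ (is_derive_cst _ _ _) (is_derive_sqpos t)).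
have h2 := is_derive_sqpos (1 - pos t ^+ 2).
have h3 : is_derive t 1 (fun s : R => pos (1 - pos s ^+ 2) ^+ 2 : R) (- dramp t).
  rewrite (_ : - dramp t = 2 * pos (1 - pos t ^+ 2) * - (2 * pos t)); last by rewrite /dramp mulrN.
  exact: (@is_derive1_comp R (fun s => pos s ^+ 2) (fun s => 1 - pos s ^+ 2) t _ _ h2 h1).
rewrite -[dramp t]opprK -[X in is_derive _ _ _ X]add0r; exact: (@is_deriveB R R R (cst 1) _ t 1 0 _ (is_derive_cst _ _ _) h3).
Qed.

Lemma continuous_dramp : continuous dramp.
Proof.
have c1 : continuous (fun t : R => 2 * pos t).
  by move=> t; apply: cvgMl_tmp; exact: continuous_pos.
have c2 : continuous (fun t : R => 1 - pos t ^+ 2).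
  by move=> t; exact: (cvgB (cvg_cst _) (cvgM (@continuous_pos t) (@continuous_pos t))).
by move=> t; exact: (cvgM (continuous_comp (c2 t) (c1 _)) (c1 t)).
Qed.

Lemma ramp_ge0 t : 0 <= ramp t.
Proof.
rewrite subr_ge0 expr_le1// ?pos_ge0// posE; case: ifP => // _.
by rewrite gerBl sqr_ge0.
Qed.

Lemma ramp_le1 t : ramp t <= 1.
Proof. by rewrite gerBl sqr_ge0. Qed.

Lemma ramp0 t : t <= 0 -> ramp t = 0.
Proof.
move=> t0; have p0 : pos t = 0.
  by rewrite posE; case: ifP => // t0'; apply/eqP; rewrite eq_le t0.
by rewrite /ramp p0 expr0n subr0 posE ler01 expr1n subrr.
Qed.

Lemma ramp1 t : 1 <= t -> ramp t = 1.
Proof.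
move=> t1; have p1 : 1 - pos t ^+ 2 <= 0.
  rewrite posE (le_trans ler01 t1) subr_le0 expr_ge1// (le_trans ler01 t1)//.
by rewrite /ramp [X in _ - X ^+ 2]posE; case: ifP => h; rewrite ?expr0n ?subr0//;
  rewrite (_ : 1 - pos t ^+ 2 = 0) ?expr0n ?subr0//; apply/eqP; rewrite eq_le p1.
Qed.

(** Supported in the interval from al + 1/(n+1) to be - 1/(n+1), hence compactly
    in the open interval; it tends to the indicator of the latter. *)
Definition bump al be n t : R := ramp (n.+1%:R * (t - al) - 1) * ramp (n.+1%:R * (be - t) - 1).
Definition dbump al be n t : R :=
  ramp (n.+1%:R * (t - al) - 1) * (dramp (n.+1%:R * (be - t) - 1) * - n.+1%:R) +
  ramp (n.+1%:R * (be - t) - 1) * (dramp (n.+1%:R * (t - al) - 1) * n.+1%:R).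

Lemma is_derive_bump al be n t : is_derive t 1 (bump al be n) (dbump al be n t).
Proof.
have l1 : is_derive t 1 (fun s : R => n.+1%:R * (s - al) - 1 : R) n.+1%:R.
  have h := @is_deriveB R R R id (cst al) t 1 1 0 (is_derive_id t 1) (is_derive_cst _ _ _).
  have h' := @is_deriveZ R R R _ n.+1%:R t 1 _ h.
  have := @is_deriveB R R R _ (cst 1) t 1 _ 0 h' (is_derive_cst _ _ _).
  by rewrite !subr0 scaler1.
have l2 : is_derive t 1 (fun s : R => n.+1%:R * (be - s) - 1 : R) (- n.+1%:R).
  have h := @is_deriveB R R R (cst be) id t 1 0 1 (is_derive_cst _ _ _) (is_derive_id t 1).
  have h' := @is_deriveZ R R R _ n.+1%:R t 1 _ h.
  have := @is_deriveB R R R _ (cst 1) t 1 _ 0 h' (is_derive_cst _ _ _).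
  by rewrite subr0 sub0r scalerN scaler1.
apply: is_deriveM.
  exact: (@is_derive1_comp R ramp _ t _ _ (is_derive_ramp _) l1).
exact: (@is_derive1_comp R ramp _ t _ _ (is_derive_ramp _) l2).
Qed.

Lemma continuous_ramp : continuous ramp.
Proof.
move=> t; apply/differentiable_continuous/derivable1_diffP.
exact: (@ex_derive _ _ _ _ _ _ _ (is_derive_ramp t)).
Qed.

Lemma continuous_dbump al be n : continuous (dbump al be n).
Proof.
have c1 : continuous (fun t : R => n.+1%:R * (t - al) - 1).
  move=> t; apply: cvgB; last exact: cvg_cst.
  by apply: cvgMl_tmp; apply: cvgB; [exact: cvg_id|exact: cvg_cst].
have c2 : continuous (fun t : R => n.+1%:R * (be - t) - 1).
  move=> t; apply: cvgB; last exact: cvg_cst.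
  by apply: cvgMl_tmp; apply: cvgB; [exact: cvg_cst|exact: cvg_id].
have cr (f : R -> R) : continuous f -> continuous (fun t => ramp (f t)).
  by move=> cf t; apply: (continuous_comp (cf t)); exact: continuous_ramp.
have cd (f : R -> R) : continuous f -> continuous (fun t => dramp (f t)).
  by move=> cf t; apply: (continuous_comp (cf t)); exact: continuous_dramp.
have c3 (x : R) : continuous (fun _ : R => x) by move=> t; exact: cvg_cst.
move=> t; apply: (cvgD (cvgM (cr _ c1 t) (cvgM (cd _ c2 t) (c3 _ t)))).
exact: (cvgM (cr _ c2 t) (cvgM (cd _ c1 t) (c3 _ t))).
Qed.

Lemma bump_ge0 al be n t : 0 <= bump al be n t.
Proof. by rewrite mulr_ge0// ramp_ge0. Qed.

Lemma bump_le1 al be n t : bump al be n t <= 1.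
Proof. by rewrite mulr_ile1 ?ramp_ge0 ?ramp_le1. Qed.

Lemma bump_out al be n t : ~~ (al + n.+1%:R^-1 <= t <= be - n.+1%:R^-1) -> bump al be n t = 0.
Proof.
have n0 : 0 < n.+1%:R :> R by rewrite ltr0n.
have e : n.+1%:R * n.+1%:R^-1 = 1 :> R by rewrite mulfV// gt_eqF.
rewrite negb_and -!ltNge => /orP[h|h]; rewrite /bump.
  by rewrite ramp0 ?mul0r// subr_le0 -[leRHS]e ler_pM2l// lerBlDl ltW.
by rewrite [X in _ * X]ramp0 ?mulr0// subr_le0 -[leRHS]e ler_pM2l// lerBlDl -lerBlDr ltW.
Qed.

Lemma bump_cvg al be t : bump al be n t @[n --> \oo] --> (\1_`]al, be[ t : R).
Proof.
rewrite indicE; have [|tab] := boolP (t \in `]al, be[%classic).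
  rewrite inE/= in_itv/= => /andP[alt tbe].
  have big (x : R) : 0 < x -> \forall n \near \oo, 1 <= n.+1%:R * x - 1.
    move=> x0; near=> n; rewrite lerBrDr -ler_pdivrMr//.
    apply: (@le_trans _ _ n%:R); last by rewrite ler_nat.
    by near: n; exact: nbhs_infty_ger.
  apply: cvg_near_cst; near=> n; rewrite /bump !ramp1 ?mulr1//.
    by near: n; apply: big; rewrite subr_gt0.
  by near: n; apply: big; rewrite subr_gt0.
apply: cvg_near_cst; near=> n; apply: bump_out.
apply: contra tab; rewrite inE/= in_itv/= => /andP[h1 h2].
have n0 : 0 < n.+1%:R^-1 :> R by rewrite invr_gt0.
by rewrite (lt_le_trans _ h1) ?ltrDl// (le_lt_trans h2)// gtrBl.
Unshelve. all: by end_near. Qed.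

End bumps.

(** * Products of bumps as test functions *)

Section tensor_tests.
Context {R : realType} {d : nat}.
Local Notation E := 'cV[R]_d.
Variables (a b : 'I_d -> R) (M : 'M[R]_d) (M_unit : M \in unitmx) (c : E).
Local Notation T := (affine M c).
Local Notation Ti := (affine_inv M c).
Implicit Types (th dth : 'I_d -> R -> R).

Definition C1_supp_in (al be : R) (f df : R -> R) :=
  [/\ forall t : R, is_derive t (1 : R) f (df t), continuous df,
   exists K, forall t, `|f t| <= K /\ `|df t| <= K &
   exists al' be', [/\ al < al', be' < be & forall t, ~~ (al' <= t <= be') -> f t = 0]].

Definition tensor th (y : E) : R := \prod_j th j (y j ord0).

Lemma cV_decomp (v : E) : v = \sum_j v j ord0 *: basis_vec j.
Proof.
apply/colP => k; rewrite summxE (bigD1 k)//= big1 ?addr0 => [|j jk].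
  by rewrite !mxE !eqxx mulr1.
by rewrite !mxE eq_sym (negbTE jk) mulr0.
Qed.

Lemma derive_decomp (f : E -> R) (v x : E) : differentiable f x ->
  'D_v f x = \sum_j v j ord0 * 'D_(basis_vec j) f x.
Proof.
move=> df; rewrite deriveE// {1}(cV_decomp v) linear_sum.
by apply: eq_bigr => j _; rewrite linearZ deriveE.
Qed.

Definition coordT j (x : E) : R := Ti x j ord0.

Lemma is_derive_coordT j x v : is_derive x v (coordT j) ((invmx M *m v) j ord0).
Proof.
have h t : coordT j (t *: v + x) = coordT j x + t * (invmx M *m v) j ord0.
  rewrite /coordT /affine_inv -addrA mulmxDr -scalemxAr.
  by rewrite [LHS]mxE [LHS]addrC [X in _ + X = _]mxE.
have c0 : h^-1 *: (coordT j (h *: v + x) - coordT j x) @[h --> (0:R)^'] -->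
    (invmx M *m v) j ord0.
  apply: cvg_near_cst; near=> t.
  rewrite h addrAC subrr add0r [_ *: _]mulrA mulVf ?mul1r//.
  by near: t; exact: nbhs_dnbhs_neq.
by apply: DeriveDef; [apply/cvg_ex; eexists; exact: c0|apply/cvg_lim].
Unshelve. all: by end_near. Qed.

Lemma continuous_coordT j : continuous (coordT j).
Proof.
move=> x; exact: (continuous_comp (@continuous_affine_inv R d M c x) (@coord_continuous R d 1 j ord0 _)).
Qed.

Lemma differentiable_coordT j x : differentiable (coordT j) x.
Proof.
pose l (y : E) : R := (invmx M *m y) j ord0.
pose lH := GRing.isLinear.Build R E R _ l (@mulmx_linear R d (invmx M) j).
pose lL : {linear E -> R} := HB.pack l lH.
have -> : coordT j = lL \- cst (l c).
  by apply/funext => y; rewrite /coordT /affine_inv mulmxBr [LHS]mxE [X in _ + X = _]mxE.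
apply: differentiableB; last exact: differentiable_cst.
apply: linear_differentiable; exact: continuous_mulmx.
Qed.

Section factors.
Variables (th dth : 'I_d -> R -> R).
Hypothesis C1th : forall j, C1_supp_in (a j) (b j) (th j) (dth j).

Let factor j (x : E) : R := th j (coordT j x).

Let th_continuous j : continuous (th j).
Proof.
move=> t; apply/differentiable_continuous/derivable1_diffP.
by have [h _ _ _] := C1th j; exact: (@ex_derive _ _ _ _ _ _ _ (h t)).
Qed.

Let factor_continuous j : continuous (factor j).
Proof.
by move=> x; exact: (continuous_comp (@continuous_coordT j x) (@th_continuous j _)).
Qed.

Let factor_differentiable j x : differentiable (factor j) x.
Proof.
apply: (@differentiable_comp _ _ _ _ (coordT j) (th j)); first exact: differentiable_coordT.
apply/derivable1_diffP; have [h _ _ _] := C1th j.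
exact: (@ex_derive _ _ _ _ _ _ _ (h _)).
Qed.

Let factor_derive j x v : 'D_v (factor j) x = dth j (coordT j x) * (invmx M *m v) j ord0.
Proof.
have dC := @differentiable_coordT j x; have [h _ _ _] := C1th j.
have dt : derivable (th j) (coordT j x) 1 by exact: (@ex_derive _ _ _ _ _ _ _ (h _)).
have dT : differentiable (th j) (coordT j x) by exact/derivable1_diffP.
rewrite deriveE; last exact: factor_differentiable.
rewrite /factor (@diff_comp _ _ _ _ (coordT j) (th j) x dC dT)/=.
have -> : 'd (coordT j) x v = (invmx M *m v) j ord0.
  by rewrite -deriveE//; apply: derive_val; exact: is_derive_coordT.
by rewrite deriv1E// derive1E (@derive_val _ _ _ _ _ _ _ (h _)) /= [LHS]mulrC.
Qed.

Let P (s : seq 'I_d) (x : E) : R := \prod_(j <- s) factor j x.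

Let P_differentiable s x : differentiable (P s) x.
Proof.
elim: s => [|j s IH].
  rewrite (_ : P [::] = cst 1); first exact: differentiable_cst.
  by apply/funext => y; rewrite /P big_nil.
rewrite (_ : P (j :: s) = factor j * P s); first exact: differentiableM.
by apply/funext => y; rewrite /P big_cons.
Qed.

Let P_derive_cons j s x v : 'D_v (P (j :: s)) x =
  factor j x * 'D_v (P s) x + P s x * 'D_v (factor j) x.
Proof.
rewrite (_ : P (j :: s) = factor j * P s); last first.
  by apply/funext => y; rewrite /P big_cons.
by rewrite deriveM//; exact: diff_derivable.
Qed.

Let P_continuous s : continuous (P s).
Proof. by move=> x; exact: differentiable_continuous. Qed.

Let P_derive_continuous s v : continuous ('D_v (P s)).
Proof.
elim: s => [|j s IH].
  rewrite (_ : 'D_v (P [::]) = cst 0); first exact: cst_continuous.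
  apply/funext => x; rewrite (_ : P [::] = cst 1) ?derive_cst//.
  by apply/funext => y; rewrite /P big_nil.
rewrite (_ : 'D_v (P (j :: s)) = fun x => factor j x * 'D_v (P s) x +
    P s x * (dth j (coordT j x) * (invmx M *m v) j ord0)); last first.
  by apply/funext => x; rewrite P_derive_cons factor_derive.
have [_ cd _ _] := C1th j.
have c1 : continuous (fun x => dth j (coordT j x)).
  by move=> x; exact: (continuous_comp (@continuous_coordT j x) (cd _)).
have c2 (r : R) : continuous (fun _ : E => r) by exact: cst_continuous.
move=> x; apply: (cvgD (cvgM (@factor_continuous j x) (IH x))).
exact: (cvgM (@P_continuous s x) (cvgM (c1 x) (c2 _ x))).
Qed.

Let P_derive i s x : uniq s -> 'D_(M *m basis_vec i) (P s) x =
  (i \in s)%:R * (dth i (coordT i x) * \prod_(j <- s | j != i) factor j x).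
Proof.
elim: s => [_|j s IH /= /andP[js us]].
  rewrite (_ : P [::] = cst 1) ?derive_cst ?mul0r//.
  by apply/funext => y; rewrite /P big_nil.
rewrite P_derive_cons IH// factor_derive mulKmx// basis_vecE inE big_cons.
have [<-|ji] := eqVneq j i.
  rewrite (negbTE js) mul0r mulr0 add0r /= mulr1 mul1r mulrC; congr (_ * _).
  rewrite /P big_seq_cond [RHS]big_seq_cond; apply: eq_bigl => k; rewrite andbT.
  by case: (boolP (k \in s)) => //= ks; apply/esym; apply: contraNneq js => <-.
by rewrite /= !mulr0 addr0; ring.
Qed.

Let tensorP : tensor th \o Ti = P (index_enum 'I_d).
Proof. by apply/funext => x. Qed.

(** In direction M e_i only the i-th coordinate of the preimage moves, and it
    moves at unit speed. *)
Lemma tensor_derive i x : 'D_(M *m basis_vec i) (tensor th \o Ti) x =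
  dth i (Ti x i ord0) * \prod_(j | j != i) th j (Ti x j ord0).
Proof.
by rewrite tensorP P_derive ?index_enum_uniq// mem_index_enum mul1r.
Qed.

Lemma tensor_C1_compact_support :
  C1_compact_support (T @` box a b)° (tensor th \o Ti).
Proof.
rewrite tensorP; split; [exact: P_differentiable|move=> j; exact: P_derive_continuous|].
have {}supp j : {ab : R * R | [/\ a j < ab.1, ab.2 < b j &
    forall t, ~~ (ab.1 <= t <= ab.2) -> th j t = 0]}.
  by apply/cid; have [_ _ _ [al' [be' h]]] := C1th j; exists (al', be').
pose al j := (sval (supp j)).1; pose be j := (sval (supp j)).2.
have h j : [/\ a j < al j, be j < b j & forall t, ~~ (al j <= t <= be j) -> th j t = 0].
  exact: (svalP (supp j)).
exists (T @` mbox (fun j => `[al j, be j]%classic)); split.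
- apply: continuous_compact.
    by apply: continuous_subspaceT; exact: continuous_affine.
  by apply: compact_mbox => j; exact: segment_compact.
- move=> _ [y yb <-]; rewrite interior_affine_box//= affineK// => j.
  have [h1 h2 _] := h j; have := yb j; rewrite /= !in_itv/= => /andP[h3 h4].
  by rewrite (lt_le_trans h1 h3) (le_lt_trans h4 h2).
- move=> x; rewrite affine_image// => /existsNP[j nj].
  rewrite -tensorP /= /tensor (bigD1 j)//=.
  have [_ _ ->] := h j; first by rewrite mul0r.
  by apply/negP => hj; apply: nj; rewrite /= in_itv.
Qed.

End factors.
End tensor_tests.

(** * Integration against a charge *)

Section charge_functional.
Context {R : realType} d (T : measurableType d).
Implicit Types (nu : {charge set T -> \bar R}) (D : set T).

Definition nupos nu : {measure set T -> \bar R} := jordan_pos (svalP (hahn_sets nu)).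
Definition nuneg nu : {measure set T -> \bar R} := jordan_neg (svalP (hahn_sets nu)).

Lemma nupos_fin nu A : measurable A -> nupos nu A \is a fin_num.
Proof. by move=> mA; exact: (@fin_num_measure _ _ _ (jordan_pos (svalP (hahn_sets nu)))). Qed.

Lemma nuneg_fin nu A : measurable A -> nuneg nu A \is a fin_num.
Proof. by move=> mA; exact: (@fin_num_measure _ _ _ (jordan_neg (svalP (hahn_sets nu)))). Qed.

Lemma charge_decomp nu A : measurable A -> (nu A = nupos nu A - nuneg nu A)%E.
Proof.
move=> mA; rewrite (jordan_decomp (svalP (hahn_sets nu)) mA).
by rewrite /cadd/= /cscale EFinN mulN1e.
Qed.

Lemma finite_cst_integrable (m : {measure set T -> \bar R}) D k :
  measurable D -> m D \is a fin_num -> m.-integrable D (EFin \o (fun=> k)).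
Proof.
move=> mD fD; apply/integrableP; split; first exact: measurable_cst.
by rewrite integral_cst// lte_mul_pinfty// ltey_eq fD.
Qed.

(** The factor 1 displays both terms as integrals against an integrable density,
    the form treated in [bclin_integral]. *)
Definition cint nu D d' (T' : measurableType d') (h : T -> T') (f : T' -> R) : R :=
  \int[nupos nu]_(x in D) (f (h x) * 1) + -1 * \int[nuneg nu]_(x in D) (f (h x) * 1).

Section cint.
Variables (nu : {charge set T -> \bar R}) (D : set T) (mD : measurable D).
Variables (d' : measure_display) (T' : measurableType d') (h : T -> T').
Hypothesis mh : measurable_fun setT h.

Let ipos : (nupos nu).-integrable D (EFin \o (fun=> 1)).
Proof. by apply: finite_cst_integrable => //; exact: nupos_fin. Qed.

Let ineg : (nuneg nu).-integrable D (EFin \o (fun=> 1)).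
Proof. by apply: finite_cst_integrable => //; exact: nuneg_fin. Qed.

Lemma cint_bclin : bclin (cint nu D h).
Proof.
apply: bclin_comb; first exact: (bclin_integral mD mh ipos).
exact: (bclin_integral mD mh ineg).
Qed.

Lemma cintE f : bmeas f -> ((cint nu D h f)%:E = charge_integral nu D (f \o h))%E.
Proof.
move=> bf; rewrite /cint EFinD mulN1r EFinN; congr (_ - _)%E.
  rewrite EFin_Rintegral//; last exact: (integrable_bmeas mD mh ipos).
  by apply: eq_integral => x _; rewrite mulr1.
rewrite EFin_Rintegral//; last exact: (integrable_bmeas mD mh ineg).
by apply: eq_integral => x _; rewrite mulr1.
Qed.

Lemma le_cint f (K : R) : bmeas f -> (forall x, D x -> `|f (h x)| <= K) ->
  ((`|cint nu D h f|)%:E <= K%:E * Defs.total_variation nu D)%E.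
Proof.
move=> bf fK.
have le1 (m : {measure set T -> \bar R}) : m D \is a fin_num ->
    `|\int[m]_(x in D) (f (h x) * 1)| <= K * fine (m D).
  move=> mfin; have i1 : m.-integrable D (EFin \o (fun=> 1)) by exact: finite_cst_integrable.
  apply: (le_trans (le_normr_Rintegral mD (integrable_bmeas mD mh i1 bf))).
  rewrite -Rintegral_cst//; apply: le_Rintegral => //.
  - exact: (integrable_abse (integrable_bmeas mD mh i1 bf)).
  - exact: finite_cst_integrable.
  - by move=> x Dx; rewrite mulr1 fK.
rewrite -[Defs.total_variation nu D]/(nupos nu D + nuneg nu D)%E.
have fp := nupos_fin nu mD; have fn := nuneg_fin nu mD.
rewrite -(fineK fp) -(fineK fn) -EFinD -EFinM lee_fin mulrDr.
by rewrite (le_trans (ler_normD _ _))// mulN1r normrN lerD// le1.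
Qed.

End cint.

Lemma cint_indic nu D A : measurable D -> measurable A ->
  cint nu D (T' := T) id (\1_A) = fine (nu (A `&` D)).
Proof.
move=> mD mA; have mAD := measurableI _ _ mA mD.
rewrite charge_decomp// fineB ?nupos_fin ?nuneg_fin// /cint mulN1r.
by congr (_ - _); rewrite /Rintegral; under eq_integral do rewrite mulr1;
  rewrite integral_indic.
Qed.

(** The Jordan parts of a sum of charges are not the sums of the Jordan parts,
    so linearity in the charge is checked on indicators and extended to bounded
    functions. *)
Lemma charge_integral_sum (n : nat) (k : 'I_n -> R) (nus : 'I_n -> {charge set T -> \bar R})
  (D : set T) f : measurable D -> bmeas f ->
  (charge_integral (\big[@charge_add _ _ _/charge_zero _ _]_(j < n)
      charge_scale (k j) (nus j)) D f =
   \sum_(j < n) (k j)%:E * charge_integral (nus j) D f)%E.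
Proof.
move=> mD bf; set nu := (X in charge_integral X).
have nuE A : (nu A = \sum_(j < n) (k j)%:E * nus j A)%E.
  rewrite /nu; elim: (index_enum _) => [|j s IH]; first by rewrite !big_nil.
  by rewrite !big_cons -IH.
have mid := @measurable_id _ T setT.
pose L g := cint nu D id g - \sum_(j < n) k j * cint (nus j) D id g.
have hL : bclin L.
  split=> [c g1 g2 b1 b2|F g K bF bg FK Fg].
    rewrite /L (cint_bclin _ mD mid).1// (eq_bigr (fun j => c * (k j * cint (nus j) D id g1) +
      k j * cint (nus j) D id g2)); last first.
      by move=> j _; rewrite (cint_bclin _ mD mid).1//; ring.
    by rewrite big_split/= -mulr_sumr; ring.
  apply: cvgB; first exact: (cint_bclin _ mD mid).2 bF bg FK Fg.
  apply: (@cvg_big _ _ +%R) => [|j _]; first exact: add_continuous.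
  apply: cvgMl_tmp; exact: (cint_bclin _ mD mid).2 bF bg FK Fg.
have L0 : L f = 0.
  apply: (bclin_eq0 hL) => // A mA; have mAD := measurableI _ _ mA mD.
  rewrite /L cint_indic// nuE.
  apply/eqP; rewrite subr_eq0 -(@eqe R) fineK; last first.
    by apply/sum_fin_numP => j _ _; rewrite fin_numM// fin_num_measure.
  rewrite -sumEFin; apply/eqP; apply: eq_bigr => j _.
  by rewrite EFinM cint_indic// fineK// fin_num_measure.
rewrite -[f]/(f \o id) -cintE//.
have -> : cint nu D id f = \sum_(j < n) k j * cint (nus j) D id f.
  by apply/eqP; rewrite -subr_eq0; exact/eqP.
by rewrite -sumEFin; apply: eq_bigr => j _; rewrite EFinM cintE.
Qed.

End charge_functional.

(** * Primitives of compactly supported functions *)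

Section primitives.
Context {R : realType}.
Local Notation lebR := (@lebesgue_measure R).
Variables (al be : R).

Definition C0_supp_in (w : R -> R) :=
  [/\ continuous w, exists K, forall t, `|w t| <= K &
   exists al' be', [/\ al < al', be' < be & forall t, ~~ (al' <= t <= be') -> w t = 0]].

Lemma C0_supp_out w t : C0_supp_in w -> w t * \1_`[al, be] t = w t.
Proof.
move=> [_ _ [al' [be' [h1 h2 h3]]]]; have [tab|tab] := boolP (t \in `[al, be]%classic).
  by rewrite indicE tab mulr1.
rewrite h3 ?mul0r//; apply: contra tab; rewrite inE/= in_itv/= => /andP[h4 h5].
by rewrite (le_trans (ltW h1) h4) (le_trans h5 (ltW h2)).
Qed.

Lemma C0_supp_bmeas w : C0_supp_in w -> bmeas (w : measurableTypeR R -> R).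
Proof. by move=> [cw bw _]; split => //; exact: continuous_measurable_fun. Qed.

Lemma C0_supp_integrable w : C0_supp_in w -> lebR.-integrable setT (EFin \o w).
Proof.
move=> hw; have := @integrable_bmeas R _ (measurableTypeR R) _ (measurableTypeR R) lebR
  setT measurableT id (@measurable_id _ _ _) (fun t => 1 * \1_`[al, be] t).
move=> /(_ (integrable_box_indic al be 1) w (C0_supp_bmeas hw)); congr integrable.
by apply/funext => t /=; rewrite mul1r C0_supp_out.
Qed.

Lemma C0_supp_comb w1 w2 k : C0_supp_in w1 -> C0_supp_in w2 ->
  C0_supp_in (fun t => w1 t - k * w2 t).
Proof.
move=> [c1 [K1 b1] [al1 [be1 [h1 h1' h1'']]]] [c2 [K2 b2] [al2 [be2 [h2 h2' h2'']]]]; split.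
- move=> t; apply: cvgB; first exact: c1.
  by apply: cvgMl_tmp; exact: c2.
- exists (K1 + `|k| * K2) => t; rewrite (le_trans (ler_normB _ _))// lerD// normrM.
  by rewrite ler_wpM2l.
- exists (Num.min al1 al2), (Num.max be1 be2); split; rewrite ?lt_min ?gt_max ?h1 ?h1'//.
  move=> t; rewrite negb_and -!ltNge lt_min gt_max => h.
  rewrite h1'' ?h2'' ?mulr0 ?subr0//.
    by rewrite negb_and -!ltNge; case/orP: h => /andP[e1 e2]; rewrite ?e1 ?e2 ?orbT.
  by rewrite negb_and -!ltNge; case/orP: h => /andP[e1 e2]; rewrite ?e1 ?e2 ?orbT.
Qed.

Definition primitive (w : R -> R) (s : R) : R := \int[lebR]_(t in `]-oo, s]) w t.

(** To the right of the support of w the primitive is the total integral of w,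
    which vanishes. *)
Lemma primitive_C1 w : C0_supp_in w -> \int[lebR]_t w t = 0 ->
  C1_supp_in al be (primitive w) w.
Proof.
move=> hw w0; have iw := C0_supp_integrable hw.
have [cw [K wK] [al' [be' [h1 h2 h3]]]] := hw.
have iwS (A : set (measurableTypeR R)) : measurable A -> lebR.-integrable A (EFin \o w).
  by move=> mA; apply: (integrableS measurableT _ _ iw).
have H0 s : ~~ (al' <= s <= be') -> primitive w s = 0.
  rewrite negb_and -!ltNge => /orP[sal|sbe].
    transitivity (\int[lebR]_(t in `]-oo, s]) (0 : R)).
      apply: eq_Rintegral => t; rewrite inE/= in_itv/= => ts; apply: h3.
      by rewrite negb_and -!ltNge (le_lt_trans ts sal).
    by rewrite Rintegral_cst// mul0r.
  rewrite -w0 /primitive Rintegral_mkcond; apply: eq_Rintegral => t _.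
  rewrite patchE; case: ifPn => //; rewrite notin_setE/= in_itv/= => /negP.
  rewrite -ltNge => st; rewrite h3// negb_and -!ltNge (lt_trans sbe st) orbT//.
have Hb s : `|primitive w s| <= \int[lebR]_t `|w t|.
  have mI : measurable (`]-oo, s]%classic : set (measurableTypeR R)) by exact: measurable_itv.
  rewrite /primitive; apply: (le_trans (le_normr_Rintegral mI (iwS _ mI))).
  rewrite Rintegral_mkcond; apply: le_Rintegral => //.
  - rewrite -restrict_EFin -integrable_mkcond//.
    exact: (integrable_abse (iwS _ mI)).
  - exact: (integrable_abse iw).
  - by move=> t _; rewrite patchE; case: ifP => _; [exact: lexx|exact: normr_ge0].
split => //.
- move=> t; have tt1 : t < t + 1 by rewrite ltrDl.
  have FT := @continuous_FTC1 R w -oo%O t (t + 1) tt1 (iwS _ (measurable_itv _)).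
  have [|dP PE] := FT _ (cw t). by rewrite /= ltNyr.
  by apply: DeriveDef => //; rewrite -derive1E.
- exists (Num.max K (\int[lebR]_t `|w t|)) => t.
  by rewrite !le_max wK Hb orbT.
- by exists al', be'; split.
Qed.

Lemma norm_mul_le4 (u v : R) : 0 <= u <= 1 -> 0 <= v <= 1 -> `|2 * u * (2 * v)| <= 4.
Proof. by move=> /andP[? ?] /andP[? ?]; rewrite ger0_norm; nra. Qed.

Lemma norm_mul_le1 (r e k K : R) : 0 <= r <= 1 -> `|e| <= K -> `|r * (e * k)| <= K * `|k|.
Proof.
move=> /andP[r0 r1] eK; rewrite !normrM (ger0_norm r0).
rewrite (@le_trans _ _ (1 * (`|e| * `|k|)))//; first by rewrite ler_wpM2r// mulr_ge0.
by rewrite mul1r ler_wpM2r.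
Qed.

Lemma dramp_bound (t : R) : `|dramp t| <= 4.
Proof.
have p0 (s : R) : 0 <= s -> s <= 1 -> 0 <= pos s <= 1.
  move=> s0 s1; rewrite posE s0. by rewrite s0 s1.
rewrite /dramp; have [t0|t0] := leP t 0.
  rewrite [X in _ * (2 * X)](_ : _ = 0) ?mulr0 ?normr0//.
  by rewrite posE; case: ifP => // t0'; apply/eqP; rewrite eq_le t0.
have [t1|t1] := leP 1 t.
  rewrite [X in 2 * X * _](_ : _ = 0) ?mulr0 ?mul0r ?normr0//.
  rewrite posE; case: ifP => //; rewrite posE (ltW t0) subr_ge0 => t1'.
  by apply/eqP; rewrite subr_eq0 eq_le t1' andbT expr_ge1 ?(ltW t0).
have /andP[q0 q1] := p0 t (ltW t0) (ltW t1).
have r01 : 0 <= 1 - pos t ^+ 2 <= 1.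
  by apply/andP; split; [rewrite subr_ge0 expr_le1 ?q0 ?q1|rewrite gerBl sqr_ge0].
have /andP[s0 s1] : 0 <= pos (1 - pos t ^+ 2) <= 1 by case/andP: r01; exact: p0.
by apply: norm_mul_le4; rewrite ?q0 ?q1 ?s0 ?s1.
Qed.

Lemma bump_C1 n : C1_supp_in al be (bump al be n) (dbump al be n).
Proof.
split.
- by move=> t; exact: is_derive_bump.
- exact: continuous_dbump.
- exists (1 + (4 * `|- n.+1%:R| + 4 * `|n.+1%:R|)) => t; split.
    by rewrite ger0_norm ?bump_ge0// (le_trans (bump_le1 _ _ _ _))// lerDl addr_ge0// mulr_ge0.
  apply: (@le_trans _ _ (4 * `|- n.+1%:R| + 4 * `|n.+1%:R|)); last by rewrite lerDr.
  rewrite (le_trans (ler_normD _ _))// lerD//.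
    by apply: norm_mul_le1; rewrite ?ramp_ge0 ?ramp_le1 ?dramp_bound.
  by apply: norm_mul_le1; rewrite ?ramp_ge0 ?ramp_le1 ?dramp_bound.
- have n0 : 0 < n.+1%:R^-1 :> R by rewrite invr_gt0.
  exists (al + n.+1%:R^-1), (be - n.+1%:R^-1); split.
  + by rewrite ltrDl.
  + by rewrite gtrBl.
  + by move=> t; exact: bump_out.
Qed.

Lemma C1_C0 f df : C1_supp_in al be f df -> C0_supp_in f.
Proof.
move=> [h1 h2 [K h3] h4]; split => //; last by exists K => t; have [] := h3 t.
move=> t; apply/differentiable_continuous/derivable1_diffP.
exact: (@ex_derive _ _ _ _ _ _ _ (h1 t)).
Qed.

(** The integrals of the bumps tend to be - al, so one of them is positive and
    can be normalised. *)
Lemma unit_mass : al < be -> exists2 chi, C0_supp_in chi & \int[lebR]_t chi t = 1.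
Proof.
move=> albe; pose L (w : measurableTypeR R -> R) := \int[lebR]_t (w t * (1 * \1_`[al, be] t)).
have hL : bclin L.
  exact: (@bclin_integral R _ (measurableTypeR R) _ (measurableTypeR R) lebR
    setT measurableT id (@measurable_id _ _ _) (fun t => 1 * \1_`[al, be] t)
    (integrable_box_indic al be 1)).
have LE w : C0_supp_in w -> L w = \int[lebR]_t w t.
  by move=> hw; apply: eq_Rintegral => t _; rewrite mul1r C0_supp_out.
have bC n := C1_C0 (bump_C1 n).
have bi : bmeas (\1_`]al, be[ : measurableTypeR R -> R) by exact: bmeas_indic.
have Lc : L (bump al be n) @[n --> \oo] --> L (\1_`]al, be[).
  apply: (hL.2 _ _ 1) => //; first by move=> n; exact: C0_supp_bmeas.
  - by move=> n t; rewrite ger0_norm ?bump_ge0 ?bump_le1.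
  - by move=> t; exact: bump_cvg.
have L1 : L (\1_`]al, be[) = be - al.
  have -> : L (\1_`]al, be[) = fine (\int[lebR]_t (\1_`]al, be[ t)%:E).
    apply: eq_Rintegral => t _; rewrite mul1r !indicE.
    have [|] := boolP (t \in `]al, be[%classic); last by rewrite mul0r.
    rewrite inE/= in_itv/= => /andP[h1 h2].
    by rewrite mem_set ?mulr1//= in_itv/= !ltW.
  rewrite integral_indic// setIT.
  have : lebR `]al, be[%classic = (be - al)%:E; last by move=> e; rewrite -[RHS]/(fine (be - al)%:E) -e.
  by rewrite lebesgue_measure_itv/= lte_fin albe EFinB.
have [n Ln] : exists n, 0 < L (bump al be n).
  have : \forall n \near \oo, 0 < L (bump al be n).
    by apply: (cvgr_gt _ Lc); rewrite L1 subr_gt0.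
  by move=> [N _ h]; exists N; apply: h => /=.
(* A multiple of the bump, in the form of a difference covered by [C0_supp_comb]. *)
exists (fun t => bump al be n t - (1 - (L (bump al be n))^-1) * bump al be n t).
  exact: C0_supp_comb.
transitivity (\int[lebR]_t ((L (bump al be n))^-1 * bump al be n t)).
  by apply: eq_Rintegral => t _; ring.
rewrite RintegralZl//; last exact: C0_supp_integrable.
by rewrite -LE// mulVf// gt_eqF.
Qed.

End primitives.

(** * Integration by parts for functions of bounded variation *)

Section weak_identity.
Context {R : realType} {d : nat}.
Local Notation E := 'cV[R]_d.
Local Notation lam := (@lebesgue_cV R d).
Local Notation lebR := (@lebesgue_measure R).
Variables (a b : 'I_d -> R) (ab : forall i, a i < b i).
Variables (M : 'M[R]_d) (M_unit : M \in unitmx) (c : E).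
Local Notation T := (affine M c).
Local Notation Ti := (affine_inv M c).
Local Notation Omega := (T @` box a b).
Variables (f : E -> R) (fi : lam.-integrable Omega (EFin \o f)).
Hypothesis f_grad : exists Df, is_gradient_measure Omega f Df.

Lemma interior_measurable : measurable (Omega°).
Proof. apply: open_measurable_cV; exact: open_interior. Qed.

Let mO := interior_measurable.
Let mTi := @measurable_affine_inv R d M c.

Lemma integrable_interior : lam.-integrable Omega° (EFin \o f).
Proof.
have mOm : measurable Omega.
  rewrite affine_image// -[X in measurable X]setTI; apply: mTi => //.
  exact: measurable_box.
exact: (integrableS mOm mO (@interior_subset _ _) fi).
Qed.

Let A (psi : E -> R) : R := \int[lam]_(x in Omega°) (psi (Ti x) * f x).

Let A_bclin : bclin A.
Proof. exact: (bclin_integral mO mTi integrable_interior). Qed.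

Lemma gradient_measureP : is_gradient_measure Omega f (gradient_measure Omega f).
Proof.
rewrite /gradient_measure; case: pselect => // H; exact: (svalP (cid H)).
Qed.

Lemma bmeas_coord (w : R -> R) j : continuous w -> (exists K, forall t, `|w t| <= K) ->
  bmeas (fun y : E => w (y j ord0)).
Proof.
move=> cw [K wK]; split; last by exists K.
apply: (measurableT_comp (f := w)); first exact: continuous_measurable_fun.
exact: measurable_cV_coord.
Qed.

Definition dtensor (th dth : 'I_d -> R -> R) i (y : E) : R :=
  dth i (y i ord0) * \prod_(j | j != i) th j (y j ord0).

Section test.
Variables (th dth : 'I_d -> R -> R).
Hypothesis C1th : forall j, C1_supp_in (a j) (b j) (th j) (dth j).

Let bth j : bmeas (fun y : E => th j (y j ord0)).
Proof. by have [h1 h2 _] := C1_C0 (C1th j); exact: bmeas_coord. Qed.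

Let bdth j : bmeas (fun y : E => dth j (y j ord0)).
Proof.
have [_ h2 [K h3] _] := C1th j; apply: bmeas_coord => //.
by exists K => t; have [] := h3 t.
Qed.

Lemma bmeas_tensor : bmeas (tensor th : E -> R).
Proof. by apply: (@bmeas_prod R _ E _ _ (fun j (y : E) => th j (y j ord0))). Qed.

Lemma bmeas_dtensor i : bmeas (dtensor th dth i).
Proof.
apply: bmeasM; first exact: bdth.
rewrite (_ : (fun y : E => _) = fun y => \prod_j (if j != i then th j (y j ord0) else 1)).
  apply: (@bmeas_prod R _ E _ _ (fun j (y : E) => if j != i then th j (y j ord0) else 1)) => j.
  by case: (j != i); [exact: bth|exact: bmeas_cst].
by apply/funext => y; rewrite big_mkcond.
Qed.

(** The definition of the gradient measure applied to the product of the th j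
    composed with the inverse of T, once M e_i is expanded in the standard
    basis. *)
Lemma test_identity i :
  A (dtensor th dth i) + cint (directional_measure Omega f (M *m basis_vec i)) Omega° Ti (tensor th) = 0.
Proof.
set v := M *m basis_vec i.
pose eta := tensor th \o Ti.
have hC : C1_compact_support Omega° eta by exact: tensor_C1_compact_support C1th.
have deta : forall x, differentiable eta x by case: hC.
have Dv j x : 'D_(M *m basis_vec j) eta x = dtensor th dth j (Ti x).
  exact: tensor_derive.
(* The partial derivatives of eta, as functions on the source of T. *)
pose G j (y : E) : R := \sum_l (invmx M *m basis_vec j : E) l ord0 * dtensor th dth l y.
have bG j : bmeas (G j).
  by apply: bmeas_sum => l; apply: bmeasM; [exact: bmeas_cst|exact: bmeas_dtensor].
have De j x : 'D_(basis_vec j) eta x = G j (Ti x).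
  rewrite deriveE// -[X in 'd eta x X](mulKVmx M_unit).
  rewrite {1}(cV_decomp (invmx M *m basis_vec j)) mulmx_sumr linear_sum.
  by apply: eq_bigr => l _; rewrite -scalemxAr linearZ /= -deriveE// Dv.
have AG j : (A (G j))%:E = (- charge_integral (gradient_measure Omega f j) Omega° eta)%E.
  have := gradient_measureP; rewrite /is_gradient_measure => /(_ j eta hC) <-; rewrite /A EFin_Rintegral//.
    by apply: eq_integral => x _; rewrite De mulrC.
  exact: (integrable_bmeas mO mTi integrable_interior).
have -> : dtensor th dth i = fun y => \sum_j v j ord0 * G j y.
  apply/funext => y; rewrite -(affineK M_unit c y) -Dv derive_decomp//.
  by apply: eq_bigr => j _; rewrite De.
rewrite (bclin_sum _ A_bclin)//; last by move=> j; apply: bmeasM => //; exact: bmeas_cst.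
apply/eqP; rewrite addrC addr_eq0 -(@eqe R) EFinN (cintE _ mO mTi); last exact: bmeas_tensor.
rewrite charge_integral_sum//; last first.
  by have [mt [K tK]] := bmeas_tensor; split; [exact: (measurableT_comp mt mTi)|exists K => x; exact: tK].
rewrite -sumEFin -sumeN.
  apply/eqP; apply: eq_bigr => j _.
  by rewrite bclinZ// EFinM AG muleN oppeK.
by move=> j k _ _; exact: fin_num_adde_defr.
Qed.

End test.

Lemma bclin_ext (L1 L2 : (E -> R) -> R) : bclin L1 ->
  (forall g, bmeas g -> L1 g = L2 g) -> bclin L2.
Proof.
move=> [l1 c1] e; split=> [k g h bg bh|F g K bF bg FK Fg].
  by rewrite -!e// ?l1//; apply: bmeasD => //; apply: bmeasM => //; exact: bmeas_cst.
rewrite -e// (_ : (fun n => L2 (F n)) = fun n => L1 (F n)); first exact: c1 Fg.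
by apply/funext => n; rewrite e.
Qed.

Lemma bclin_mul (L : (E -> R) -> R) (w : E -> R) : bclin L -> bmeas w ->
  bclin (fun g => L (fun y => w y * g y)).
Proof.
move=> [l1 c1] bw; have [_ [W wW]] := bw; split=> [k g h bg bh|F g K bF bg FK Fg].
  rewrite -l1; [|exact: bmeasM|exact: bmeasM].
  by congr L; apply/funext => y; ring.
apply: (c1 _ _ (W * K)).
- by move=> n; exact: bmeasM.
- exact: bmeasM.
- by move=> n y; rewrite normrM ler_pM.
- by move=> y; apply: cvgMl_tmp; exact: Fg.
Qed.

Lemma bclin_sub_kop (L : (E -> R) -> R) i kap : kern kap -> bclin L ->
  bclin (fun g => L (fun y => g y - kop i kap g y)).
Proof.
move=> hk hL; apply: (bclin_ext (bclin_comb (-1) hL (bclin_kop i hk hL))) => g bg.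
by rewrite mulN1r (bclinB hL)//; exact: bmeas_kop.
Qed.

(** A generating pi-system whose members meet the open box in products of open
    intervals, the sets whose indicators are limits of products of bumps. *)
Definition rays : set (set E) := [set B | exists2 A : 'I_d -> set R,
  (forall j, A j = setT \/ exists al, A j = `]al, +oo[%classic) & B = mbox A].

Lemma rays_setI : setI_closed rays.
Proof.
move=> _ _ [A1 h1 ->] [A2 h2 ->]; exists (fun j => A1 j `&` A2 j).
  move=> j; have [->|[al ->]] := h1 j; first by rewrite setTI.
  have [->|[be ->]] := h2 j; first by rewrite setIT; right; exists al.
  right; exists (Num.max al be); apply/seteqP; split => t /=.
    by rewrite !in_itv/= !andbT gt_max => -[-> ->].
  by rewrite !in_itv/= !andbT gt_max => /andP[].
apply/seteqP; split => x /= => [[xA xB] i|xAB].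
  by split; [exact: xA|exact: xB].
by split => i; have [] := xAB i.
Qed.

Lemma measurable_rays : @measurable _ E = <<s rays >>.
Proof.
apply/seteqP; split; last first.
  apply: smallest_sub; first exact: sigma_algebra_measurable.
  move=> _ [A1 h ->]; apply: measurable_mbox => j.
  by have [->|[al ->]] := h j.
rewrite measurable_mboxes; apply: smallest_sub; first exact: smallest_sigma_algebra.
move=> _ [A1 mA1 ->].
have mco (j : 'I_d) : measurable_fun (setT : set (g_sigma_algebraType rays))
    (fun x : E => x j ord0).
  apply: (measurability _ (RGenOInfty.measurableE R)).
  move=> _ [_ [al ->] <-]; rewrite setTI; apply: sub_sigma_algebra.
  exists (fun k => if k == j then `]al, +oo[%classic else setT).
    by move=> k; case: ifP => _; [right; exists al|left].
  apply/seteqP; split => x /=; first by move=> xj k; case: eqP => // ->.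
  by move=> /(_ j); rewrite eqxx.
have -> : mbox A1 = \bigcap_(j in [set: 'I_d]) ((fun x : E => x j ord0) @^-1` A1 j).
  by rewrite /mbox; apply/seteqP; split => x /= Ax j; [move=> _|]; apply: Ax.
apply: (@fin_bigcap_measurable _ (g_sigma_algebraType rays)); first exact: finite_finset.
move=> j _; rewrite -[X in measurable X]setTI; apply: mco => //; exact: mA1.
Qed.

Section coordinate.
Variable i : 'I_d.
Let nu := directional_measure Omega f (M *m basis_vec i).
Let B := cint nu Omega° Ti.

Let B_bclin : bclin B.
Proof. exact: cint_bclin. Qed.

Section with_chi.
Variables (chi : R -> R) (chi_supp : C0_supp_in (a i) (b i) chi)
  (chi1 : \int[lebR]_t chi t = 1).

Definition ker_chi (s t : R) : R := chi s * \1_`[a i, b i] t.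

Lemma kern_chi : kern ker_chi.
Proof.
have [cc [K cK] _] := chi_supp; split; last first.
  by exists (a i), (b i), K => s t; rewrite normrM (ger0_norm (_ : 0 <= \1_`[a i, b i] t))// ler_wpM2r.
apply: measurable_funM; last exact: (kern_int a b i).1.
apply: (measurableT_comp (f := chi : measurableTypeR R -> R)) => //.
exact: continuous_measurable_fun.
Qed.

(** Removes the integral in direction i. Unlike the mean, the multiple of chi
    that is subtracted has compact support in the open interval, so products of
    bumps stay test functions. *)
Definition demean (q : E -> R) (y : E) : R := q y - kop i ker_chi q y.

(** The defect in the integration by parts formula, made into a functional
    defined for all psi by cutting psi off to the open box and removing its
    integrals in direction i. *)
Let L (psi : E -> R) : R :=
  A (demean (fun y => \1_(obox a b) y * psi y)) +
  1 * B (line_prim a b i (demean (fun y => \1_(obox a b) y * psi y))).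

Let L_bclin : bclin L.
Proof.
have bo : bmeas (\1_(obox a b) : E -> R) by apply: bmeas_indic; exact: measurable_obox.
apply: bclin_comb.
  exact: (bclin_mul (bclin_sub_kop i kern_chi A_bclin) bo).
exact: (bclin_mul (bclin_sub_kop i kern_chi (bclin_kop i (kern_prim a b i) B_bclin)) bo).
Qed.

Let kop_factor kap (w : R -> R) (p : E -> R) (y : E) :
  (forall z t, p (set_coord z i t) = p z) ->
  lebR.-integrable setT (EFin \o (fun t => w t * kap (y i ord0) t)) ->
  kop i kap (fun z => w (z i ord0) * p z) y = p y * \int[lebR]_t (w t * kap (y i ord0) t).
Proof.
move=> pc iw; rewrite /kop -RintegralZl//; apply: eq_Rintegral => t _.
by rewrite pc set_coordE eqxx; ring.
Qed.

Let C1_weaken (al al' be : R) (g dg : R -> R) : al' <= al ->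
  C1_supp_in al be g dg -> C1_supp_in al' be g dg.
Proof.
move=> h [h1 h2 h3 [u [v [h4 h5 h6]]]]; split => //; exists u, v; split => //.
exact: le_lt_trans h4.
Qed.

(** Removing the integral in direction i changes only the i-th factor, into a
    function of integral zero whose primitive is again C^1 with compact support;
    [test_identity] then applies. *)
Let L_bumps (al : 'I_d -> R) n : (forall j, a j <= al j) ->
  L (tensor (fun j => bump (al j) (b j) n)) = 0.
Proof.
move=> aal; pose th j := bump (al j) (b j) n.
have C1th j : C1_supp_in (a j) (b j) (th j) (dbump (al j) (b j) n).
  exact: (C1_weaken (aal j) (bump_C1 (al j) (b j) n)).
pose p (y : E) := \prod_(j | j != i) th j (y j ord0).
have pc z t : p (set_coord z i t) = p z.
  by apply: eq_bigr => j ji; rewrite set_coordE (negbTE ji).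
have tE y : tensor th y = th i (y i ord0) * p y by rewrite /tensor (bigD1 i).
have qE : (fun y => \1_(obox a b) y * tensor th y) = (fun y => th i (y i ord0) * p y).
  apply/funext => y; rewrite -tE indicE.
  have [|yo] := boolP (y \in obox a b); first by rewrite mul1r.
  rewrite mul0r; move: yo; rewrite notin_setE => /existsNP[j nj].
  rewrite /tensor (bigD1 j)//= /th bump_out ?mul0r//.
  apply/negP => /andP[h1 h2]; apply: nj; rewrite /= in_itv/=.
  have n0 : 0 < n.+1%:R^-1 :> R by rewrite invr_gt0.
  by rewrite (lt_le_trans _ h1) ?(le_lt_trans (aal j)) ?ltrDl// (le_lt_trans h2)// gtrBl.
have C0i := C1_C0 (C1th i).
pose I0 := \int[lebR]_t th i t.
pose W t := th i t - I0 * chi t.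
have CW : C0_supp_in (a i) (b i) W by exact: C0_supp_comb.
have W0 : \int[lebR]_t W t = 0.
  rewrite /W RintegralB//; last 2 first.
  - exact: C0_supp_integrable C0i.
  - under [X in _.-integrable _ X]eq_fun do rewrite /= EFinM; apply: integrableZl => //.
    exact: C0_supp_integrable chi_supp.
  by rewrite RintegralZl ?chi1 ?mulr1 ?subrr//; exact: C0_supp_integrable chi_supp.
have dE : demean (fun y => \1_(obox a b) y * tensor th y) = fun y => W (y i ord0) * p y.
  rewrite qE; apply/funext => y; rewrite /demean kop_factor//.
    rewrite (_ : \int[lebR]_t (th i t * ker_chi (y i ord0) t) = chi (y i ord0) * I0).
      by rewrite /W; ring.
    rewrite -RintegralZl//; last exact: C0_supp_integrable C0i.
    by apply: eq_Rintegral => t _; rewrite /ker_chi -[in RHS](C0_supp_out t C0i); ring.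
  apply: (@eq_integrable _ _ _ lebR setT measurableT (fun t => (chi (y i ord0) * th i t)%:E)).
    by move=> t _; rewrite /= /ker_chi -[in LHS](C0_supp_out t C0i); congr EFin; ring.
  by under eq_fun do rewrite EFinM; apply: integrableZl => //; exact: C0_supp_integrable C0i.
have pE : line_prim a b i (fun y => W (y i ord0) * p y) = fun y => primitive W (y i ord0) * p y.
  apply/funext => y; rewrite /line_prim kop_factor//.
    rewrite mulrC; congr (_ * _); rewrite /primitive [RHS]Rintegral_mkcond.
    apply: eq_Rintegral => t _; rewrite /ker_prim mulrA (C0_supp_out t CW) patchE.
    have [ty|ty] := boolP (t <= y i ord0).
      by rewrite mulr1 mem_set//= in_itv.
    by rewrite mulr0 memNset//= in_itv/=; exact/negP.
  have := kop_integrable i y (kern_prim a b i) (bmeas_coord i _ _ : bmeas (fun z : E => W (z i ord0))).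
  by have [cW bW _] := CW; move=> /(_ cW bW); under eq_fun do rewrite set_coordE eqxx.
rewrite /L dE pE mul1r.
(* The product with the i-th factor replaced by the primitive W is the test function. *)
pose th' j := if j == i then primitive W else th j.
pose dth' j := if j == i then W else dbump (al j) (b j) n.
have C1' j : C1_supp_in (a j) (b j) (th' j) (dth' j).
  by rewrite /th' /dth'; case: eqP => [->|_]; [exact: primitive_C1|exact: C1th].
rewrite -[RHS](test_identity C1' i); congr (A _ + B _).
  apply/funext => y; rewrite /dtensor /dth' eqxx; congr (_ * _).
  by apply: eq_bigr => j ji; rewrite /th' (negbTE ji).
apply/funext => y; rewrite /tensor (bigD1 i)//= {1}/th' eqxx; congr (_ * _).
by apply: eq_bigr => j ji; rewrite /th' (negbTE ji).
Qed.

Let L_rays (al : 'I_d -> R) : (forall j, a j <= al j) ->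
  L (\1_(mbox (fun j => `]al j, b j[%classic))) = 0.
Proof.
move=> aal.
have bt n : bmeas (tensor (fun j => bump (al j) (b j) n) : E -> R).
  by apply: bmeas_tensor => j; exact: (C1_weaken (aal j) (bump_C1 _ _ _)).
have mm : measurable (mbox (fun j => `]al j, b j[%classic) : set E) by exact: measurable_mbox.
have cL : L (tensor (fun j => bump (al j) (b j) n)) @[n --> \oo] -->
    L (\1_(mbox (fun j => `]al j, b j[%classic))).
  apply: (L_bclin.2 _ _ 1) => //.
  - exact: bmeas_indic.
  - move=> n y; rewrite ger0_norm; first by apply: prodr_ile1 => j _; rewrite bump_ge0 bump_le1.
    by apply: prodr_ge0 => j _; exact: bump_ge0.
  - move=> y; have -> : \1_(mbox (fun j => `]al j, b j[%classic)) y =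
        \prod_j (\1_`]al j, b j[ (y j ord0) : R).
      rewrite indicE; have [|] := boolP (y \in _).
        rewrite inE => yA; rewrite big1// => j _; rewrite indicE mem_set//; exact: yA.
      rewrite notin_setE => /existsNP[j nj]; rewrite (bigD1 j)//= indicE memNset//.
      by rewrite mul0r.
    apply: (@cvg_big R 'I_d *%R 1 xpredT (@mul_continuous R) nat \oo (index_enum 'I_d)
      (fun j n => bump (al j) (b j) n (y j ord0))) => j _.
    exact: bump_cvg.
rewrite (_ : (fun n => _) = fun=> 0) in cL; last by apply/funext => n; exact: L_bumps.
by apply/esym; apply: (cvg_unique _ (cvg_cst (0 : R)) cL).
Qed.

Let L_eq0 psi : bmeas psi -> L psi = 0.
Proof.
have gen (D : 'I_d -> set R) :
    (forall j, D j = setT \/ exists al, D j = `]al, +oo[%classic) -> L (\1_(mbox D)) = 0.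
  move=> hD; have {hD} : forall j, exists al, a j <= al /\
      forall t, D j t /\ a j < t < b j <-> al < t < b j.
    move=> j; have [->|[al ->]] := hD j.
      by exists (a j); split => // t; split => [[]//|].
    exists (Num.max (a j) al); rewrite le_max lexx; split => // t /=.
    rewrite in_itv/= andbT gt_max; split => [[-> /andP[-> ->]]//|].
    by move=> /andP[/andP[-> ->] ->].
  move=> /choice[al hal].
  rewrite -(@L_rays al) => [|j]; last by have [] := hal j.
  rewrite /L; suff -> : (fun y => \1_(obox a b) y * \1_(mbox D) y) =
    (fun y : E => \1_(obox a b) y * \1_(mbox (fun j => `]al j, b j[%classic)) y :> R) by [].
  apply/funext => y; rewrite !indicE -!natrM !mulnb; congr (nat_of_bool _)%:R.
  apply/idP/idP => /andP[]; rewrite !inE => yo h; apply/andP; rewrite !inE; split => // j.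
    have [_ /(_ (y j ord0)) e] := hal j; rewrite /= in_itv/=; apply: (e.1).
    by split; [exact: h|have := yo j; rewrite /= in_itv].
  have [_ /(_ (y j ord0)) e] := hal j; apply: (e.2 _).1.
  by have := h j; rewrite /= in_itv.
apply: (bclin_pi_eq0 L_bclin measurable_rays rays_setI).
- rewrite (_ : setT = mbox (fun=> setT)); last by apply/seteqP; split.
  by apply: gen => j; left.
- by move=> _ [D hD ->]; exact: gen.
Qed.

(** Functions of mean zero that vanish off the open box are not changed by the
    modifications in the definition of the defect, which vanishes identically. *)
Lemma weak_identity_chi psi : bmeas psi -> (forall y, ~ obox a b y -> psi y = 0) ->
  line_int a b i psi = (fun=> 0) -> A psi = - B (line_prim a b i psi).
Proof.
move=> bp po p0; have := L_eq0 bp; rewrite /L.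
have -> : (fun y => \1_(obox a b) y * psi y) = psi.
  apply/funext => y; rewrite indicE; have [|] := boolP (y \in obox a b); first by rewrite mul1r.
  by rewrite notin_setE => /po ->; rewrite mulr0.
have -> : demean psi = psi.
  apply/funext => y; rewrite /demean (_ : kop i ker_chi psi y = chi (y i ord0) * line_int a b i psi y).
    by rewrite p0 mulr0 subr0.
  rewrite /line_int /kop -RintegralZl//; last exact: kop_integrable (kern_int a b i) bp.
  by apply: eq_Rintegral => t _; rewrite /ker_chi /ker_int; ring.
by rewrite mul1r => /eqP; rewrite addr_eq0 => /eqP.
Qed.

End with_chi.

Lemma weak_bound psi (K : R) : bmeas psi -> (forall y, ~ obox a b y -> psi y = 0) ->
  line_int a b i psi = (fun=> 0) ->
  (forall y, line_int a b i (fun x => `|psi x|) y <= K) ->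
  ((`|\int[lam]_(x in Omega°) (psi (Ti x) * f x)|)%:E <=
    (2^-1 * K)%:E * directional_variation Omega f (M *m basis_vec i))%E.
Proof.
move=> bp po p0 pK.
have [chi chi_supp chi1] := unit_mass (ab i).
have /= e := weak_identity_chi chi_supp chi1 bp po p0.
rewrite -/(A psi) e normrN; apply: le_cint => //.
  exact: bmeas_kop (kern_prim a b i) bp.
move=> x _; apply: (le_trans (line_prim_le_half bp _)); first by rewrite p0.
by rewrite ler_wpM2l.
Qed.

End coordinate.

End weak_identity.

(** * Integration by parts on a segment *)

Section by_parts.
Context {R : realType}.
Local Notation lebR := (@lebesgue_measure R).

Lemma within_itv_integrable (u v : R) (G : R -> R) :
  {within `[u, v], continuous G} -> lebR.-integrable `[u, v] (EFin \o G).
Proof. by move=> cG; apply: continuous_compact_integrable => //; exact: segment_compact. Qed.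

(** Fubini's theorem on the set of all t <= u. *)
Lemma triangle_fubini (p q : R -> R) :
  lebR.-integrable setT (EFin \o p) -> lebR.-integrable setT (EFin \o q) ->
  \int[lebR]_t (p t * \int[lebR]_u (q u * (t <= u)%R%:R)) =
  \int[lebR]_u (q u * \int[lebR]_t (p t * (t <= u)%R%:R)).
Proof.
move=> ip iq.
pose F (tu : measurableTypeR R * measurableTypeR R) : R :=
  p tu.1 * q tu.2 * (tu.1 <= tu.2)%R%:R.
have mp : measurable_fun setT (p : measurableTypeR R -> R).
  exact/measurable_EFinP/measurable_int/ip.
have mq : measurable_fun setT (q : measurableTypeR R -> R).
  exact/measurable_EFinP/measurable_int/iq.
have mle : measurable_fun setT (fun tu : measurableTypeR R * measurableTypeR R =>
    ((tu.1 <= tu.2)%R%:R : R)).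
  have ms : measurable_fun setT (fun tu : measurableTypeR R * measurableTypeR R => (tu.2, tu.1)).
    exact: measurable_swap.
  exact: (measurableT_comp measurable_le_indic ms).
have mF : measurable_fun setT (EFin \o F).
  apply/measurable_EFinP; apply: measurable_funM => //; apply: measurable_funM.
    exact: (measurableT_comp mp (@measurable_fst _ _ _ _)).
  exact: (measurableT_comp mq (@measurable_snd _ _ _ _)).
have step (g : R -> R) (e : R -> bool) : lebR.-integrable setT (EFin \o g) ->
    measurable_fun setT (fun t : measurableTypeR R => ((e t)%:R : R)) ->
    lebR.-integrable setT (fun t => (g t * (e t)%:R)%:E).
  move=> ig me; apply: (le_integrable _ _ _ ig) => //.
    apply/measurable_EFinP; apply: measurable_funM => //.
    exact/measurable_EFinP/measurable_int/ig.
  move=> t _ /=; rewrite lee_fin normrM ler_piMr//.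
  by case: (e t); rewrite ?normr1 ?normr0.
have iF : (lebR \x lebR)%E.-integrable setT (EFin \o F).
  apply/integrable12ltyP => //.
  have mabs g : measurable_fun setT (g : measurableTypeR R -> R) ->
      measurable_fun setT (fun t : measurableTypeR R => `|g t|%:E).
    by move=> mg; apply/measurable_EFinP; exact: measurableT_comp.
  set Q := (\int[lebR]_u `|q u|%:E)%E.
  have Q0 : (0 <= Q)%E by exact: integral_ge0.
  have Qfin : (Q < +oo)%E by have /integrableP[] := iq.
  apply: (@le_lt_trans _ _ (\int[lebR]_t (`|p t|%:E * Q)))%E.
    apply: ge0_le_integral => //.
    - by move=> t _; apply: integral_ge0.
    - apply: (@measurable_fun_fubini_tonelli_F _ _ _ _ _ lebR (fun x => `|(EFin \o F) x|)%E) => //.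
      exact: measurableT_comp.
    - by apply: emeasurable_funM => //; exact: mabs.
    - move=> t _; rewrite -ge0_integralZl//; last exact: mabs.
      apply: ge0_le_integral => //.
      + apply/measurable_EFinP; apply: measurableT_comp => //.
        have := measurable_fun_pair2 t ((measurable_EFinP _ _).1 mF : measurable_fun setT F).
        exact.
      + by apply/measurable_EFinP; apply: measurable_funM => //; exact: measurableT_comp.
      + move=> u _; rewrite -EFinM lee_fin /F/= !normrM ler_piMr//.
        by case: (t <= u); rewrite ?normr1 ?normr0.
  rewrite ge0_integralZr//; last exact: mabs.
  rewrite lte_mul_pinfty//; first by apply: integral_ge0.
  rewrite ge0_fin_numE ?integral_ge0//.
  by have /integrableP[] := ip.
have mt1 t : measurable_fun setT (fun u : measurableTypeR R => ((t <= u)%R%:R : R)).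
  have := measurable_fun_pair2 t mle; exact.
have mt2 u : measurable_fun setT (fun t : measurableTypeR R => ((t <= u)%R%:R : R)).
  have := measurable_fun_pair1 u mle; exact.
rewrite /Rintegral; congr fine.
transitivity (\int[lebR]_t \int[lebR]_u (EFin \o F) (t, u))%E.
  apply: eq_integral => t _; rewrite -/(Rintegral _ _ _) EFinM EFin_Rintegral//; last first.
    exact: step.
  rewrite -integralZl//; last exact: step.
  by apply: eq_integral => u _; rewrite /F/= -EFinM mulrA.
rewrite Fubini//.
apply: eq_integral => u _; rewrite -/(Rintegral _ _ _) EFinM EFin_Rintegral//; last first.
  exact: step.
rewrite -integralZl//; last exact: step.
by apply: eq_integral => t _; rewrite /F/= -EFinM; congr EFin; ring.
Qed.

Lemma FTC_right (u v : R) (G H : R -> R) : u < v ->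
  {within `[u, v], continuous G} -> {within `[u, v], continuous H} ->
  (forall t, u < t < v -> is_derive t (1 : R) G (H t)) ->
  forall t, u <= t <= v -> \int[lebR]_(x in `[t, v]) H x = G v - G t.
Proof.
move=> uv cG cH dG t /andP[ut]; rewrite le_eqVlt => /predU1P[->|tv].
  rewrite subrr set_itv1 Rintegral_set1//.
have sub : `[t, v]%classic `<=` `[u, v]%classic.
  by move=> x /=; rewrite !in_itv/= => /andP[tx ->]; rewrite (le_trans ut tx).
rewrite /Rintegral (@continuous_FTC2 _ H G t v tv) -?EFinB//.
- exact: continuous_subspaceW cH.
- have /(continuous_within_itvP _ tv)[c1 c2 c3] := continuous_subspaceW sub cG.
  split => // x; rewrite in_itv/= => /andP[tx xv].
  by have [] := dG x; rewrite ?xv ?(le_lt_trans ut tx).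
- move=> x; rewrite in_itv/= => /andP[tx xv]; rewrite derive1E.
  by have [|_ <-] := dG x; rewrite ?xv ?(le_lt_trans ut tx).
Qed.

(** The function p is only integrable, so its primitive need not be
    differentiable. As p has integral zero one may replace G by G - G(v), write
    this as minus an integral of H and exchange the order of integration. *)
Lemma by_parts_primitive (u v : R) (G H p : R -> R) : u < v ->
  {within `[u, v], continuous G} -> {within `[u, v], continuous H} ->
  (forall t, u < t < v -> is_derive t (1 : R) G (H t)) ->
  lebR.-integrable setT (fun t => (p t * \1_`[u, v] t)%:E) ->
  lebR.-integrable setT (fun t => (p t * \1_`[u, v] t * G t)%:E) ->
  \int[lebR]_t (p t * \1_`[u, v] t) = 0 ->
  \int[lebR]_t (p t * \1_`[u, v] t * G t) =
  - \int[lebR]_s (H s * \1_`[u, v] s * \int[lebR]_t (p t * (\1_`[u, v] t * (t <= s)%R%:R))).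
Proof.
move=> uv cG cH dG ip ipG p0.
have iH : lebR.-integrable setT (fun t => (H t * \1_`[u, v] t)%:E).
  have := within_itv_integrable cH; rewrite integrable_mkcond//.
  congr (_.-integrable _ _); apply/funext => t; rewrite patchE indicE.
  by case: (_ \in _); rewrite ?mulr1 ?mulr0.
have := triangle_fubini ip iH.
under [X in _ = X -> _]eq_Rintegral => s _.
  under [X in _ * X]eq_Rintegral do rewrite -mulrA.
  over.
move=> <-.
(* Inserting G v is free because p has integral zero. *)
transitivity (- \int[lebR]_t (p t * \1_`[u, v] t * G v - p t * \1_`[u, v] t * G t)).
  have iv : lebR.-integrable setT (fun t => (p t * \1_`[u, v] t * G v)%:E).
    by under eq_fun do rewrite EFinM; exact: integrableZr.
  rewrite RintegralB//.
  by rewrite RintegralZr// p0 mul0r sub0r opprK.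
congr (- _); apply: eq_Rintegral => t _; rewrite -mulrBr indicE.
have [|_] := boolP (t \in _); last by rewrite !mulr0 !mul0r.
rewrite inE/= in_itv/= => tuv; congr (_ * _); rewrite -(FTC_right uv cG cH dG tuv).
rewrite [LHS]Rintegral_mkcond; apply: eq_Rintegral => x _; rewrite patchE indicE -mulrA -natrM mulnb.
rewrite [in RHS](_ : _ && _ = (x \in `[t, v]%classic)); first by case: (_ \in _); rewrite ?mulr1 ?mulr0.
move/andP: tuv => [ut tv]; apply/idP/idP; rewrite !inE/= !in_itv/=.
  by move=> /andP[]; rewrite inE/= in_itv/= => /andP[_ ->] ->.
move=> /andP[tx xv]; rewrite tx andbT inE/= in_itv/= xv (le_trans ut tx)//.
Qed.

End by_parts.

(** * Functions smooth up to the boundary *)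

Section within_topology.

Lemma within_comp (T U V : topologicalType) (A : set T) (B : set U) (h : T -> U) (g : U -> V) :
  continuous h -> (forall x, A x -> B (h x)) -> {within B, continuous g} ->
  {within A, continuous (fun x => g (h x))}.
Proof.
move=> ch AB /subspace_continuousP cg; apply/subspace_continuousP => x Ax W gW.
have /= := cg _ (AB _ Ax) _ gW; rewrite /within/= => hW.
have := ch x _ hW; rewrite /within /= nbhs_simpl/=.
by apply: filterS => y /= yW Ay; exact/yW/AB.
Qed.

Lemma within_interior_continuous (T V : topologicalType) (A : set T) (g : T -> V) x :
  {within A, continuous g} -> A° x -> {for x, continuous g}.
Proof.
move=> /subspace_continuousP cg Ax W gW.
have /= := cg _ (interior_subset Ax) _ gW; rewrite /within/=.
by apply: filterS2 Ax => y yA /(_ yA).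
Qed.

End within_topology.

Section Ck_chain.
Context {R : realType} {d : nat}.
Local Notation E := 'cV[R]_d.
Variable Omega : set E.
Implicit Types (f g : E -> R) (v : E).

Lemma Ck_closure_cst k c : Ck_closure k Omega (fun=> c).
Proof.
elim: k c => [|k IH] c /=; (split; first by apply: continuous_subspaceT; exact: cst_continuous) => //.
split=> [x _|j]; first exact: differentiable_cst.
by exists (fun=> 0); [move=> x _; rewrite derive_cst|exact: IH].
Qed.

Lemma Ck_closure_comb k r f g : Ck_closure k Omega f -> Ck_closure k Omega g ->
  Ck_closure k Omega (fun x => r * f x + g x).
Proof.
have cc f1 f2 : {within Omega, continuous f1} -> {within Omega, continuous f2} ->
    {within Omega, continuous (fun x => r * f1 x + f2 x)}.
  move=> c1 c2 x.
  exact: (cvgD (cvgM (cvg_cst r) (c1 x)) (c2 x)).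
elim: k f g => [|k IH] f g /=; first by move=> [cf _] [cg _]; split => //; exact: cc.
move=> [cf [df Df]] [cg [dg Dg]]; split; first exact: cc.
have rf x : differentiable f x -> differentiable (fun x => r * f x) x.
  by move=> h; exact: (differentiableZ r h).
split=> [x Ox|j].
  by apply: (@differentiableD _ _ _ (fun x => r * f x) g); [apply: rf; exact: df|exact: dg].
have [f' f'E Cf'] := Df j; have [g' g'E Cg'] := Dg j.
exists (fun x => r * f' x + g' x); last exact: IH.
move=> x Ox; rewrite f'E// g'E//.
have hf := @diff_derivable _ _ _ f x (basis_vec j) (df x Ox).
have hg := @diff_derivable _ _ _ g x (basis_vec j) (dg x Ox).
have hZ : derivable (fun x => r * f x) x (basis_vec j).
  exact: (diff_derivable (rf x (df x Ox))).
rewrite [RHS](@deriveD _ _ _ (fun x => r * f x) g)//; congr (_ + _).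
by rewrite [RHS](@deriveZ _ _ _ f r).
Qed.

Lemma Ck_closure_sum k (I : Type) (s : seq I) (r : I -> R) (F : I -> E -> R) :
  (forall i, Ck_closure k Omega (F i)) ->
  Ck_closure k Omega (fun x => \sum_(i <- s) r i * F i x).
Proof.
move=> CF; elim: s => [|i s IH].
  by under eq_fun do rewrite big_nil; exact: Ck_closure_cst.
by under eq_fun do rewrite big_cons; exact: Ck_closure_comb.
Qed.

(** A directional derivative is a combination of partial derivatives. *)
Lemma Ck_closure_derive k f v : Ck_closure k.+1 Omega f ->
  exists2 g, (forall x, Omega° x -> g x = 'D_v f x) & Ck_closure k Omega g.
Proof.
move=> /= [_ [df Df]].
have /choice[g gP] : forall j, exists g, (forall x, Omega° x -> g x = 'D_(basis_vec j) f x) /\ Ck_closure k Omega g.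
  by move=> j; have [g h1 h2] := Df j; exists g.
exists (fun x => \sum_j v j ord0 * g j x).
  by move=> x Ox; rewrite derive_decomp; [apply: eq_bigr => j _; rewrite (gP j).1|exact: df].
by apply: Ck_closure_sum => j; exact: (gP j).2.
Qed.

Lemma Ck_closure_continuous k f : Ck_closure k Omega f -> {within Omega, continuous f}.
Proof. by case: k => [|k] []. Qed.

End Ck_chain.

Section step.
Context {R : realType} {d : nat}.
Local Notation E := 'cV[R]_d.
Local Notation lam := (@lebesgue_cV R d).
Local Notation lebR := (@lebesgue_measure R).
Variables (a b : 'I_d -> R) (ab : forall i, a i < b i).
Variables (M : 'M[R]_d) (M_unit : M \in unitmx) (c : E).
Local Notation T := (affine M c).
Local Notation Omega := (T @` box a b).
Implicit Types (g h k psi q : E -> R) (y : E).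

Lemma obox_interior y : obox a b y -> Omega° (T y).
Proof.
by move=> yo; rewrite interior_affine_box//=; rewrite (affineK M_unit).
Qed.


Lemma integrable_on_box q : bmeas q -> lam.-integrable setT (fun y => (\1_(box a b) y * q y)%:E).
Proof.
move=> bq; have mB := @measurable_box R d a b.
have i1 : lam.-integrable setT (EFin \o (\1_(box a b) : E -> R)).
  apply/integrableP; split; first by apply/measurable_EFinP/measurable_indic.
  under eq_integral do rewrite gee0_abs ?lee_fin//.
  by rewrite integral_indic ?setIT//; exact: (box_lty a b).
have := @integrable_bmeas R _ E _ E lam setT measurableT id (@measurable_id _ _ _) _ i1 _ bq.
by under eq_fun do rewrite mulrC.
Qed.

(** The cut-off to the open box has no effect on integrals, and confines
    attention to the points where g is differentiable. *)
Definition pull (g : E -> R) (y : E) : R := \1_(obox a b) y * g (T y).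

Lemma within_box_pull g : {within Omega, continuous g} ->
  {within box a b, continuous (fun y => g (T y))}.
Proof.
move=> cg; apply: (within_comp (B := Omega) (h := T) _ _ cg); first exact: continuous_affine.
by move=> y yS; exists y.
Qed.

Lemma bmeas_pull g : {within Omega, continuous g} -> bmeas (pull g).
Proof.
move=> cg; split.
  have : measurable_fun (obox a b) (fun y => g (T y)).
    apply: within_continuous_measurable_cV => [|y yo].
      by apply: open_mbox => i; exact: interval_open.
    apply: (@continuous_comp _ _ _ T g); first exact: continuous_affine.
    exact: within_interior_continuous cg (obox_interior yo).
  move/(measurable_restrictT _ (measurable_obox a b)); apply: eq_measurable_fun => y _.
  by rewrite /pull indicE patchE; case: (_ \in _); rewrite ?mul1r ?mul0r.
have cS : compact (box a b).
  by rewrite box_mbox; apply: compact_mbox => i; exact: segment_compact.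
have /compact_bounded[K [_ KP]] := continuous_compact (within_box_pull cg) cS.
exists (`|K| + 1) => y; rewrite /pull indicE.
have [|_] := boolP (y \in _); last by rewrite mul0r normr0 addr_ge0.
rewrite inE mul1r => /obox_sub yS; apply: KP => /=; last by exists y.
by rewrite (le_lt_trans (ler_norm _))// ltrDl.
Qed.

Lemma integrable_pull psi g : bmeas psi -> {within Omega, continuous g} ->
  lam.-integrable setT (fun y => (psi y * pull g y)%:E).
Proof.
move=> bp cg; have := integrable_on_box (bmeasM bp (bmeas_pull cg)).
congr (_.-integrable _ _); apply/funext => y; congr EFin; rewrite /pull !indicE.
have [/set_mem yo|_] := boolP (y \in obox a b); last by rewrite !(mul0r, mulr0).
by rewrite (mem_set (obox_sub yo)) mul1r.
Qed.

Lemma Rintegral_oo_cc (u v : R) (F : R -> R) :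
  lebR.-integrable setT (fun t => (F t * \1_`[u, v] t)%:E) ->
  \int[lebR]_t (F t * \1_`]u, v[ t) = \int[lebR]_t (F t * \1_`[u, v] t).
Proof.
move=> iF.
have mk (A : set R) : \int[lebR]_t (F t * \1_A t) = \int[lebR]_(t in A) F t.
  rewrite [RHS]Rintegral_mkcond; apply: eq_Rintegral => t _; rewrite patchE indicE.
  by case: (_ \in _); rewrite ?mulr1 ?mulr0.
have iFcc : lebR.-integrable `[u, v] (EFin \o F).
  apply/integrable_mkcond => //; move: iF; congr (_.-integrable _ _); apply/funext => t.
  by rewrite patchE indicE; case: (_ \in _); rewrite ?mulr1 ?mulr0.
rewrite !mk Rintegral_itv_obnd_cbnd ?Rintegral_itv_bndo_bndc//.
  by apply: integrableS iFcc => // t /=; rewrite !in_itv/= => /andP[-> /ltW].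
by apply: integrableS iFcc => // t /=; rewrite !in_itv/= => /andP[/ltW -> /ltW].
Qed.

Lemma obox_set_coord y i t : (forall j, j != i -> y j ord0 \in `]a j, b j[) ->
  obox a b (set_coord y i t) <-> `]a i, b i[%classic t.
Proof.
move=> yo; split => [/(_ i)|ti j]; rewrite set_coordE ?eqxx//.
by case: eqP => [->//|/eqP /yo].
Qed.

(** On a line through the interior of the box this is [by_parts_primitive] for
    the restriction of g, which is continuous up to the end points. *)
Lemma slice_by_parts i psi g h y : bmeas psi -> line_int a b i psi = (fun=> 0) ->
  {within Omega, continuous g} -> {within Omega, continuous h} ->
  (forall x, Omega° x -> differentiable g x) ->
  (forall x, Omega° x -> h x = 'D_(M *m basis_vec i) g x) ->
  (forall j, j != i -> y j ord0 \in `]a j, b j[) ->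
  \int[lebR]_t (psi (set_coord y i t) * pull g (set_coord y i t)) =
  - \int[lebR]_t (line_prim a b i psi (set_coord y i t) * pull h (set_coord y i t)).
Proof.
move=> bp p0 cg ch dg hE yo.
pose p t := psi (set_coord y i t).
pose G t := g (T (set_coord y i t)); pose H t := h (T (set_coord y i t)).
have pullE k t : pull k (set_coord y i t) = \1_`]a i, b i[ t * k (T (set_coord y i t)).
  rewrite /pull !indicE; congr (_%:R * _); congr nat_of_bool.
  by apply/idP/idP; rewrite !inE => /obox_set_coord; apply.
have csl : continuous (fun t => set_coord y i t).
  apply: cV_continuous => j; under eq_fun do rewrite set_coordE.
  by case: eqP => _; [move=> t; exact: cvg_id|exact: cst_continuous].
have cc k : {within Omega, continuous k} ->
    {within `[a i, b i], continuous (fun t => k (T (set_coord y i t)))}.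
  move=> /within_box_pull; apply: within_comp csl _ => t /=; rewrite in_itv/= => ti j.
  rewrite set_coordE; case: eqP => [->//|/eqP /yo].
  by rewrite in_itv/= => /andP[/ltW -> /ltW ->].
have dG t : a i < t < b i -> is_derive t (1 : R) G (H t).
  move=> ti; have xo : obox a b (set_coord y i t).
    by apply/obox_set_coord => //=; rewrite in_itv.
  have x0 := obox_interior xo.
  (* The difference quotients of G at t are those of g in direction M e_i. *)
  have shiftE s : T (set_coord y i (s *: (1 : R) + t)) = s *: (M *m basis_vec i) + T (set_coord y i t).
    rewrite /affine scalemxAr addrA -mulmxDr; congr (M *m _ + _).
    apply/colP => j; rewrite !mxE eqxx andbT; case: eqP => _; rewrite ?mulr1 ?mulr0 ?add0r//.
    by rewrite /GRing.scale/= mulr1.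
  have dgx := @diff_derivable _ _ _ g _ (M *m basis_vec i) (dg _ x0).
  have quot : (fun s : R => s^-1 *: ((G \o shift t) (s *: (1 : R)) - G t)) =
      (fun s => s^-1 *: ((g \o shift (T (set_coord y i t))) (s *: (M *m basis_vec i)) -
        g (T (set_coord y i t)))).
    by apply/funext => s; rewrite /G /= shiftE.
  split; rewrite /derivable /derive quot; first exact: dgx.
  by rewrite /H hE.
have intg q k : bmeas q -> {within Omega, continuous k} ->
    lebR.-integrable setT (fun t => (q (set_coord y i t) * k (T (set_coord y i t)) * \1_`[a i, b i] t)%:E).
  move=> bq ck; have ik := within_itv_integrable (cc _ ck).
  have mi : measurable `[a i, b i]%classic by [].
  have := @integrable_bmeas R _ E _ (measurableTypeR R) lebR _ mi
    (fun t => set_coord y i t) (measurable_slice i y) _ ik _ bq.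
  rewrite integrable_mkcond//; congr (_.-integrable _ _); apply/funext => t.
  by rewrite patchE indicE; case: (_ \in _); rewrite ?mulr1 ?mulr0.
have bP : bmeas (line_prim a b i psi) by exact: bmeas_kop (kern_prim a b i) bp.
under eq_Rintegral do rewrite pullE mulrCA mulrC.
under [in RHS]eq_Rintegral do rewrite pullE mulrCA mulrC.
rewrite !Rintegral_oo_cc; [|exact: intg|exact: intg].
transitivity (\int[lebR]_t (p t * \1_`[a i, b i] t * G t)).
  by apply: eq_Rintegral => t _; rewrite /p /G; ring.
rewrite (by_parts_primitive (ab i) (cc _ cg) (cc _ ch) dG).
- congr (- _); apply: eq_Rintegral => t _; rewrite /line_prim kop_set_coord /ker_prim /p /H.
  by rewrite -[RHS]mulrA [RHS]mulrC.
- have := kop_integrable i y (kern_int a b i) bp; exact.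
- have := intg psi g bp cg; congr (_.-integrable _ _); apply/funext => t.
  by congr EFin; rewrite /p /G; ring.
- have := congr1 (fun F => F y) p0; rewrite /line_int /kop /ker_int; exact.
Qed.

(** Lines that miss the interior of the box contribute zero to both sides. *)
Lemma step_by_parts i psi g h : bmeas psi -> line_int a b i psi = (fun=> 0) ->
  {within Omega, continuous g} -> {within Omega, continuous h} ->
  (forall x, Omega° x -> differentiable g x) ->
  (forall x, Omega° x -> h x = 'D_(M *m basis_vec i) g x) ->
  \int[lam]_y (psi y * pull g y) = - \int[lam]_y (line_prim a b i psi y * pull h y).
Proof.
move=> bp p0 cg ch dg hE.
have bP : bmeas (line_prim a b i psi) by exact: bmeas_kop (kern_prim a b i) bp.
have i1 := integrable_pull bp cg.
have i2 : lam.-integrable setT (fun y => (- (line_prim a b i psi y * pull h y))%:E).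
  under eq_fun do rewrite EFinN; apply: integrableN; exact: integrable_pull.
transitivity (\int[lam]_y (- (line_prim a b i psi y * pull h y))); last first.
  under eq_Rintegral do rewrite -mulN1r; rewrite RintegralZl ?mulN1r//.
  exact: integrable_pull.
rewrite /Rintegral; congr fine; apply: (eq_integral_slices (i := i) i1 i2) => y.
have sl q k : bmeas q -> {within Omega, continuous k} ->
    lebR.-integrable setT (fun t => (q (set_coord y i t) * pull k (set_coord y i t))%:E).
  move=> bq ck.
  have := kop_integrable i y (kern_int a b i) (bmeasM bq (bmeas_pull ck)).
  congr (_.-integrable _ _); apply/funext => t; congr EFin; rewrite /ker_int.
  rewrite /pull [X in _ * (X * _)]indicE; have [|_] := boolP (_ \in _); last by rewrite !(mul0r, mulr0).
  rewrite inE => /(_ i); rewrite set_coordE eqxx /= in_itv/= => /andP[u v].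
  by rewrite indicE mem_set ?mulr1//= in_itv/= !ltW.
rewrite -EFin_Rintegral//; last exact: sl.
have slN : lebR.-integrable setT (fun t => (- (line_prim a b i psi (set_coord y i t) * pull h (set_coord y i t)))%:E).
  by under eq_fun do rewrite EFinN; apply: integrableN; exact: sl.
rewrite -EFin_Rintegral//.
congr EFin.
transitivity (- \int[lebR]_t (line_prim a b i psi (set_coord y i t) * pull h (set_coord y i t))); last first.
  under [RHS]eq_Rintegral do rewrite -mulN1r; rewrite RintegralZl ?mulN1r//.
  exact: sl.
have [yo|/existsNP[j /not_implyP[ji nj]]] := pselect (forall j, j != i -> y j ord0 \in `]a j, b j[).
  exact: slice_by_parts.
have z q k : \int[lebR]_t (q (set_coord y i t) * pull k (set_coord y i t)) = 0.
  rewrite (_ : (fun t => _) = fun=> 0) ?Rintegral_cst ?mul0r//.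
  apply/funext => t; rewrite /pull indicE memNset ?mul0r ?mulr0// => /(_ j).
  by rewrite set_coordE (negbTE ji).
by rewrite !z oppr0.
Qed.
End step.

(** * Integration over a block of coordinates *)

Section mixed_bound.
Context {R : realType} {d : nat}.
Local Notation E := 'cV[R]_d.
Local Notation lam := (@lebesgue_cV R d).
Local Notation lebR := (@lebesgue_measure R).
Variables (a b : 'I_d -> R) (ab : forall i, a i < b i).
Implicit Types (q r : E -> R) (y : E) (i j : 'I_d) (s : seq 'I_d).
Local Notation N i := (line_int a b i).
Local Notation Ns s := (int_seq a b s).
Local Notation chi := (\1_(box a b) : E -> R).

Lemma box_set_coord i y t : box a b (set_coord y i t) <->
  a i <= t <= b i /\ forall j, j != i -> a j <= y j ord0 <= b j.
Proof.
split=> [h|[ti yo] j].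
  split; first by have := h i; rewrite set_coordE eqxx.
  by move=> j ji; have := h j; rewrite set_coordE (negbTE ji).
by rewrite set_coordE; case: eqP => [->//|/eqP /yo].
Qed.

Lemma line_int_box i q y : bmeas q -> (forall j, j != i -> a j <= y j ord0 <= b j) ->
  \int[lebR]_t (chi (set_coord y i t) * q (set_coord y i t)) = N i q y.
Proof.
move=> bq yo; apply: eq_Rintegral => t _; rewrite mulrC /ker_int !indicE; congr (_ * _%:R).
by congr nat_of_bool; apply/idP/idP; rewrite !inE/= in_itv/=; [by case/box_set_coord|by move=> ti; apply/box_set_coord].
Qed.

Lemma box_line_integrable i q y : bmeas q ->
  lebR.-integrable setT (fun t => (chi (set_coord y i t) * q (set_coord y i t))%:E).
Proof.
move=> bq; have mB := @measurable_box R d a b.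
have := kop_integrable i y (kern_int a b i) (bmeasM (bmeas_indic mB) bq).
congr (_.-integrable _ _); apply/funext => t; congr EFin; rewrite /ker_int.
have [yB|yB] := boolP (set_coord y i t \in box a b).
  move: yB; rewrite inE => yB; rewrite [X in _ * X]indicE mem_set ?mulr1//.
  by move/box_set_coord : yB => -[]; rewrite /= in_itv.
by rewrite indicE (negbTE yB) !mul0r.
Qed.

(** On each line both integrals equal the product of the integrals of q and r. *)
Lemma line_int_adjoint i q r : bmeas q -> bmeas r ->
  (\int[lam]_y (chi y * (N i q y * r y))%:E = \int[lam]_y (chi y * (q y * N i r y))%:E)%E.
Proof.
move=> bq br.
have bN g : bmeas g -> bmeas (N i g) by exact: bmeas_kop (kern_int a b i).
have b1 := bmeasM (bN _ bq) br; have b2 := bmeasM bq (bN _ br).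
apply: (@eq_integral_slices _ _ i); [exact: integrable_on_box|exact: integrable_on_box|].
move=> y.
rewrite -EFin_Rintegral//; last exact: box_line_integrable b1.
rewrite -EFin_Rintegral//; last exact: box_line_integrable b2.
congr EFin.
have [yo|/existsNP[j /not_implyP[ji nj]]] := pselect (forall j, j != i -> a j <= y j ord0 <= b j).
  rewrite (line_int_box b1 yo) (line_int_box b2 yo).
  under [X in N i X y = _]eq_fun do rewrite mulrC.
  rewrite !line_int_mulr// => [|s|s]; [by rewrite mulrC|exact: line_int_set_coord..].
rewrite -[LHS]/(Rintegral _ _ _) (_ : (fun t => _) = fun=> 0); last first.
  apply/funext => t; rewrite indicE memNset ?mul0r// => /box_set_coord[_ /(_ j ji)].
  exact: nj.
apply: eq_Rintegral => t _; rewrite indicE memNset ?mul0r// => /box_set_coord[_ /(_ j ji)].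
exact: nj.
Qed.

Lemma int_seq_adjoint s q r : bmeas q -> bmeas r ->
  (\int[lam]_y (chi y * (Ns s q y * r y))%:E = \int[lam]_y (chi y * (q y * Ns (rev s) r y))%:E)%E.
Proof.
move=> bq; elim: s r => [|i s IH] r br //=.
rewrite line_int_adjoint//; last exact: bmeas_int_seq.
rewrite IH; last exact: bmeas_kop (kern_int a b i) br.
by rewrite rev_cons /int_seq foldr_rcons.
Qed.

Lemma int_seq_set_coord s i r y t : i \in s -> Ns s r (set_coord y i t) = Ns s r y.
Proof.
elim: s y => //= j s IH y; rewrite inE => /predU1P[->|is_]; first exact: line_int_set_coord.
have [->|ij] := eqVneq i j; first exact: line_int_set_coord.
rewrite !line_intE; apply: eq_Rintegral => u _.
by rewrite set_coordC// IH.
Qed.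

(** One passes from y to y' by changing the coordinates in I one at a time. *)
Lemma agree_off (I : {set 'I_d}) (h : E -> R) y y' :
  (forall i z t, i \in I -> h (set_coord z i t) = h z) ->
  (forall j, j \notin I -> y j ord0 = y' j ord0) -> h y = h y'.
Proof.
move=> hI yy'; pose z s := foldr (fun i w => set_coord w i (y' i ord0)) y s.
have zE s j : z s j ord0 = if j \in s then y' j ord0 else y j ord0.
  elim: s => //= i s IH; rewrite set_coordE inE; case: eqP => [->//|_]; exact: IH.
have hz s : {subset s <= I} -> h (z s) = h y.
  elim: s => //= i s IH sI; rewrite hI; last by apply: sI; rewrite mem_head.
  by apply: IH => j js; apply: sI; rewrite inE js orbT.
(* After all the changes, the point is y'. *)
rewrite -(hz (enum I)); last by move=> j; rewrite mem_enum.
congr h; apply/colP => j; rewrite zE mem_enum; case: ifPn => // /yy' //.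
Qed.

Lemma int_seq_cst s y : Ns s (fun=> 1) y = \prod_(i <- s) (b i - a i).
Proof.
elim: s y => [|i s IH] y; first by rewrite big_nil.
rewrite big_cons /= line_int_cst// ?IH//.
Qed.

Lemma box_on_mbox (J : {set 'I_d}) :
  box_on a b (J := J) = mbox (fun k : 'I_#|J| => `[a (enum_val k), b (enum_val k)]%classic).
Proof. by apply/seteqP; split => x /= xA i; have := xA i; rewrite /= in_itv. Qed.

Lemma measurable_box_on (J : {set 'I_d}) : measurable (box_on a b (J := J)).
Proof. by rewrite box_on_mbox; exact: measurable_mbox. Qed.

Lemma box_on_volume (J : {set 'I_d}) :
  @lebesgue_cV R #|J| (box_on a b (J := J)) = (\prod_(i <- enum J) (b i - a i))%:E.
Proof.
rewrite box_on_mbox (lebesgue_cV_mbox (A := fun k : 'I_#|J| => `[a (enum_val k), b (enum_val k)]%classic))//.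
rewrite big_enum/= [in RHS]big_enum_val -prodEFin; apply: eq_bigr => k _.
by rewrite (_ : _ `[_, _]%classic = (b (enum_val k) - a (enum_val k))%:E)// lebesgue_measure_itv/= lte_fin ab EFinB.
Qed.

Lemma box_glue (J : {set 'I_d}) wu : box a b (@glue R d J wu) <->
  box_on a b (J := ~: J) wu.1 /\ box_on a b (J := J) wu.2.
Proof.
have := @glue_mbox R d J (fun i => `[a i, b i]%classic).
rewrite -box_mbox -!box_on_mbox => /seteqP[h1 h2]; split; [exact: h1|exact: h2].
Qed.

Section fubini_blocks.
Variable I : {set 'I_d}.
Local Notation lamI := (@lebesgue_cV R #|I|).
Local Notation lamC := (@lebesgue_cV R #|~: I|).
Local Notation chiI := (\1_(box_on a b (J := I)) : 'cV[R]_#|I| -> R).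
Local Notation chiC := (\1_(box_on a b (J := ~: I)) : 'cV[R]_#|~: I| -> R).
Local Open Scope ereal_scope.

Let Q (g : E -> R) w := \int[lamI]_u (chiI u * g (@glue R d I (w, u)))%:E.

Let measurable_joint g : bmeas g ->
  measurable_fun setT (fun wu : 'cV[R]_#|~: I| * 'cV[R]_#|I| => (chiI wu.2 * g (@glue R d I wu))%:E).
Proof.
move=> [mg _]; apply/measurable_EFinP; apply: measurable_funM.
  apply: (measurableT_comp (f := chiI)) => //.
  by apply: measurable_indic; exact: measurable_box_on.
by apply: (measurableT_comp mg); exact: measurable_glue.
Qed.

Let measurable_Q g : bmeas g -> (forall y, (0 <= g y)%R) -> measurable_fun setT (Q g).
Proof.
move=> bg g0; apply: (measurable_fun_fubini_tonelli_F _ (measurable_joint bg)).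
by move=> x; rewrite lee_fin mulr_ge0.
Qed.

(** Here h, which does not depend on the coordinates in I, leaves the inner
    integral. *)
Let integral_box_split g h : bmeas g -> bmeas h ->
  (forall y, (0 <= g y)%R) -> (forall y, (0 <= h y)%R) ->
  (forall i z t, i \in I -> h (set_coord z i t) = h z) ->
  \int[lam]_y (chi y * (g y * h y))%:E =
  \int[lamC]_w ((chiC w * h (embed w))%:E * Q g w).
Proof.
move=> bg bh g0 h0 hI; rewrite (@ge0_integral_glue _ _ I).
- apply: eq_integral => w _.
  rewrite /Q -ge0_integralZl//; last 3 first.
  + exact: (measurableT_comp (measurable_joint bg) (measurable_pair1 w)).
  + by move=> u _; rewrite lee_fin mulr_ge0.
  + by rewrite lee_fin mulr_ge0.
  apply: eq_integral => u _; rewrite -EFinM; congr EFin.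
  have -> : h (@glue R d I (w, u)) = h (embed w).
    apply: (agree_off hI) => j jI; rewrite /glue/= mxE (embed_notin (J := I))// addr0//.
  rewrite [X in (X * _)%R = _](_ : _ = chiC w * chiI u)%R; first by ring.
  rewrite !indicE -natrM mulnb; congr (nat_of_bool _)%:R.
  apply/idP/andP; rewrite !inE; first by case/box_glue.
  by move=> [wC uI]; apply/box_glue.
- apply/measurable_EFinP; apply: measurable_funM; last exact: (bmeasM bg bh).1.
  by apply: measurable_indic; exact: measurable_box.
- by move=> y; rewrite lee_fin !mulr_ge0.
Qed.

(** By adjointness the left-hand side is the integral of q h with h the integral
    of r over the coordinates in I. For fixed w, the integral of q over the
    fibre is at most L, and h is constant there. The integral of h over the
    outer coordinates equals that of r over the box: take q = 1, whose integral
    over the coordinates in I is the volume of the fibre. *)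
Lemma mixed_mean_bound q r (L : R) : bmeas q -> bmeas r ->
  (forall y, (0 <= q y)%R) -> (forall y, (0 <= r y)%R) -> (0 <= L)%R ->
  {ae lamC, forall w, box_on a b w ->
    \int[lamI]_(u in box_on a b (J := I)) (q (embed w + embed u)%R)%:E <= L%:E} ->
  \int[lam]_y (chi y * (Ns (enum I) q y * r y))%:E <= L%:E * \int[lam]_y (chi y * r y)%:E.
Proof.
move=> bq br q0 r0 L0 qL.
set h := Ns (rev (enum I)) r.
have bh : bmeas h by exact: bmeas_int_seq.
have h0 y : (0 <= h y)%R by exact: int_seq_ge0.
have hI i z t : i \in I -> h (set_coord z i t) = h z.
  by move=> iI; apply: int_seq_set_coord; rewrite mem_rev mem_enum.
set V : R := (\prod_(i <- enum I) (b i - a i))%R.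
have V0 : (0 < V)%R by rewrite /V; apply: prodr_gt0 => i _; rewrite subr_gt0.
set H := fun w => (chiC w * h (embed w))%:E.
have H0 w : 0 <= H w by rewrite lee_fin mulr_ge0.
have mH : measurable_fun setT H.
  apply/measurable_EFinP; apply: measurable_funM.
    by apply: measurable_indic; exact: measurable_box_on.
  by apply: (measurableT_comp bh.1); exact: measurable_embed.
have WE : \int[lamC]_w H w = \int[lam]_y (chi y * r y)%:E.
  have b1 : bmeas ((fun=> 1%R) : E -> R) by exact: bmeas_cst.
  have := integral_box_split b1 bh (fun=> ler01) h0 hI.
  rewrite -int_seq_adjoint//.
  under eq_integral do rewrite int_seq_cst mulrCA EFinM.
  rewrite ge0_integralZl//; last 3 first.
  - by apply/measurable_EFinP; apply: measurable_funM; [apply: measurable_indic; exact: measurable_box|exact: br.1].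
  - by move=> y _; rewrite lee_fin mulr_ge0.
  - by rewrite lee_fin ltW.
  have QV w : Q (fun=> 1%R) w = V%:E.
    rewrite /Q; under eq_integral do rewrite mulr1.
    rewrite integral_indic//; last exact: measurable_box_on.
    by rewrite setIT; exact: box_on_volume.
  under [X in _ = X -> _]eq_integral do rewrite QV.
  rewrite ge0_integralZr//; [|by move=> w _; exact: H0|by rewrite lee_fin ltW].
  rewrite muleC -/V => /(congr1 (fun x => x * (V^-1)%:E)).
  by rewrite -!muleA -EFinM divff ?mule1 ?gt_eqF.
rewrite int_seq_adjoint// integral_box_split// -WE -ge0_integralZl//.
apply: ae_ge0_le_integral => //.
- by move=> w _; apply: mule_ge0; [exact: H0|rewrite /Q integral_ge0//] => u _; rewrite lee_fin mulr_ge0.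
- by apply: emeasurable_funM; [exact: mH|exact: measurable_Q].
- by move=> w _; apply: mule_ge0.
- by apply: emeasurable_funM.
apply: filterS qL => w qL _; rewrite muleC.
have [wC|wC] := boolP (w \in box_on a b (J := ~: I)); last first.
  by rewrite /H indicE (negbTE wC) mul0r !mule0.
rewrite -/(H w); apply: lee_wpmul2r => //.
move: wC; rewrite inE => wC; apply: le_trans (qL wC).
rewrite [leRHS]integral_mkcond /Q le_eqVlt; apply/orP; left; apply/eqP.
apply: eq_integral => u _; rewrite patchE indicE.
by case: (_ \in _); rewrite ?mul1r ?mul0r.
Qed.

End fubini_blocks.

End mixed_bound.

(** * Iterated integration by parts *)

Section smooth_bound.
Context {R : realType} {d : nat}.
Local Notation E := 'cV[R]_d.
Local Notation lam := (@lebesgue_cV R d).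
Variables (a b : 'I_d -> R) (ab : forall i, a i < b i).
Variables (M : 'M[R]_d) (M_unit : M \in unitmx) (c : E).
Local Notation T := (affine M c).
Local Notation Ti := (affine_inv M c).
Local Notation Omega := (T @` box a b).
Local Notation pull := (pull a b M c).
Let v i : E := M *m basis_vec i.
Implicit Types (psi f g : E -> R).

(** Each step removes one derivative order from f; the function that replaces
    psi keeps mean zero in the remaining directions. *)
Lemma iterate_by_parts s k psi f : bmeas psi -> uniq s ->
  (forall i, i \in s -> line_int a b i psi = fun=> 0) ->
  Ck_closure (size s + k) Omega f ->
  exists g, [/\ forall x, Omega° x -> g x = foldr (fun i h => 'D_(v i) h) f s x,
    Ck_closure k Omega g &
    `|\int[lam]_y (psi y * pull f y)| = `|\int[lam]_y (prim_seq a b s psi y * pull g y)|].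
Proof.
move=> bp; elim: s k => [|i s IH] k /=; first by move=> _ _ Cf; exists f; split.
move=> /andP[si us] p0 Cf.
have {}Cf : Ck_closure (size s + k.+1) Omega f by rewrite addnS.
have [|g1 [g1E C1 ->]] := IH k.+1 us _ Cf.
  by move=> j js; apply: p0; rewrite inE js orbT.
have [g gE Cg] := Ck_closure_derive (v i) C1.
exists g; split => //.
  move=> x Ox; rewrite gE//; apply: near_eq_derive.
  have : open (Omega°) by exact: open_interior.
  by rewrite openE => /(_ _ Ox); rewrite /interior; apply: filterS.
have [_ [dg1 _]] := C1.
rewrite (step_by_parts ab M_unit (i := i) _ _ (Ck_closure_continuous C1) (Ck_closure_continuous Cg) dg1 gE) ?normrN//.
  exact: bmeas_prim_seq.
by apply: line_int_prim_seq => //; apply: p0; rewrite mem_head.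
Qed.

Lemma pull_Ti f x : pull f (Ti x) = \1_(Omega°) x * f x.
Proof.
by rewrite /pull affine_invK// interior_affine_box.
Qed.

Local Open Scope ereal_scope.

Lemma integral_pull_Ti f : {within Omega, continuous f} ->
  \int[lam]_(x in Omega°) `|f x|%:E = jacobian M c * \int[lam]_y `|pull f y|%:E.
Proof.
move=> cf; have bf := bmeas_norm (bmeas_pull M_unit cf).
rewrite -(ge0_integral_affine_inv M_unit)//; last by apply/measurable_EFinP; exact: bf.1.
rewrite integral_mkcond; apply: eq_integral => x _; rewrite patchE pull_Ti indicE.
by case: (_ \in _); rewrite ?mul1r ?mul0r ?normr0.
Qed.

Lemma Rintegral_pull_Ti psi f : bmeas psi -> {within Omega, continuous f} ->
  (\int[lam]_(x in Omega°) (psi (Ti x) * f x)%R)%:E =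
  jacobian M c * (\int[lam]_y (psi y * pull f y)%R)%:E.
Proof.
move=> bp cf; have ip := integrable_pull M_unit bp cf.
rewrite (EFin_Rintegral measurableT ip) -(integral_affine_inv M_unit c ip).2.
rewrite -(EFin_Rintegral measurableT (integral_affine_inv M_unit c ip).1); congr EFin.
rewrite [LHS]Rintegral_mkcond; apply: eq_Rintegral => x _.
by rewrite patchE pull_Ti indicE; case: (_ \in _); rewrite ?mul1r ?mul0r ?mulr0.
Qed.

(** After k integrations by parts, [prim_seq_le] bounds the iterated primitive
    and [mixed_mean_bound] integrates the bound against the mixed derivative. *)
Lemma smooth_bound (I : {set 'I_d}) psi f (L : R) : bmeas psi ->
  (forall i, i \in I -> line_int a b i psi = fun=> 0%R) -> (0 <= L)%R ->
  {ae @lebesgue_cV R #|~: I|, forall w, box_on a b w ->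
    \int[@lebesgue_cV R #|I|]_(u in box_on a b (J := I)) `|psi (embed w + embed u)%R|%:E <= L%:E} ->
  Ck_closure #|I| Omega f ->
  `|\int[lam]_(x in Omega°) (psi (Ti x) * f x)%R|%R%:E <=
    ((2 ^+ #|I|)^-1 * L)%R%:E * \int[lam]_(x in Omega°) `|mixed_derivative I v f x|%:E.
Proof.
move=> bp p0 L0 pL Cf.
have cf := Ck_closure_continuous Cf.
have Cf' : Ck_closure (size (enum I) + 0) Omega f by rewrite addn0 -cardE.
have p0' i : i \in enum I -> line_int a b i psi = fun=> 0%R by rewrite mem_enum; exact: p0.
have [g [gE /Ck_closure_continuous cg pg]] := iterate_by_parts bp (enum_uniq I) p0' Cf'.
have J0 := jacobian_ge0 M c.
rewrite -abse_EFin Rintegral_pull_Ti// abseM (gee0_abs J0) abse_EFin pg.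
have -> : \int[lam]_(x in Omega°) `|mixed_derivative I v f x|%:E =
    \int[lam]_(x in Omega°) `|g x|%:E.
  by apply: eq_integral => x; rewrite inE => Ox; rewrite gE.
rewrite integral_pull_Ti// [leRHS]muleCA lee_wpmul2l//.
set P := prim_seq a b (enum I) psi.
have bP : bmeas P by exact: bmeas_prim_seq.
have bq := bmeas_norm bp; have br := bmeas_norm (bmeas_pull M_unit cg).
have chir y : ((\1_(box a b) y * `|pull g y|) = `|pull g y|)%R.
  rewrite /pull !indicE; have [/set_mem yo|_] := boolP (y \in obox a b).
    by rewrite (mem_set (obox_sub yo)) mul1r.
  by rewrite mul0r normr0 mulr0.
have iP := integrable_pull M_unit bP cg.
have mr : measurable_fun setT (fun y => (\1_(box a b) y * `|pull g y|)%:E).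
  by apply/measurable_EFinP; under eq_fun do rewrite chir; exact: br.1.
apply: (@le_trans _ _ (\int[lam]_y (`|P y| * `|pull g y|)%:E)).
  rewrite -abse_EFin (EFin_Rintegral measurableT iP).
  apply: (le_trans (le_abse_integral _ measurableT (measurable_int _ iP))).
  by under eq_integral do rewrite abse_EFin normrM.
apply: (@le_trans _ _ (\int[lam]_y (((2 ^+ #|I|)^-1)%:E *
    (\1_(box a b) y * (int_seq a b (enum I) (fun x => `|psi x|%R) y * `|pull g y|))%:E))).
  have bN := bmeas_int_seq a b (enum I) bq.
  apply: ge0_le_integral => //.
  - by apply/measurable_EFinP; exact: (bmeasM (bmeas_norm bP) br).1.
  - under eq_fun do rewrite mulrCA chir -EFinM.
    apply/measurable_EFinP; apply: measurable_funM => //.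
    exact: (bmeasM bN br).1.
  - move=> y _; rewrite mulrCA chir -EFinM lee_fin mulrA ler_wpM2r// cardE.
    by apply: prim_seq_le => //; exact: enum_uniq.
have mN : measurable_fun setT (fun y => (\1_(box a b) y * (int_seq a b (enum I) (fun x => `|psi x|%R) y * `|pull g y|))%:E).
  apply/measurable_EFinP; under eq_fun do rewrite mulrCA chir.
  exact: (bmeasM (bmeas_int_seq a b (enum I) bq) br).1.
rewrite ge0_integralZl//; last first.
  by move=> y _; rewrite lee_fin !mulr_ge0// int_seq_ge0.
rewrite EFinM -muleA lee_wpmul2l//.
under [in leRHS]eq_integral do rewrite -chir.
exact: mixed_mean_bound.
Qed.

End smooth_bound.

(** * Essential suprema and almost everywhere equality *)

Section ess_sup_on.
Local Open Scope ereal_scope.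
Context d (T : measurableType d) (R : realType) (mu : {measure set T -> \bar R}).
Implicit Types (D : set T) (g : T -> \bar R).

Lemma ess_sup_on_ge D g : {ae mu, forall x, D x -> g x <= ess_sup_on mu D g}.
Proof.
have := ess_sup_ge mu (patch (cst -oo) D g); apply: filterS => x + Dx.
by rewrite /patch mem_set.
Qed.

Lemma ess_sup_on_le D g y : {ae mu, forall x, D x -> g x <= y} -> ess_sup_on mu D g <= y.
Proof.
move=> gy; apply/ess_supP; apply: filterS gy => x gy; rewrite /patch.
by case: ifPn => [|_]; [rewrite inE => /gy|exact: leNye].
Qed.

Lemma ae_nonnull_ex D (P : set T) : measurable D -> mu D != 0 ->
  {ae mu, forall x, D x -> P x} -> exists2 x, D x & P x.
Proof.
move=> mD D0 [N [mN N0 PN]]; apply: contrapT => nP; move/eqP: D0; apply.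
apply/eqP; rewrite eq_le measure_ge0 andbT -N0; apply: le_measure; rewrite ?inE//.
by move=> x Dx; apply: PN => /= h; apply: nP; exists x => //; exact: h.
Qed.

(** As D is not null, the supremum is neither -oo nor negative. *)
Lemma ess_sup_on_fin D g (K : R) : measurable D -> mu D != 0 ->
  {ae mu, forall x, D x -> 0 <= g x <= K%:E} ->
  exists2 L : R, (0 <= L)%R & ess_sup_on mu D g = L%:E.
Proof.
move=> mD D0 gK.
have le1 : ess_sup_on mu D g <= K%:E.
  by apply: ess_sup_on_le; apply: filterS gK => x + Dx => /(_ Dx) /andP[].
have ge0 : 0 <= ess_sup_on mu D g.
  have [x Dx] : exists2 x, D x & 0 <= g x <= K%:E /\ g x <= ess_sup_on mu D g.
    apply: ae_nonnull_ex => //; have := ess_sup_on_ge D g.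
    by apply: filterS2 gK => x h1 h2 Dx; split; [exact: h1|exact: h2].
  by move=> [/andP[+ _]]; exact: le_trans.
exists (fine (ess_sup_on mu D g)); first exact: fine_ge0.
by rewrite fineK// ge0_fin_numE// (le_lt_trans le1)// ltry.
Qed.

End ess_sup_on.

Section ae_means.
Context {R : realType} {d : nat}.
Local Notation E := 'cV[R]_d.
Local Notation lam := (@lebesgue_cV R d).
Local Notation lebR := (@lebesgue_measure R).
Variables (a b : 'I_d -> R) (ab : forall i, a i < b i).
Implicit Types (p q : E -> R) (s : seq 'I_d).

Lemma mean_free_eq_box s p q : (forall y, box a b y -> p y = q y) ->
  forall y, box a b y -> mean_free a b s p y = mean_free a b s q y.
Proof.
move=> pq; elim: s => //= i s IH y yB; congr (_ - _ * _); first exact: IH.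
apply: eq_Rintegral => t; rewrite inE/= in_itv/= => ti; apply: IH.
by apply/box_set_coord; split => // j _; exact: yB.
Qed.

Lemma measurable_mean_free s p : measurable_fun setT p ->
  measurable_fun setT (mean_free a b s p).
Proof.
move=> mp; elim: s => //= i s IH; apply: measurable_funB => //.
rewrite slice_meanE; apply: measurable_funM => //.
exact: measurable_kop (kern_int a b i) IH.
Qed.

(** On almost every line parallel to e_i, p and q agree almost everywhere, so
    that they have the same mean there. *)
Lemma ae_mean_free s p q : measurable_fun setT p -> measurable_fun setT q ->
  {ae lam, forall y, p y = q y} ->
  {ae lam, forall y, mean_free a b s p y = mean_free a b s q y}.
Proof.
move=> mp mq pq; elim: s => //= i s IH.
have mP := measurable_mean_free s mp; have mQ := measurable_mean_free s mq.
move: mP mQ IH; set P := mean_free a b s p; set Q := mean_free a b s q => mP mQ PQ.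
have [N [mN N0 PN]] := PQ.
have := ae_slice_null i mN N0; apply: filterS2 PQ => y yPQ yN.
rewrite /= yPQ !slice_meanE; congr (_ - _ * _); congr fine.
have mk (g : E -> R) : measurable_fun setT g -> measurable_fun setT
    (fun t : measurableTypeR R => (g (set_coord y i t) * ker_int a b i (y i ord0) t)%:E).
  move=> mg; apply/measurable_EFinP; apply: measurable_funM.
    exact: (measurableT_comp mg (measurable_slice i y)).
  exact: kern_measurable (kern_int a b i).
apply: (@ae_eq_integral _ (measurableTypeR R) _ lebR) => //; [exact: mk|exact: mk|].
exists [set t | N (set_coord y i t)]; split => //.
- rewrite -[X in measurable X]setTI; exact: (measurable_slice i y).
- by move=> t /= h; apply: PN => /= e; apply: h => _; rewrite e.
Qed.

End ae_means.

(** * Separating the two parts of phi *)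

Section representative.
Context {R : realType} {d : nat}.
Local Notation E := 'cV[R]_d.
Local Notation lam := (@lebesgue_cV R d).
Variables (a b : 'I_d -> R).

(** Truncation of p at its essential supremum. *)
Lemma bounded_representative (p : E -> R) : Linfty (box a b) p ->
  exists psi : E -> R, [/\ bmeas psi, measurable_fun setT (p \_ (box a b)) &
    {ae lam, forall y, (p \_ (box a b)) y = psi y}].
Proof.
move=> [mp np]; set q := p \_ (box a b).
have mq : measurable_fun setT q.
  by apply/(measurable_restrictT _ (measurable_box a b)).
(* If the supremum is -oo, fine turns it into the bound 0. *)
pose B := `|fine (Linfty_norm (box a b) p)|.
have nB : (Linfty_norm (box a b) p <= B%:E)%E.
  by move: np; rewrite /B; case: Linfty_norm => [r|//|] _; rewrite ?leNye// lee_fin ler_norm.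
have mA : measurable [set y | `|q y| <= B].
  rewrite -[X in measurable X]setTI.
  have mn : measurable_fun setT (fun y => `|q y|) by exact: measurableT_comp.
  have := mn measurableT `]-oo, B]%classic (measurable_itv _).
  by congr measurable; apply/seteqP; split => y /=; rewrite in_itv.
exists (fun y => q y * \1_[set y | `|q y| <= B] y); split => //.
  split; first by apply: measurable_funM => //; exact: measurable_indic.
  exists B => y; rewrite indicE; have [|_] := boolP (_ \in _); first by rewrite inE mulr1.
  by rewrite mulr0 normr0 normr_ge0.
have := ess_sup_on_ge lam (box a b) (fun x => `|p x|%:E); apply: filterS => y h.
have qB : `|q y| <= B.
  rewrite /q patchE; case: ifPn => [|_]; last by rewrite normr0 normr_ge0.
  by rewrite inE => /h /le_trans /(_ nB); rewrite lee_fin.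
by rewrite indicE mem_set ?mulr1.
Qed.

End representative.

Section assembly.
Context {R : realType} {d : nat}.
Local Notation E := 'cV[R]_d.
Local Notation lam := (@lebesgue_cV R d).
Variables (a b : 'I_d -> R) (ab : forall i, a i < b i).
Variables (M : 'M[R]_d) (M_unit : M \in unitmx) (c : E).
Local Notation T := (affine M c).
Local Notation Ti := (affine_inv M c).
Local Notation Omega := (T @` box a b).

Lemma P_T_affine (I : {set 'I_d}) (phi : E -> R) :
  P_T a b M c I phi \o T = mean_free a b (enum I) (phi \o T).
Proof.
rewrite /P_T; elim: (enum I) => //= i s IH; apply/funext => y /=.
rewrite -IH /= /slice_meanT /= affineK//.
Qed.

Lemma ae_affine_inv (P : E -> Prop) :
  {ae lam, forall y, P y} -> {ae lam, forall x, P (Ti x)}.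
Proof.
move=> [N [mN N0 PN]]; exists (Ti @^-1` N); split.
- rewrite -[X in measurable X]setTI; exact: measurable_affine_inv.
- exact: affine_inv_null.
- by move=> x /= h; exact: PN.
Qed.

Lemma Omega_Ti x : Omega x <-> box a b (Ti x).
Proof. by rewrite affine_image. Qed.

Lemma measurable_Omega : measurable Omega.
Proof.
rewrite affine_image// -[X in measurable X]setTI; apply: measurable_affine_inv => //.
exact: measurable_box.
Qed.

Local Open Scope ereal_scope.

Lemma integral_Omega_interior (F : E -> \bar R) : lam.-integrable Omega F ->
  \int[lam]_(x in Omega) F x = \int[lam]_(x in Omega°) F x.
Proof.
move=> iF; have mO := measurable_Omega.
have mI : measurable (Omega°) by exact: interior_measurable.
rewrite (negligible_integral (N := Omega `\` Omega°))//.
- by rewrite setDD setIidr//; exact: interior_subset.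
- exact: measurableD.
- rewrite interior_affine_box// affine_image//.
  apply: (affine_inv_null M_unit c (N := box a b `\` obox a b)); last exact: box_boundary_null.
  by apply: measurableD; [exact: measurable_box|exact: measurable_obox].
Qed.

Variables (f phi : E -> R) (f_dens : prob_density Omega f).
Variables (psi0 : E -> R) (bpsi0 : bmeas psi0).
Hypothesis mphi : measurable_fun setT ((phi \o T) \_ (box a b)).
Hypothesis phi_psi0 : {ae lam, forall y, ((phi \o T) \_ (box a b)) y = psi0 y}.
Variable I : {set 'I_d}.
Let psi := mean_free a b (enum I) psi0.

Lemma ae_P_T : {ae lam, forall y, box a b y -> P_T a b M c I phi (T y) = psi y}.
Proof.
have := ae_mean_free a b (enum I) mphi bpsi0.1 phi_psi0; apply: filterS => y e yB.
rewrite -[LHS]/((P_T a b M c I phi \o T) y) P_T_affine -[RHS]e.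
by apply: mean_free_eq_box => // z zB; rewrite patchE mem_set.
Qed.

Lemma Omega_nonnull : lam Omega != 0.
Proof.
have [_ _ f1] := f_dens; apply/eqP => O0; move: f1.
rewrite null_set_integral//; [|exact: measurable_Omega|by have [_ /measurable_int] := f_dens].
by move=> /eqP; rewrite eq_sym onee_eq0.
Qed.

(** On Omega, phi is almost everywhere the sum of psi and psi0 - psi composed
    with the inverse of T. The second function is R phi, whose absolute value is
    almost everywhere at most its norm, and f has integral 1. *)
Lemma split_bound (X : \bar R) : 0 <= X ->
  `|\int[lam]_(x in Omega°) (psi (Ti x) * f x)%R|%R%:E <= X ->
  `|\int[lam]_(x in Omega) (phi x * f x)%:E| <= X + Linfty_norm Omega (R_T a b M c I phi).
Proof.
move=> X0 psiX; have [f0 fi f1] := f_dens.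
have mO := measurable_Omega; have mTi := @measurable_affine_inv R d M c.
have bpsi : bmeas psi by exact: bmeas_mean_free.
have brho : bmeas (fun y => psi0 y - psi y)%R by exact: bmeasB.
have mf : measurable_fun Omega f by exact/measurable_EFinP/measurable_int/fi.
have phiE : {ae lam, forall x, Omega x -> phi x = psi0 (Ti x)}.
  have := ae_affine_inv phi_psi0; apply: filterS => x <- Ox.
  by rewrite patchE mem_set ?/= ?affine_invK//; exact/Omega_Ti.
have PE : {ae lam, forall x, Omega x -> P_T a b M c I phi x = psi (Ti x)}.
  have := ae_affine_inv ae_P_T; apply: filterS => x h Ox.
  by rewrite -h ?affine_invK//; exact/Omega_Ti.
have RE : {ae lam, forall x, Omega x -> R_T a b M c I phi x = (psi0 (Ti x) - psi (Ti x))%R}.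
  by apply: filterS2 phiE PE => x h1 h2 Ox; rewrite /R_T/= h1// h2.
have [n n0 nE] : exists2 n : R, (0 <= n)%R & Linfty_norm Omega (R_T a b M c I phi) = n%:E.
  have [_ [K rK]] := brho; apply: (ess_sup_on_fin (K := K)) => //; first exact: Omega_nonnull.
  by apply: filterS RE => x h Ox; rewrite h// !lee_fin normr_ge0 rK.
have rho_n : {ae lam, forall x, Omega x -> (`|psi0 (Ti x) - psi (Ti x)| <= n)%R}.
  have := ess_sup_on_ge lam Omega (fun x => `|R_T a b M c I phi x|%:E).
  by apply: filterS2 RE => x h1 h2 Ox; rewrite -lee_fin -nE -h1//; exact: h2.
have i1 := integrable_bmeas mO mTi fi bpsi.
have i2 := integrable_bmeas mO mTi fi brho.
have mphiO : measurable_fun Omega phi.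
  have : measurable_fun Omega (((phi \o T) \_ (box a b)) \o Ti).
    by apply: measurable_funTS; exact: measurableT_comp.
  apply: eq_measurable_fun => x; rewrite inE => Ox /=.
  by rewrite patchE mem_set ?/= ?affine_invK//; exact/Omega_Ti.
have -> : \int[lam]_(x in Omega) (phi x * f x)%:E =
    \int[lam]_(x in Omega) (psi (Ti x) * f x)%:E +
    \int[lam]_(x in Omega) ((psi0 (Ti x) - psi (Ti x)) * f x)%:E.
  rewrite -integralD//; apply: ae_eq_integral => //.
  - by apply/measurable_EFinP; exact: measurable_funM.
  - by apply: emeasurable_funD; [exact: measurable_int i1|exact: measurable_int i2].
  - by apply: filterS phiE => x h Ox; rewrite h// -EFinD; congr EFin; ring.
apply: (le_trans (lee_abs_add _ _)); apply: leeD.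
  rewrite integral_Omega_interior// -EFin_Rintegral//.
    exact: interior_measurable.
  by apply: integrableS i1 => //; [exact: interior_measurable|exact: interior_subset].
rewrite nE; apply: (le_trans (le_abse_integral _ mO (measurable_int _ i2))).
rewrite -[leRHS]mule1 -f1 -integralZl//.
apply: ae_ge0_le_integral => //.
- by apply: measurableT_comp => //; exact: measurable_int i2.
- by move=> x Ox; rewrite -EFinM lee_fin mulr_ge0// f0.
- by apply: emeasurable_funM => //; exact/measurable_EFinP.
- apply: filterS rho_n => x h Ox; rewrite -EFinM abse_EFin lee_fin normrM (ger0_norm (f0 _ Ox)).
  by rewrite ler_wpM2r ?h// f0.
Qed.

End assembly.

(** * The two bounds *)

Section line_bound.
Context {R : realType} {d : nat}.
Local Notation E := 'cV[R]_d.
Local Notation lam := (@lebesgue_cV R d).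
Variables (a b : 'I_d -> R) (ab : forall i, a i < b i).
Variables (M : 'M[R]_d) (M_unit : M \in unitmx) (c : E).
Local Notation T := (affine M c).
Local Notation Ti := (affine_inv M c).
Local Notation Omega := (T @` box a b).
Variables (f : E -> R) (fi : lam.-integrable Omega (EFin \o f)).
Hypothesis f_grad : exists Df, is_gradient_measure Omega f Df.

Lemma line_int_obox i (psi : E -> R) y : bmeas psi -> line_int a b i psi y = 0 ->
  line_int a b i (fun x => psi x * \1_(obox a b) x) y = 0.
Proof.
move=> bp p0.
have [yo|/existsNP[j /not_implyP[ji nj]]] := pselect (forall j, j != i -> y j ord0 \in `]a j, b j[).
  have ik := kop_integrable i y (kern_int a b i) bp.
  rewrite -p0 /line_int /kop /ker_int.
  rewrite -[RHS](Rintegral_oo_cc (F := fun t => psi (set_coord y i t)) ik).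
  apply: eq_Rintegral => t _; rewrite -mulrA; congr (_ * _); rewrite !indicE -natrM mulnb.
  congr (nat_of_bool _)%:R; apply/andP/idP; rewrite !inE.
    by move=> [/(obox_set_coord t yo)].
  move=> /= ti; split; first exact/(obox_set_coord t yo).
  by move: ti; rewrite !in_itv/= => /andP[/ltW -> /ltW ->].
rewrite /line_int /kop (_ : (fun t => _) = fun=> 0) ?Rintegral_cst ?mul0r//.
apply/funext => t; rewrite [X in _ * X * _]indicE memNset ?mulr0 ?mul0r// => /(_ j).
by rewrite set_coordE (negbTE ji).
Qed.

(** The bound L holds on almost every line only. Since the bad points form whole
    lines, making psi zero there preserves mean zero in direction i; it changes
    psi on a null set. *)
Lemma line_bound i psi (L : R) : bmeas psi -> line_int a b i psi = (fun=> 0) -> 0 <= L ->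
  {ae lam, forall y, obox a b y -> line_int a b i (fun x => `|psi x|) y <= L} ->
  ((`|\int[lam]_(x in Omega°) (psi (Ti x) * f x)|)%:E <=
    (2^-1 * L)%:E * directional_variation Omega f (M *m basis_vec i))%E.
Proof.
move=> bp p0 L0 pL; set n := line_int a b i (fun x => `|psi x|).
have bn : bmeas n by apply: bmeas_kop (kern_int a b i) (bmeas_norm bp).
pose G := [set y | n y <= L].
have mG : measurable G.
  rewrite -[X in measurable X]setTI.
  have := bn.1 measurableT `]-oo, L]%classic (measurable_itv _).
  by congr measurable; apply/seteqP; split => y /=; rewrite in_itv.
have mo := @measurable_obox R d a b.
(* The indicator of G is kept apart, being constant along direction i. *)
pose q y := psi y * \1_(obox a b) y.
have bq : bmeas q by apply: bmeasM => //; exact: bmeas_indic.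
pose psi' y := q y * \1_G y.
have bp' : bmeas psi' by apply: bmeasM => //; exact: bmeas_indic.
have GE y t : \1_G (set_coord y i t) = \1_G y :> R.
  by rewrite !indicE; congr (nat_of_bool _)%:R; apply/idP/idP; rewrite !inE /G/= /n line_int_set_coord.
have <- : \int[lam]_(x in Omega°) (psi' (Ti x) * f x) = \int[lam]_(x in Omega°) (psi (Ti x) * f x).
  have iO := integrable_interior M_unit fi.
  have mO := @interior_measurable R d a b M c.
  have mTi := @measurable_affine_inv R d M c.
  rewrite /Rintegral; congr fine; apply: ae_eq_integral => //.
  - exact: measurable_int (integrable_bmeas mO mTi iO bp').
  - exact: measurable_int (integrable_bmeas mO mTi iO bp).
  have := ae_affine_inv M_unit c pL; apply: filterS => x h Ox.
  have xo : obox a b (Ti x) by move: Ox; rewrite interior_affine_box.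
  by rewrite /psi' /q !indicE !mem_set ?mulr1//; exact: h.
apply: weak_bound => //.
- by move=> y yo; rewrite /psi' /q indicE memNset ?mulr0 ?mul0r.
- apply/funext => y; rewrite line_int_mulr// line_int_obox ?mul0r//.
  by rewrite p0.
move=> y; rewrite (_ : (fun x => `|psi' x|) = fun x => `|q x| * \1_G x); last first.
  by apply/funext => x; rewrite normrM (ger0_norm (_ : 0 <= \1_G x)).
rewrite line_int_mulr//; last exact: bmeas_norm.
rewrite indicE; have [|_] := boolP (y \in G); last by rewrite mulr0.
rewrite inE mulr1; apply: le_trans; apply: le_line_int; [exact: bmeas_norm..|].
move=> x; rewrite /q normrM ler_piMr// indicE.
by case: (_ \in _); rewrite ?normr1 ?normr0.
Qed.

End line_bound.

Section fibres.
Context {R : realType} {d : nat}.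
Local Notation E := 'cV[R]_d.
Local Notation lam := (@lebesgue_cV R d).
Local Notation lebR := (@lebesgue_measure R).
Variables (a b : 'I_d -> R) (ab : forall i, a i < b i).
Variables (M : 'M[R]_d) (M_unit : M \in unitmx) (c : E).
Local Notation T := (affine M c).
Local Notation Omega := (T @` box a b).
Variables (f phi : E -> R) (f_dens : prob_density Omega f).
Variables (psi0 : E -> R) (bpsi0 : bmeas psi0).
Hypothesis mphi : measurable_fun setT ((phi \o T) \_ (box a b)).
Hypothesis phi_psi0 : {ae lam, forall y, ((phi \o T) \_ (box a b)) y = psi0 y}.
Variables (I : {set 'I_d}) (I_gt0 : (0 < #|I|)%N).
Let psi := mean_free a b (enum I) psi0.
Let bpsi : bmeas psi. Proof. exact: bmeas_mean_free. Qed.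

Local Open Scope ereal_scope.

(** Both quantities Lambda are suprema over w of integrals over the fibre of
    points gam w u with u in D: segments in one case, blocks of coordinates in
    the other. On almost every fibre P phi may be replaced by psi, whose
    boundedness makes the supremum finite. *)
Lemma fibre_sup d1 d2 (W : measurableType d1) (U : measurableType d2)
    (mu : {measure set W -> \bar R}) (m : {measure set U -> \bar R})
    (C : set W) (D : set U) (gam : W -> U -> E) (V : R) :
  measurable C -> mu C != 0 -> measurable D -> m D = V%:E ->
  (forall w, measurable_fun setT (gam w)) ->
  (forall w u, C w -> D u -> box a b (gam w u)) ->
  (forall N, measurable N -> lam N = 0 -> {ae mu, forall w, m [set u | N (gam w u)] = 0}) ->
  exists L : R, [/\ (0 <= L)%R,
    ess_sup_on mu C (fun w => \int[m]_(u in D) `|P_T a b M c I phi (T (gam w u))|%:E) = L%:E &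
    {ae mu, forall w, C w -> \int[m]_(u in D) `|psi (gam w u)|%:E <= L%:E}].
Proof.
move=> mC C0 mD DV mg gB gN.
(* On the box this is (P phi) o T, and it is measurable on the whole space. *)
pose Pm := mean_free a b (enum I) ((phi \o T) \_ (box a b)).
have mPm : measurable_fun setT Pm by exact: measurable_mean_free.
have PmE y : box a b y -> P_T a b M c I phi (T y) = Pm y.
  rewrite -[P_T a b M c I phi (T y)]/((P_T a b M c I phi \o T) y) P_T_affine//.
  by apply: mean_free_eq_box => z zB; rewrite patchE mem_set.
have mpsi w : measurable_fun D (fun u => `|psi (gam w u)|%:E).
  apply/measurable_EFinP; apply: measurableT_comp => //; apply: measurable_funTS.
  exact: (measurableT_comp bpsi.1).
have [N [mN N0 PN]] := ae_P_T M_unit bpsi0 mphi phi_psi0 I.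
have FE : {ae mu, forall w, C w -> \int[m]_(u in D) `|P_T a b M c I phi (T (gam w u))|%:E =
    \int[m]_(u in D) `|psi (gam w u)|%:E}.
  apply: filterS (gN _ mN N0) => w wN Cw; apply: ae_eq_integral => //.
    have : measurable_fun D (fun u => `|Pm (gam w u)|%:E).
      apply/measurable_EFinP; apply: measurableT_comp => //; apply: measurable_funTS.
      exact: (measurableT_comp mPm).
    apply: eq_measurable_fun => u; rewrite inE => Du.
    by rewrite PmE//; exact: gB.
  exists [set u | N (gam w u)]; split => //.
    by rewrite -[X in measurable X]setTI; exact: mg.
  move=> u /= h; apply: PN => /= e; apply: h => Du.
  by rewrite e//; exact: gB.
have [_ [K pK]] := bpsi.
have [L L0 LE] : exists2 L : R, (0 <= L)%R &
    ess_sup_on mu C (fun w => \int[m]_(u in D) `|P_T a b M c I phi (T (gam w u))|%:E) = L%:E.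
  apply: (ess_sup_on_fin (K := (K * V)%R)) => //; apply: filterS FE => w h Cw; rewrite h//.
  rewrite integral_ge0//= EFinM -DV -integral_cst//.
  by apply: ge0_le_integral => // u _; rewrite lee_fin.
exists L; split => //.
have := ess_sup_on_ge mu C (fun w => \int[m]_(u in D) `|P_T a b M c I phi (T (gam w u))|%:E).
by rewrite LE; apply: filterS2 FE => w h1 h2 Cw; rewrite -h1//; exact: h2.
Qed.

Lemma box_on_nonnull (J : {set 'I_d}) : @lebesgue_cV R #|J| (box_on a b (J := J)) != 0.
Proof.
have := box_on_volume ab J; move=> ->; rewrite eqe gt_eqF//.
by apply: prodr_gt0 => i _; rewrite subr_gt0.
Qed.

Lemma psi_mean_free i : i \in I -> line_int a b i psi = fun=> 0%R.
Proof. by move=> iI; apply: line_int_mean_free => //; rewrite mem_enum. Qed.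

Lemma smooth_part : Ck_closure #|I| Omega f ->
  `|\int[lam]_(x in Omega) (phi x * f x)%:E| <=
    ((2 ^+ #|I|)^-1)%:E * Lambda_mixT a b M c I (P_T a b M c I phi) *
      (\int[lam]_(x in Omega°) `|mixed_derivative I (fun i => M *m basis_vec i) f x|%:E) +
    Linfty_norm Omega (R_T a b M c I phi).
Proof.
move=> Cf.
have [L [L0 LE pL]] : exists L : R, [/\ (0 <= L)%R,
    Lambda_mixT a b M c I (P_T a b M c I phi) = L%:E &
    {ae @lebesgue_cV R #|~: I|, forall w, box_on a b w ->
      \int[@lebesgue_cV R #|I|]_(u in box_on a b (J := I)) `|psi (embed w + embed u)%R|%:E <= L%:E}].
  apply: (@fibre_sup _ _ _ _ (@lebesgue_cV R #|~: I|) (@lebesgue_cV R #|I|)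
    _ (box_on a b (J := I)) (fun w u => embed w + embed u)%R (\prod_(i <- enum I) (b i - a i))%R).
  - exact: measurable_box_on.
  - exact: box_on_nonnull.
  - exact: measurable_box_on.
  - exact: box_on_volume.
  - by move=> w; exact: (measurableT_comp (@measurable_glue R d I) (measurable_pair1 w)).
  - by move=> w u Cw Du; exact: (box_glue a b (w, u)).2 (conj Cw Du).
  - exact: ae_glue_null.
rewrite LE -EFinM.
apply: (split_bound ab M_unit f_dens bpsi0 mphi phi_psi0).
  by rewrite mule_ge0 ?integral_ge0// lee_fin mulr_ge0// invr_ge0 exprn_ge0.
by apply: smooth_bound => //; exact: psi_mean_free.
Qed.

(** Every direction i of I yields a bound with constant 1/2, in which the
    supremum for i is at most the maximum; the k bounds are averaged. *)
Lemma BV_part : BV Omega f ->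
  `|\int[lam]_(x in Omega) (phi x * f x)%:E| <=
    ((2 * #|I|)%:R^-1)%:E * Lambda_slT a b M c I (P_T a b M c I phi) *
      (\sum_(i in I) directional_variation Omega f (M *m basis_vec i)) +
    Linfty_norm Omega (R_T a b M c I phi).
Proof.
move=> [fi f_grad].
have sup i : exists L : R, [/\ (0 <= L)%R,
    ess_sup_on (@lebesgue_cV R #|~: [set i]|) (box_on a b (J := ~: [set i]))
      (fun w => \int[lebR]_(t in `[a i, b i]) `|P_T a b M c I phi (T (embed w + t *: basis_vec i)%R)|%:E) = L%:E &
    {ae @lebesgue_cV R #|~: [set i]|, forall w, box_on a b w ->
      \int[lebR]_(t in `[a i, b i]) `|psi (embed w + t *: basis_vec i)%R|%:E <= L%:E}].
  have vol : lebR `[a i, b i]%classic = (b i - a i)%:E.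
    by rewrite lebesgue_measure_itv/= lte_fin ab EFinB.
  apply: (@fibre_sup _ _ _ (measurableTypeR R) (@lebesgue_cV R #|~: [set i]|) lebR
    _ `[a i, b i]%classic (fun w t => embed w + t *: basis_vec i)%R (b i - a i)%R) => //.
  - exact: measurable_box_on.
  - exact: box_on_nonnull.
  - by move=> w; exact: (measurableT_comp (@measurable_glue1 R d i) (measurable_pair1 w)).
  - move=> w t wC; rewrite /= in_itv/= => ti; rewrite -[X in box a b X]/(@glue1 R d i (w, t)).
    rewrite glue1_set_coord; apply/box_set_coord; split => // j ji.
    have jJ' : j \in ~: [set i] by rewrite !inE.
    by have [k ->] := enum_valP_ex jJ'; rewrite embedE; exact: wC.
  - exact: ae_glue1_null.
have [L LP] := choice sup.
set V := fun i => directional_variation Omega f (M *m basis_vec i).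
have V0 i : 0 <= V i by exact: measure_ge0.
set Lam := Lambda_slT _ _ _ _ _ _.
have LamE : Lam = \big[maxe/-oo]_(i in I) (L i)%:E.
  by apply: eq_bigr => i _; have [_ + _] := LP i.
have LLam i : i \in I -> (L i)%:E <= Lam.
  by move=> iI; rewrite LamE; apply: le_bigmax_cond.
have Lam0 : 0 <= Lam.
  have [i iI] := card_gt0P I_gt0.
  by apply: le_trans (LLam i iI); rewrite lee_fin; have [] := LP i.
have S0 : 0 <= \sum_(i in I) V i by apply: sume_ge0.
apply: (split_bound ab M_unit f_dens bpsi0 mphi phi_psi0).
  by rewrite !mule_ge0// lee_fin invr_ge0.
set A := `|_|%R.
have AV i : i \in I -> A%:E <= 2^-1%:E * Lam * V i.
  move=> iI; have [L0 _ pL] := LP i.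
  apply: (@le_trans _ _ ((2^-1 * L i)%:E * V i)); last first.
    by rewrite EFinM lee_wpmul2r// lee_wpmul2l// LLam.
  apply: line_bound => //; first exact: psi_mean_free.
  have := ae_away pL; apply: filterS => y h yo.
  have yC : box_on a b (away i y) by move=> k; rewrite mxE; exact: (obox_sub yo).
  rewrite -lee_fin; apply: le_trans (h yC).
  rewrite (EFin_Rintegral _ (kop_integrable i y (kern_int a b i) (bmeas_norm bpsi)))//.
  rewrite le_eqVlt; apply/orP; left; apply/eqP; rewrite [RHS]integral_mkcond.
  apply: eq_integral => t _; rewrite patchE /ker_int indicE set_coord_away.
  by case: (_ \in _); rewrite ?mulr1 ?mulr0.
have k0 : (0 < #|I|%:R :> R)%R by rewrite ltr0n.
have kA : #|I|%:R%:E * A%:E <= 2^-1%:E * Lam * \sum_(i in I) V i.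
  rewrite ge0_sume_distrr//; apply: le_trans (lee_sum _ AV).
  by rewrite sumEFin sumr_const -EFinM mulr_natl.
have -> : A%:E = (#|I|%:R^-1)%:E * (#|I|%:R%:E * A%:E).
  by rewrite -!EFinM mulrA mulVf ?mul1r ?gt_eqF.
rewrite natrM invfM mulrC EFinM -!muleA lee_wpmul2l ?muleA//.
Qed.

End fibres.

(* The mixed derivative of f is only defined in the interior of Omega; the
   boundary of Omega is a null set. *)
Theorem theoremA31 (R : realType) (d : nat) (d_gt0 : (0 < d)%N)
  (a b : 'I_d -> R) (ab : forall i, a i < b i)
  (M : 'M[R]_d) (M_unit : M \in unitmx) (c : 'cV[R]_d)
  (I : {set 'I_d}) (I_neq0 : (0 < #|I|)%N)
  (f phi : 'cV[R]_d -> R) :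
  let S := box a b in
  let T := affine M c in
  let Omega := T @` S in
  let v i := M *m basis_vec i in
  let lambda := @lebesgue_cV R d in
  prob_density Omega f ->
  (BV Omega f -> Linfty S (phi \o T) ->
   (`| \int[lambda]_(x in Omega) (phi x * f x)%:E | <=
     ((2 * #|I|)%:R^-1)%:E * Lambda_slT a b M c I (P_T a b M c I phi) *
       (\sum_(i in I) directional_variation Omega f (v i)) +
     Linfty_norm Omega (R_T a b M c I phi))%E) /\
  (Ck_closure #|I| Omega f -> Linfty S (phi \o T) ->
   (`| \int[lambda]_(x in Omega) (phi x * f x)%:E | <=
     ((2 ^+ #|I|)^-1)%:E * Lambda_mixT a b M c I (P_T a b M c I phi) *
       (\int[lambda]_(x in Omega°) `| mixed_derivative I v f x |%:E) +
     Linfty_norm Omega (R_T a b M c I phi))%E).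
Proof.
move=> S T Omega v lambda f_dens; split => [f_BV|f_Ck] /bounded_representative[psi [bpsi mphi phiE]].
  exact: (BV_part ab M_unit f_dens bpsi mphi phiE I_neq0 f_BV).
exact: (smooth_part ab M_unit f_dens bpsi mphi phiE f_Ck).
Qed.
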